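(* There is a $7.249$-approximation algorithm for $P \mid r_j \mid \sum w_S C_S$ and a $10.874$-approximation algorithm for $Q \mid r_j \mid \sum w_S C_S$.
   Context: Machine scheduling with group completion times: a set $J$ of jobs, job $j$ with processing requirement $p_j$ and release date $r_j$; a family $\mathcal{S} \subseteq 2^J$ of groups with weights $w_S > 0$; $m$ parallel machines. Each job must be processed non-preemptively on a single machine, starting no earlier than $r_j$, and each machine processes at most one job at a time. In $P \mid r_j \mid \sum w_S C_S$ the machines are identical (job $j$ takes time $p_j$ on any machine); in $Q \mid r_j \mid \sum w_S C_S$ machine $i$ has speed $s_i > 0$ and job $j$ takes time $p_j / s_i$ on machine $i$. $C_j$ is the completion time of job $j$, $C_S = \max_{j \in S} C_j$, and the objective is to minimize $\sum_{S} w_S C_S$. An $\alpha$-approximation algorithm runs in polynomial time and outputs a solution of cost at most $\alpha$ times the optimum. *)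

(* Defs.v *)
From mathcomp Require Import all_boot all_order all_algebra.

Set Implicit Arguments.
Unset Strict Implicit.
Unset Printing Implicit Defensive.

Import Order.TTheory GRing.Theory Num.Theory.

(* Polynomial time is measured on structured programs for a logarithmic-cost
   RAM.  The memory is an infinite array of natural numbers.  Every evaluation step
   is charged the number of binary digits of the value it produces (constants,
   addresses, fetched contents and results alike), so a computation of cost t
   only ever handles numbers of at most t bits: up to a polynomial, cost is
   Turing machine time. *)

Definition bits (n : nat) : nat := (trunc_log 2 n).+1.

Definition memory := nat -> nat.

Inductive expr : Type :=
| Const of nat
| Fetch of expr
| Add of expr & expr
| Sub of expr & expr
| Mul of expr & expr
| Div of expr & expr
| Mod of expr & expr.

Inductive cmd : Type :=
| Skip
| Store of expr & expr
| Seq of cmd & cmd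
| If of expr & cmd & cmd
| While of expr & cmd.

(* [Sub] is truncated subtraction; [Div] and [Mod] by 0 follow [divn], [modn]. *)
Fixpoint eval (mem : memory) (e : expr) : nat :=
  match e with
  | Const n => n
  | Fetch a => mem (eval mem a)
  | Add e1 e2 => eval mem e1 + eval mem e2
  | Sub e1 e2 => eval mem e1 - eval mem e2
  | Mul e1 e2 => eval mem e1 * eval mem e2
  | Div e1 e2 => eval mem e1 %/ eval mem e2
  | Mod e1 e2 => eval mem e1 %% eval mem e2
  end.

Fixpoint eval_cost (mem : memory) (e : expr) : nat :=
  bits (eval mem e) +
  match e with
  | Const _ => 0
  | Fetch a => eval_cost mem a
  | Add e1 e2 | Sub e1 e2 | Mul e1 e2 | Div e1 e2 | Mod e1 e2 =>
      eval_cost mem e1 + eval_cost mem e2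
  end.

Definition update (mem : memory) (a v : nat) : memory :=
  fun b => if b == a then v else mem b.

(* [exec c mem mem' t]: started on [mem], [c] halts with memory [mem'] at cost
   [t].  A condition is true when its value is nonzero. *)
Inductive exec : cmd -> memory -> memory -> nat -> Prop :=
| ExecSkip mem : exec Skip mem mem 1
| ExecStore mem a e :
    exec (Store a e) mem (update mem (eval mem a) (eval mem e))
      (eval_cost mem a + eval_cost mem e).+1
| ExecSeq c1 c2 mem mem1 mem2 t1 t2 :
    exec c1 mem mem1 t1 -> exec c2 mem1 mem2 t2 ->
    exec (Seq c1 c2) mem mem2 (t1 + t2).+1
| ExecIfTrue e c1 c2 mem mem' t :
    eval mem e != 0 -> exec c1 mem mem' t ->
    exec (If e c1 c2) mem mem' (eval_cost mem e + t).+1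
| ExecIfFalse e c1 c2 mem mem' t :
    eval mem e = 0 -> exec c2 mem mem' t ->
    exec (If e c1 c2) mem mem' (eval_cost mem e + t).+1
| ExecWhileTrue e c mem mem1 mem2 t1 t2 :
    eval mem e != 0 -> exec c mem mem1 t1 -> exec (While e c) mem1 mem2 t2 ->
    exec (While e c) mem mem2 (eval_cost mem e + t1 + t2).+1
| ExecWhileFalse e c mem :
    eval mem e = 0 -> exec (While e c) mem mem (eval_cost mem e).+1.

(* The input word occupies the cells 0, 1, 2, ...; all other cells hold 0. *)
Definition init_memory (s : seq nat) : memory := nth 0 s.

Definition input_size (s : seq nat) : nat := \sum_(x <- s) bits x.

Local Open Scope ring_scope.

Record min_problem : Type := MinProblem {
  instance : Type;
  valid : instance -> Prop;
  encode : instance -> seq nat;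
  solution : instance -> Type;
  (* [written mem s]: the final memory [mem] contains the solution [s] *)
  written : forall x : instance, memory -> solution x -> Prop;
  feasible : forall x : instance, solution x -> Prop;
  cost : forall x : instance, solution x -> rat
}.

(* [exec] is deterministic, so exhibiting one halting run describes the run of
   [c] on [x].  The last clause bounds [cost s] by [alpha] times the infimum of
   the costs, without presupposing that it is attained. *)
Definition approximation_algorithm (Pb : min_problem) (alpha : rat) (c : cmd) :
    Prop :=
  exists T : {poly nat}, forall x : instance Pb, valid x ->
    exists (mem : memory) (t : nat) (s : solution x),
      [/\ exec c (init_memory (encode x)) mem t,
          (t <= T.[input_size (encode x)])%N,
          written mem s,
          feasible s &
          forall s' : solution x, feasible s' -> cost s <= alpha * cost s'].

Record job_data : Type := JobData {
  njobs : nat;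
  proc : 'I_njobs -> rat;
  release : 'I_njobs -> rat;
  groups : seq ({set 'I_njobs} * rat) (* the pairs (S, w_S) *)
}.

(* The distinctness clause makes the list of groups a family in the sense of a set of subsets. *)
Definition valid_jobs (J : job_data) : Prop :=
  [/\ forall j : 'I_(njobs J), 0 <= proc j,
      forall j : 'I_(njobs J), 0 <= release j,
      uniq [seq g.1 | g <- groups J] &
      forall g, g \in groups J -> 0 < g.2].

(* [sched j] is the machine and the start time of job [j]; with rational data,
   starting each job as early as its machine's order allows shows that rational
   start times do not change the optimum. *)
Definition schedule (m n : nat) : Type := {ffun 'I_n -> 'I_m * rat}.

Section Schedules.

Variables (m : nat) (J : job_data).
(* [dur i j] is the time job [j] takes on machine [i]. *)
Variable dur : 'I_m -> 'I_(njobs J) -> rat.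
Variable sched : schedule m (njobs J).

Definition machine_of (j : 'I_(njobs J)) : 'I_m := (sched j).1.

Definition start (j : 'I_(njobs J)) : rat := (sched j).2.

Definition completion (j : 'I_(njobs J)) : rat :=
  start j + dur (machine_of j) j.

(* Times are nonnegative, whence the default value for the empty group. *)
Definition group_completion (S : {set 'I_(njobs J)}) : rat :=
  \big[Num.max/0]_(j in S) completion j.

Definition weighted_completion : rat :=
  \sum_(g <- groups J) g.2 * group_completion g.1.

(* Jobs of length 0 occupy a place in the order of their machine too: they do
   not run in the interior of another job. *)
Definition feasible_schedule : Prop :=
  (forall j, release j <= start j) /\
  (forall j k, j != k -> machine_of j = machine_of k ->
     completion j <= start k \/ completion k <= start j).

(* Job [j] owns the cells 3j, 3j+1, 3j+2 of the output: its machine, and the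
   numerator and denominator (not necessarily coprime) of its start time. *)
Definition written_schedule (mem : memory) : Prop :=
  forall j : 'I_(njobs J),
    [/\ mem (3 * j)%N = machine_of j,
        mem (3 * j + 2)%N != 0%N &
        start j = (mem (3 * j + 1)%N)%:R / (mem (3 * j + 2)%N)%:R].

End Schedules.

(* Only used on nonnegative numbers, for which no sign is needed. *)
Definition encode_rat (q : rat) : seq nat := [:: `|numq q|%N; `|denq q|%N].

(* A group is listed as its weight followed by its incidence vector. *)
Definition encode_jobs (J : job_data) : seq nat :=
  flatten [seq encode_rat (proc j) ++ encode_rat (release j)
          | j <- enum 'I_(njobs J)] ++
  flatten [seq encode_rat g.2 ++
               [seq nat_of_bool (j \in (g.1 : {set 'I_(njobs J)}))
                   | j <- enum 'I_(njobs J)]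
          | g <- groups J].

Record P_instance : Type := PInstance {
  P_machines : nat;
  P_jobs : job_data
}.

Definition P_dur (x : P_instance) (i : 'I_(P_machines x))
    (j : 'I_(njobs (P_jobs x))) : rat := proc j.

Definition P_encode (x : P_instance) : seq nat :=
  [:: P_machines x; njobs (P_jobs x); size (groups (P_jobs x))] ++
  encode_jobs (P_jobs x).

Definition P_rj_sum_wSCS : min_problem := {|
  instance := P_instance;
  valid := fun x => (0 < P_machines x)%N /\ valid_jobs (P_jobs x);
  encode := P_encode;
  solution := fun x => schedule (P_machines x) (njobs (P_jobs x));
  written := fun x mem s => written_schedule s mem;
  feasible := fun x s => feasible_schedule (@P_dur x) s;
  cost := fun x s => weighted_completion (@P_dur x) s
|}.

Record Q_instance : Type := QInstance {
  Q_machines : nat;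
  speed : 'I_Q_machines -> rat;
  Q_jobs : job_data
}.

Definition Q_dur (x : Q_instance) (i : 'I_(Q_machines x))
    (j : 'I_(njobs (Q_jobs x))) : rat := proc j / speed i.

Definition Q_encode (x : Q_instance) : seq nat :=
  [:: Q_machines x; njobs (Q_jobs x); size (groups (Q_jobs x))] ++
  flatten [seq encode_rat (speed i) | i <- enum 'I_(Q_machines x)] ++
  encode_jobs (Q_jobs x).

Definition Q_rj_sum_wSCS : min_problem := {|
  instance := Q_instance;
  valid := fun x => [/\ (0 < Q_machines x)%N,
                        forall i : 'I_(Q_machines x), 0 < speed i &
                        valid_jobs (Q_jobs x)];
  encode := Q_encode;
  solution := fun x => schedule (Q_machines x) (njobs (Q_jobs x));
  written := fun x mem s => written_schedule s mem;
  feasible := fun x s => feasible_schedule (@Q_dur x) s;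
  cost := fun x s => weighted_completion (@Q_dur x) s
|}.

(* Main.v *)
Require Import Defs.
From mathcomp Require Import all_boot all_order all_algebra.
From mathcomp Require Import zify ring lra.
Local Open Scope ring_scope.
(* Time is scaled to the naturals and cut along a grid of ratio 41/40.  A schedule
   yields a 0/1 solution of a linear program whose variables say by which grid
   time each job, and each group, is finished; a packing row for each job [j] and
   each time bounds the work of the jobs at least as long as [j].  Guessing the
   optimal cost turns the program into a mixed packing and covering system, which
   multiplicative weights solve up to a factor 1.05 in integer arithmetic.

   For every threshold [i/40], a job is put in the block of the first grid time by
   which its fraction reaches the threshold, and the blocks are scheduled one after
   the other by a greedy rule.  On identical machines a job of block [b] completes
   by [(2 + 42/i) b].  On related machines blocks are first merged with a period of
   40 grid steps and a random-like offset, so that each base is at least 2.65 times the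
   previous one, and every block waits for the previous ones, the longest jobs first.
   The best schedule over all thresholds and offsets is at most a suitable average,
   which is within 5 resp. 10 times the guess; two roundings to the grid cost
   [(41/40)^2], which gives 5.26 < 7.249 and 10.51 < 10.874.

   The algorithms are written in a small language of loops over arrays, compiled
   once and for all to the RAM with a polynomial cost bound. *)
Set Implicit Arguments.
Unset Strict Implicit.
Unset Printing Implicit Defensive.
Import Order.TTheory GRing.Theory Num.Theory.
Local Close Scope ring_scope.

(** A group completes with its last member, so a bound on the average completion time of each single
    job says nothing about a group. All jobs therefore share the threshold: if at some time one
    member of a group has not reached the threshold a, the covering rows force the fraction by which
    the group is unfinished above 1 - a, and this one variable pays for all members at once. A small
    threshold is paid for in load: a job present with fraction a may weigh 1/a times as much, which
    for a = i/40 and a solver error of 1.05 gives 42/i. Packing rows are indexed by jobs because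
    jobs at least as long as j that are done by time t occupy only machines able to process j within
    t; comparing loads on just these machines lets the greedy rule work for any speeds. Resource
    bounds shape the rest: numbers may have only polynomially many bits, the number of identical
    machines is given in binary, and durations must be exact integers. Hence integer weights over a
    common denominator, no more identical machines than can be of use, and data scaled by the
    product of all speeds. *)

(** * Runs with a time bound and a postcondition *)

Definition runs (c : cmd) (mem : memory) (T : nat) (Q : memory -> Prop) : Prop :=
  exists mem' t, [/\ exec c mem mem' t, t <= T & Q mem'].

Lemma runs_weaken c mem T T' (Q Q' : memory -> Prop) :
  runs c mem T Q -> T <= T' -> (forall mem', Q mem' -> Q' mem') ->
  runs c mem T' Q'.
Proof.
move=> [mem' [t [e le_t q]]] leT QQ'; exists mem', t; split=> //; last exact: QQ'.
exact: leq_trans leT.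
Qed.

Lemma runs_seq c1 c2 mem T1 T2 (Q R : memory -> Prop) :
  runs c1 mem T1 Q -> (forall mem', Q mem' -> runs c2 mem' T2 R) ->
  runs (Seq c1 c2) mem (T1 + T2).+1 R.
Proof.
move=> [mem1 [t1 [e1 l1 /[swap] /[apply] -[mem2 [t2 [e2 l2 r]]]]]].
exists mem2, (t1 + t2).+1; split=> //; first exact: ExecSeq e1 e2.
by rewrite ltnS leq_add.
Qed.

(** The index of the invariant [I] is the number of iterations still to come, so that termination
    and the time bound come together. *)
Lemma runs_while (I : nat -> memory -> Prop) e c Te Tc :
  (forall k mem, I k.+1 mem ->
     [/\ eval mem e != 0, eval_cost mem e <= Te & runs c mem Tc (I k)]) ->
  (forall mem, I 0 mem -> eval mem e = 0 /\ eval_cost mem e <= Te) ->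
  forall k mem, I k mem -> runs (While e c) mem (k.+1 * (Te + Tc).+1) (I 0).
Proof.
move=> step stop; elim=> [|k IHk] mem Imem.
  have [e0 lee] := stop _ Imem; exists mem, (eval_cost mem e).+1; split=> //.
  exact: ExecWhileFalse.
  by rewrite mul1n ltnS (leq_trans lee) ?leq_addr.
have [en0 lee [mem1 [t1 [e1 l1 /IHk[mem2 [t2 [e2 l2 I0]]]]]]] := step _ _ Imem.
exists mem2, (eval_cost mem e + t1 + t2).+1; split=> //.
  exact: ExecWhileTrue e1 e2.
by rewrite mulSn; lia.
Qed.

(** * Sizes of values and costs of expressions *)

Definition bounded (W : nat) (mem : memory) : Prop := forall x, mem x < 2 ^ W.

(** Bounds the length of a value in multiples of the word length [W] of the memory: sums and
    products add lengths, while truncated subtraction, quotient and remainder never exceed their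
    first operand. Evaluation costs are therefore linear in [W]. *)
Fixpoint esize (e : expr) : nat :=
  match e with
  | Const n => bits n
  | Fetch _ => 1
  | Add e1 e2 | Mul e1 e2 => esize e1 + esize e2
  | Defs.Sub e1 _ | Div e1 _ | Mod e1 _ => esize e1
  end.

Fixpoint ecost (e : expr) : nat :=
  esize e +
  match e with
  | Const _ => 0
  | Fetch e1 => ecost e1
  | Add e1 e2 | Defs.Sub e1 e2 | Mul e1 e2 | Div e1 e2 | Mod e1 e2 =>
      ecost e1 + ecost e2
  end.

Lemma bits_le x k : 0 < k -> x < 2 ^ k -> bits x <= k.
Proof.
case: k => // k _ lt_x; rewrite /bits ltnS.
case: x lt_x => [|x] lt_x; first by rewrite trunc_log0.
by rewrite -ltnS -(ltn_exp2l _ _ (ltnSn 1)) (leq_ltn_trans _ lt_x) ?trunc_logP.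
Qed.

Lemma ltn_bits x : x < 2 ^ bits x.
Proof. exact: trunc_log_ltn. Qed.

Lemma esize_gt0 e : 0 < esize e.
Proof. by elim: e => //= e1 H1 e2 H2; rewrite addn_gt0 H1. Qed.

Lemma expn2D_gt x y a b : 0 < a -> 0 < b -> x < 2 ^ a -> y < 2 ^ b ->
  x + y < 2 ^ (a + b).
Proof.
case: a b => [|a] [|b] // _ _ lx ly; rewrite expnD.
have := expn_gt0 2 a; have := expn_gt0 2 b; rewrite /= => hb ha.
rewrite !expnS in lx ly *; nia.
Qed.

Lemma eval_lt W mem e : 0 < W -> bounded W mem -> eval mem e < 2 ^ (esize e * W).
Proof.
move=> W0 bm; have sW e' : 0 < esize e' * W by rewrite muln_gt0 esize_gt0.
elim: e => [n|e _|e1 H1 e2 H2|e1 H1 e2 H2|e1 H1 e2 H2|e1 H1 e2 H2|e1 H1 e2 H2] /=.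
- by apply: leq_trans (ltn_bits n) _; rewrite leq_exp2l // leq_pmulr.
- by rewrite mul1n; apply: bm.
- by rewrite mulnDl expn2D_gt.
- exact: leq_ltn_trans (leq_subr _ _) H1.
- by rewrite mulnDl expnD ltn_mul.
- exact: leq_ltn_trans (leq_div _ _) H1.
- exact: leq_ltn_trans (leq_mod _ _) H1.
Qed.

Lemma eval_cost_le W mem e : 0 < W -> bounded W mem ->
  eval_cost mem e <= ecost e * W.
Proof.
move=> W0 bm; have bl e' : bits (eval mem e') <= esize e' * W.
  by apply: bits_le; [rewrite muln_gt0 esize_gt0 | exact: eval_lt].
elim: e => [n|e H|e1 H1 e2 H2|e1 H1 e2 H2|e1 H1 e2 H2|e1 H1 e2 H2|e1 H1 e2 H2];
  set e' := (X in eval_cost _ X); have := bl e'; rewrite /e' /= !mulnDl ?addn0; lia.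
Qed.

Lemma runs_store W mem a e : 0 < W -> bounded W mem ->
  runs (Store a e) mem ((ecost a + ecost e) * W).+1
    (fun mem' => mem' = update mem (eval mem a) (eval mem e)).
Proof.
move=> W0 bm; exists (update mem (eval mem a) (eval mem e)).
exists (eval_cost mem a + eval_cost mem e).+1; split=> //; first exact: ExecStore.
by rewrite ltnS mulnDl leq_add // eval_cost_le.
Qed.

(** * Loop programs over arrays *)

(* Cell [i] of array [a] is the memory cell [width * i + a], so that all arrays
   are infinite and disjoint. *)
Notation width := 100.

Variant op := OAdd | OMul | OSub | ODiv | OMod | OMax | OMin | OLt | OLe | OEq | OAnd.

Definition op_eval (o : op) (x y : nat) : nat :=
  match o with
  | OAdd => x + y | OMul => x * y | OSub => x - y | ODiv => x %/ y
  | OMod => x %% y | OMax => maxn x y | OMin => minn x y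
  | OLt => x < y | OLe => x <= y | OEq => x == y
  | OAnd => (x != 0) && (y != 0)
  end.

Inductive hexp := K of nat | G of nat & hexp | B of op & hexp & hexp.

Definition store := nat -> nat -> nat.

Definition upd (s : store) (a i v : nat) : store :=
  fun b => if b == a then fun k => if k == i then v else s a k else s b.

Fixpoint hev (s : store) (e : hexp) : nat :=
  match e with
  | K n => n
  | G a i => s a (hev s i)
  | B o e1 e2 => op_eval o (hev s e1) (hev s e2)
  end.

Inductive hcmd :=
| Nop
| Set_ of nat & hexp & hexp
| Seq_ of hcmd & hcmd
| If_ of hexp & hcmd & hcmd
| For of nat & hexp & hcmd.

(* Values of safe expressions never exceed the largest cell. *)
Fixpoint safe (e : hexp) : bool :=
  match e with
  | K n => n <= 100
  | G _ _ => true
  | B o e1 e2 =>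
    match o with
    | OAdd | OMul => false
    | OSub | ODiv | OMod | OMin => safe e1
    | OMax => safe e1 && safe e2
    | _ => true
    end
  end.

Fixpoint assigned (c : hcmd) : seq nat :=
  match c with
  | Nop => [::]
  | Set_ a _ _ => [:: a]
  | Seq_ c1 c2 | If_ _ c1 c2 => assigned c1 ++ assigned c2
  | For v _ c1 => v :: assigned c1
  end.

(* The arrays holding the clamping constants [Y] and [Z]. *)
Notation rY := 2.
Notation rZ := 3.

Fixpoint wf_exp (e : hexp) : bool :=
  match e with
  | K _ => true
  | G a e1 => (a < width) && wf_exp e1
  | B _ e1 e2 => wf_exp e1 && wf_exp e2
  end.

Fixpoint wf (c : hcmd) : bool :=
  match c with
  | Nop => true
  | Set_ a e1 e2 => [&& a < width, a != rY, a != rZ, wf_exp e1 & wf_exp e2]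
  | Seq_ c1 c2 => wf c1 && wf c2
  | If_ e c1 c2 => [&& wf_exp e, wf c1 & wf c2]
  | For v e c1 =>
      [&& v < width, v != rY, v != rZ, wf_exp e, v \notin assigned c1 & wf c1]
  end.

Section Denotation.

Variables Y Z : nat.

Definition clamp (e : hexp) (x : nat) : nat := if safe e then x else x %% Z.

(* Results that could grow are reduced modulo [Z] and loop bounds are cut at [Y]:
   the cost of a program is then polynomial in [Y] by its mere syntax.
   The counter of the loop [For v e c] is cell 0 of array [v], its bound is kept
   in cell 1. *)
Fixpoint den (c : hcmd) (s : store) : store :=
  match c with
  | Nop => s
  | Set_ a e1 e2 => upd s a (hev s e1) (clamp e2 (hev s e2))
  | Seq_ c1 c2 => den c2 (den c1 s)
  | If_ e c1 c2 => if hev s e != 0 then den c1 s else den c2 s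
  | For v e c1 =>
      let N := minn (hev s e) Y in
      iteri N (fun i s' => upd (den c1 s') v 0 i.+1) (upd (upd s v 1 N) v 0 0)
  end.

(** Arrays are disjoint, so a syntactic test decides which of them a program leaves alone. This is
    how facts are carried across pieces of program. *)
Lemma den_frame c s a : a \notin assigned c -> den c s a = s a.
Proof.
elim: c s => [|b e1 e2|c1 H1 c2 H2|e c1 H1 c2 H2|v e c1 H1] s //=.
- by rewrite inE /upd => /negPf->.
- by rewrite mem_cat => /norP[a1 a2]; rewrite H2 // H1.
- by rewrite mem_cat => /norP[a1 a2]; case: ifP => _; [apply: H1 | apply: H2].
- rewrite inE => /norP[/negPf av a1]; set s0 := upd _ v 0 0.
  have <- : s0 a = s a by rewrite /s0 /upd av.
  by elim: (minn _ _) => //= k IHk; rewrite {1}/upd av H1.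
Qed.

(** The step may use that arrays outside the loop's assignments are those from before the loop, so
    the invariant has to speak only of what the body changes. It is stated for the store in which
    the counter has just been written. *)
Lemma for_rule (I : nat -> store -> Prop) v e c s :
  v \notin assigned c -> hev s e <= Y ->
  I 0 (upd (upd s v 1 (hev s e)) v 0 0) ->
  (forall i s', i < hev s e -> s' v 0 = i ->
     (forall a, a != v -> a \notin assigned c -> s' a = s a) ->
     I i s' -> I i.+1 (upd (den c s') v 0 i.+1)) ->
  I (hev s e) (den (For v e c) s).
Proof.
move=> vc le_eY I0 Istep /=; rewrite (minn_idPl le_eY).
pose F i s' := upd (den c s') v 0 i.+1.
set s0 := upd _ v 0 0 in I0 *.
have H k : k <= hev s e -> [/\ I k (iteri k F s0), iteri k F s0 v 0 = k &
    forall a, a != v -> a \notin assigned c -> iteri k F s0 a = s a].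
  elim: k => [|k IHk] lek /=.
    by split=> //; [rewrite /s0 /upd !eqxx | move=> a /negPf av _; rewrite /s0 /upd av].
  have [Ik vk fk] := IHk (ltnW lek); split; first exact: Istep.
    by rewrite /F /upd !eqxx.
  by move=> a av ac; rewrite /F /upd (negPf av) den_frame // fk.
by case: (H _ (leqnn _)).
Qed.

End Denotation.

(** * Compilation *)

(** The RAM has no comparisons: [1 - (1 - x)] tests whether [x] is nonzero, and [x + (y - x)] is the
    maximum, with truncated subtraction. Operands get duplicated, which only affects the constant
    size of the fixed program. *)
Definition cop (o : op) (x y : expr) : expr :=
  match o with
  | OAdd => Add x y | OMul => Mul x y | OSub => Defs.Sub x y | ODiv => Div x y
  | OMod => Mod x y | OMax => Add x (Defs.Sub y x) | OMin => Defs.Sub x (Defs.Sub x y)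
  | OLt => Defs.Sub (Const 1) (Defs.Sub (Const 1) (Defs.Sub y x))
  | OLe => Defs.Sub (Const 1) (Defs.Sub x y)
  | OEq => Defs.Sub (Const 1) (Add (Defs.Sub x y) (Defs.Sub y x))
  | OAnd => Defs.Sub (Const 1) (Defs.Sub (Const 1) (Mul x y))
  end.

Definition cell (a : nat) (i : expr) : expr := Add (Mul (Const width) i) (Const a).

Fixpoint cexp (e : hexp) : expr :=
  match e with
  | K n => Const n
  | G a i => Fetch (cell a (cexp i))
  | B o e1 e2 => cop o (cexp e1) (cexp e2)
  end.

Definition cclamp (e : hexp) : expr :=
  if safe e then cexp e else Mod (cexp e) (cexp (G rZ (K 0))).

Fixpoint ccmd (c : hcmd) : cmd :=
  match c with
  | Nop => Skip
  | Set_ a e1 e2 => Store (cell a (cexp e1)) (cclamp e2)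
  | Seq_ c1 c2 => Seq (ccmd c1) (ccmd c2)
  | If_ e c1 c2 => If (cexp e) (ccmd c1) (ccmd c2)
  | For v e c1 =>
      Seq (Store (cell v (Const 1)) (cexp (B OMin e (G rY (K 0)))))
     (Seq (Store (cell v (Const 0)) (Const 0))
          (While (cexp (B OSub (G v (K 1)) (G v (K 0))))
             (Seq (ccmd c1)
                (Store (cell v (Const 0)) (cexp (B OAdd (G v (K 0)) (K 1)))))))
  end.

Definition rep (s : store) (mem : memory) : Prop :=
  forall a i, a < width -> mem (width * i + a) = s a i.

Lemma cell_inj a b i j : a < width -> b < width ->
  (width * i + a == width * j + b) = (a == b) && (i == j).
Proof.
move=> aw bw; apply/eqP/andP => [|[/eqP-> /eqP->] //]; split; lia.
Qed.

Lemma rep_update s mem a i v : a < width -> rep s mem ->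
  rep (upd s a i v) (update mem (width * i + a) v).
Proof.
move=> aw r b j bw; rewrite /update /upd cell_inj // r //.
by case: eqP => [->|].
Qed.

Lemma eval_cexp s mem e : rep s mem -> wf_exp e -> eval mem (cexp e) = hev s e.
Proof.
move=> r; elim: e => [n|a i IH|o e1 H1 e2 H2] //=.
  by case/andP=> aw /IH ->; rewrite r.
by case/andP=> /H1 <- /H2 <-; case: o => /=; lia.
Qed.

Section CompileCorrect.

Variables Y Z W : nat.
Hypotheses (W_gt0 : 0 < W) (Y_Z : Y <= Z) (Z_W : Z < 2 ^ W) (Z_ge : 100 <= Z).

Definition small (s : store) : Prop :=
  [/\ forall a i, a < width -> s a i <= Z, s rY 0 = Y & s rZ 0 = Z].

Lemma small_upd s a i v : small s -> a != rY -> a != rZ -> v <= Z ->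
  small (upd s a i v).
Proof.
move=> [sZ sY sZ'] ay az vZ; split.
- move=> b j bw; rewrite /upd; case: ifP => [/eqP eb|_]; last exact: sZ.
  by case: ifP => // _; apply: sZ; rewrite -eb.
- by rewrite /upd eq_sym (negPf ay).
- by rewrite /upd eq_sym (negPf az).
Qed.

Lemma safe_le s e : small s -> wf_exp e -> safe e -> hev s e <= Z.
Proof.
move=> [sZ _ _]; elim: e => [n|a i _|o e1 H1 e2 H2] /=.
- by move=> _ /leq_trans; apply.
- by case/andP=> aw _ _; apply: sZ.
- have le1 (b : bool) : b <= Z by case: b; lia.
  case/andP=> w1 w2; case: o => //= sf.
  + exact: leq_trans (leq_subr _ _) (H1 w1 sf).
  + exact: leq_trans (leq_div _ _) (H1 w1 sf).
  + exact: leq_trans (leq_mod _ _) (H1 w1 sf).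
  + by case/andP: sf => s1 s2; rewrite geq_max H1 ?H2.
  + by rewrite geq_min H1.
Qed.

Lemma clamp_le s e : small s -> wf_exp e -> clamp Z e (hev s e) <= Z.
Proof.
move=> sm we; rewrite /clamp; case: ifP => [|_]; first exact: safe_le.
by apply: ltnW; rewrite ltn_mod; lia.
Qed.

Lemma rep_bounded s mem : small s -> rep s mem -> bounded W mem.
Proof.
move=> [sZ _ _] r x; rewrite (divn_eq x width) mulnC r ?ltn_mod //.
by apply: leq_ltn_trans Z_W; apply: sZ; rewrite ltn_mod.
Qed.

Lemma eval_clamp s mem e : small s -> rep s mem -> wf_exp e ->
  eval mem (cclamp e) = clamp Z e (hev s e).
Proof.
move=> [_ _ sZ] r we; rewrite /cclamp /clamp; case: ifP => _.
  exact: eval_cexp.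
rewrite [LHS]/= (eval_cexp r we); congr (_ %% _).
by rewrite -[RHS]sZ -(r rZ 0).
Qed.

Fixpoint ccost (c : hcmd) : nat :=
  match c with
  | Nop => 1
  | Set_ a e1 e2 => ((ecost (cell a (cexp e1)) + ecost (cclamp e2)) * W).+1
  | Seq_ c1 c2 => (ccost c1 + ccost c2).+1
  | If_ e c1 c2 => (ecost (cexp e) * W + (ccost c1 + ccost c2)).+1
  | For v e c1 =>
      (((ecost (cell v (Const 1)) + ecost (cexp (B OMin e (G rY (K 0))))) * W).+1 +
      (((ecost (cell v (Const 0)) + ecost (Const 0)) * W).+1 +
       Y.+1 * (ecost (cexp (B OSub (G v (K 1)) (G v (K 0)))) * W +
         (ccost c1 + ((ecost (cell v (Const 0)) +
           ecost (cexp (B OAdd (G v (K 0)) (K 1)))) * W).+1).+1).+1).+1).+1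
  end.

(** Clamping keeps every cell at most [Z < 2 ^ W] and every loop within [Y] rounds, whatever the
    program computes; hence the syntactic [ccost] bounds each run without any knowledge of the
    data. *)
Lemma ccmd_correct c s mem : wf c -> small s -> rep s mem ->
  runs (ccmd c) mem (ccost c)
    (fun mem' => small (den Y Z c s) /\ rep (den Y Z c s) mem').
Proof.
elim: c s mem => [|a e1 e2|c1 H1 c2 H2|e c1 H1 c2 H2|v e c1 H1] s mem.
- by exists mem, 1; split=> //; exact: ExecSkip.
- case/and5P=> aw ay az w1 w2 sm r.
  apply: runs_weaken (runs_store _ _ W_gt0 (rep_bounded sm r)) _ _ => // mem' ->.
  rewrite (eval_clamp sm r w2).
  have -> : eval mem (cell a (cexp e1)) = width * hev s e1 + a.
    by rewrite [LHS]/= (eval_cexp r w1).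
  by split; [apply: small_upd => //; apply: clamp_le | apply: rep_update].
- case/andP=> w1 w2 sm r; apply: runs_seq (H1 _ _ w1 sm r) _ => mem' [sm' r'].
  exact: H2.
- case/and3P=> we w1 w2 sm r.
  have ce := eval_cost_le (cexp e) W_gt0 (rep_bounded sm r).
  have ee := eval_cexp r we.
  have [e0|en0] := eqVneq (hev s e) 0.
    have [mem' [t [ex lt q]]] := H2 _ _ w2 sm r.
    exists mem', (eval_cost mem (cexp e) + t).+1; split.
    + by apply: ExecIfFalse ex; rewrite ee.
    + by rewrite [ccost _]/=; lia.
    + by rewrite [den _ _ _ _]/= e0 eqxx.
  have [mem' [t [ex lt q]]] := H1 _ _ w1 sm r.
  exists mem', (eval_cost mem (cexp e) + t).+1; split.
  + by apply: ExecIfTrue ex; rewrite ee.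
  + by rewrite [ccost _]/=; lia.
  + by rewrite [den _ _ _ _]/= en0.
- case/and5P=> vw vy vz we /andP[vc w1] sm r.
  set N := minn (hev s e) Y; set s1 := upd s v 1 N; set s2 := upd s1 v 0 0.
  have NY : N <= Y by rewrite geq_minr.
  have sm1 : small s1 by apply: small_upd => //; lia.
  have sm2 : small s2 by apply: small_upd.
  rewrite /=.
  apply: runs_seq (runs_store _ _ W_gt0 (rep_bounded sm r)) _ => _ ->.
  have -> : eval mem (cexp (B OMin e (G rY (K 0)))) = N.
    have w' : wf_exp (B OMin e (G rY (K 0))) by rewrite /= we.
    by rewrite (eval_cexp r w') /=; case: sm => _ -> _.
  have -> : eval mem (cell v (Const 1)) = width * 1 + v by [].
  have r1 := rep_update 1 N vw r.
  apply: runs_seq (runs_store _ _ W_gt0 (rep_bounded sm1 r1)) _ => _ ->.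
  have r2 := rep_update 0 0 vw r1.
  set mem2 := update _ _ _; pose F i s' := upd (den Y Z c1 s') v 0 i.+1.
  (* Here [k] counts the rounds left, as [runs_while] requires, so the store is the one reached
     after [N - k] rounds. *)
  pose J k mem' := let s' := iteri (N - k) F s2 in
    [/\ k <= N, small s', rep s' mem' & s' v 0 = N - k /\ s' v 1 = N].
  have JN : J N mem2.
    by rewrite /J subnn; split=> //=; rewrite /s2 /s1 /upd !eqxx.
  have := runs_while (I := J)
    (e := cexp (B OSub (G v (K 1)) (G v (K 0))))
    (c := Seq (ccmd c1) (Store (cell v (Const 0)) (cexp (B OAdd (G v (K 0)) (K 1)))))
    (Te := ecost (cexp (B OSub (G v (K 1)) (G v (K 0)))) * W)
    (Tc := (ccost c1 + ((ecost (cell v (Const 0)) +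
           ecost (cexp (B OAdd (G v (K 0)) (K 1)))) * W).+1).+1).
  have wv : wf_exp (B OSub (G v (K 1)) (G v (K 0))) by rewrite /= vw.
  have wv1 : wf_exp (B OAdd (G v (K 0)) (K 1)) by rewrite /= vw.
  move=> /(_ _ _ N mem2 JN) runW.
  apply: runs_weaken (runW _ _) _ _.
  + move=> k mem' [lekN sm' r' [v0 v1]]; split.
    * by rewrite (eval_cexp r' wv) /= v0 v1; lia.
    * exact: eval_cost_le W_gt0 (rep_bounded sm' r').
    * apply: runs_seq (H1 _ _ w1 sm' r') _ => mem3 [sm3 r3].
      apply: runs_weaken (runs_store _ _ W_gt0 (rep_bounded sm3 r3)) _ _ => // _ ->.
      rewrite (eval_cexp r3 wv1) /=.
      rewrite /J (_ : N - k = (N - k.+1).+1); last by lia.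
      have v3 : den Y Z c1 (iteri (N - k.+1) F s2) v 0 = N - k.+1.
        by rewrite den_frame.
      rewrite v3 addn1; split=> //=; first by lia.
      - by apply: small_upd => //; lia.
      - exact: rep_update.
      - by rewrite /F /upd !eqxx den_frame.
  + move=> mem' [_ sm' r' [v0 v1]]; split.
      by rewrite (eval_cexp r' wv) /= v0 v1; lia.
    exact: eval_cost_le W_gt0 (rep_bounded sm' r').
  + by rewrite leq_mul2r orbC ltnS NY.
  + by move=> mem' [_ sm' r' _]; rewrite subn0 in sm' r'.
Qed.

End CompileCorrect.

(** * Polynomial bounds *)

Definition poly_bounded (f : nat -> nat) : Prop :=
  exists T : {poly nat}, forall x, f x <= (T.[x])%R.

Lemma poly_bounded_const k : poly_bounded (fun _ => k).
Proof. by exists k%:P%R => x; rewrite hornerC. Qed.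

Lemma poly_bounded_id : poly_bounded id.
Proof. by exists 'X%R => x; rewrite hornerX. Qed.

Lemma poly_bounded_add f g : poly_bounded f -> poly_bounded g ->
  poly_bounded (fun x => f x + g x).
Proof. by move=> [p Hp] [q Hq]; exists (p + q)%R => x; rewrite hornerD leq_add. Qed.

Lemma poly_bounded_mul f g : poly_bounded f -> poly_bounded g ->
  poly_bounded (fun x => f x * g x).
Proof. by move=> [p Hp] [q Hq]; exists (p * q)%R => x; rewrite hornerM leq_mul. Qed.

Lemma poly_bounded_succ f : poly_bounded f -> poly_bounded (fun x => (f x).+1).
Proof.
move=> Hf; have [p Hp] := poly_bounded_add Hf (poly_bounded_const 1).
by exists p => x; rewrite -addn1.
Qed.

Lemma poly_bounded_exp f k : poly_bounded f -> poly_bounded (fun x => f x ^ k).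
Proof.
move=> Hf; elim: k => [|k IHk]; first exact: (poly_bounded_const 1).
have [p Hp] := poly_bounded_mul Hf IHk; exists p => x.
by rewrite expnS.
Qed.

Ltac poly_bnd := repeat first [assumption | match goal with
  | |- poly_bounded (fun _ => ?k) => exact (poly_bounded_const k)
  | |- poly_bounded (fun x => x) => exact poly_bounded_id
  | |- poly_bounded (fun x => (@?f x).+1) => apply (@poly_bounded_succ f)
  | |- poly_bounded (fun x => @?f x + @?g x) => apply (@poly_bounded_add f g)
  | |- poly_bounded (fun x => @?f x * @?g x) => apply (@poly_bounded_mul f g)
  | |- poly_bounded (fun x => @?f x ^ ?k) => apply (@poly_bounded_exp f k)
  end].

Lemma ccost_poly c fY fW : poly_bounded fY -> poly_bounded fW ->
  poly_bounded (fun x => ccost (fY x) (fW x) c).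
Proof.
move=> pY pW; elim: c => [|a e1 e2|c1 H1 c2 H2|e c1 H1 c2 H2|v e c1 H1];
  rewrite [ccost]lock /= -lock.
- exact: poly_bounded_const.
- exact: (poly_bounded_succ (poly_bounded_mul (poly_bounded_const _) pW)).
- exact: (poly_bounded_succ (poly_bounded_add H1 H2)).
- have p1 := poly_bounded_mul (poly_bounded_const (ecost (cexp e))) pW.
  exact: (poly_bounded_succ (poly_bounded_add p1 (poly_bounded_add H1 H2))).
- have pc k : poly_bounded (fun x => k * fW x) by poly_bnd.
  exact: (poly_bounded_succ (poly_bounded_add (poly_bounded_succ (pc _))
    (poly_bounded_succ (poly_bounded_add (poly_bounded_succ (pc _))
      (poly_bounded_mul (poly_bounded_succ pY) (poly_bounded_succ
        (poly_bounded_add (pc _) (poly_bounded_succ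
          (poly_bounded_add H1 (poly_bounded_succ (pc _))))))))))).
Qed.

Lemma ccost_mono c Y W Y' W' : Y <= Y' -> W <= W' -> ccost Y W c <= ccost Y' W' c.
Proof.
move=> lY lW; elim: c => [|a e1 e2|c1 H1 c2 H2|e c1 H1 c2 H2|v e c1 H1];
  rewrite [ccost]lock /= -lock //=.
- by rewrite ltnS leq_mul2l lW orbT.
- by rewrite ltnS leq_add.
- by rewrite ltnS !leq_add // leq_mul2l lW orbT.
- have m k : k * W <= k * W' by rewrite leq_mul2l lW orbT.
  rewrite ltnS; apply: leq_add; first by rewrite ltnS.
  rewrite ltnS; apply: leq_add; first by rewrite ltnS.
  apply: leq_mul => //; rewrite ltnS; apply: leq_add => //.
  by rewrite ltnS; apply: leq_add => //; rewrite ltnS.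
Qed.

(** * Reading the input *)

Notation rIN := 4.
Notation rL := 8.

Section Prelude.

Variable len : expr.
(** The input fills the low cells, so the two registers lie past its end, at an address computed
    from its length. Moved entries go to cells of index at least [rIN], so the three header cells
    that determine [len] stay intact meanwhile. *)
Let ctr := cell 5 len.
Let acc := cell 6 len.
Let cur := Fetch (Fetch ctr).

Definition move_input : cmd :=
  While (Fetch ctr)
    (Seq (Store ctr (Defs.Sub (Fetch ctr) (Const 1)))
    (Seq (Store (cell rIN (Fetch ctr)) cur)
         (Store acc (Mul (Fetch acc) (Add (Const 2) cur))))).

(** The bit length of the product of all [x.+2] serves as the measure of the input: the product
    exceeds each entry and 2 to the number of entries, while its length is linear in
    [input_size]. *)
Definition measure_input : cmd :=
  While (Fetch acc)
    (Seq (Store acc (Div (Fetch acc) (Const 2)))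
         (Store (Const 7) (Add (Fetch (Const 7)) (Const 1)))).

Fixpoint power (e : expr) (k : nat) : expr :=
  if k is k'.+1 then Mul e (power e k') else Const 1.

(** [Y] is a fixed power of the input measure and [Z = 2 ^ Y] comes from [Y] doublings. The factor
    2000 absorbs the numeric constants of the algorithm; the exponent 30 leaves room for the largest
    numbers of the solver, whose length stays below the 26th power. *)
Definition set_clamp : cmd :=
  Seq (Store (Const rL) (Mul (Const 2000) (Fetch (Const 7))))
 (Seq (Store (Const rY) (power (Fetch (Const rL)) 30))
 (Seq (Store (Const rZ) (Const 1))
 (Seq (Store (Const 9) (Fetch (Const rY)))
      (While (Fetch (Const 9))
        (Seq (Store (Const rZ) (Mul (Const 2) (Fetch (Const rZ))))
             (Store (Const 9) (Defs.Sub (Fetch (Const 9)) (Const 1)))))))).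

Definition prelude : cmd :=
  Seq (Store ctr len)
 (Seq (Store acc (Const 1))
 (Seq move_input
 (Seq (Store (Const 7) (Const 0))
 (Seq measure_input set_clamp)))).

Variables (s : seq nat).
Hypothesis s3 : 2 < size s.
Hypothesis lenP : forall mem : memory, (forall i, i < 3 -> mem i = nth 0 s i) ->
  eval mem len = size s.

Variables input_log scale Ybound : nat.
Hypothesis input_logE : input_log = bits (\prod_(x <- s) x.+2).
Hypothesis scaleE : scale = 2000 * input_log.
Hypothesis YboundE : Ybound = scale ^ 30.
Let W := Ybound.+1.

Lemma input_log_gt0 : 0 < input_log. Proof. by rewrite input_logE. Qed.

Lemma scale_ge : 2000 <= scale.
Proof. by rewrite scaleE leq_pmulr // input_log_gt0. Qed.

Lemma scale_Y : scale <= Ybound.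
Proof. by rewrite YboundE -{1}[scale]expn1 leq_exp2l //; have := scale_ge; lia. Qed.

Lemma log_scale : input_log <= scale.
Proof. by rewrite scaleE leq_pmull. Qed.

Lemma sub_prod (a : nat) : \prod_(a <= i < size s) (nth 0 s i).+2 <= \prod_(x <- s) x.+2.
Proof.
have p0 m n : 0 < \prod_(m <= i < n) (nth 0 s i).+2 by rewrite prodn_gt0.
rewrite [leqRHS](big_nth 0) /=; have [la|lt] := leqP a (size s).
  by rewrite [leqRHS](@big_cat_nat _ _ _ a) //= leq_pmull.
by rewrite big_geq // ltnW.
Qed.


(** The inequality is not strict because [Z], which is [2 ^ Ybound], is itself stored; hence the
    word length [W] is [Ybound.+1]. *)
Definition capped (mem : memory) : Prop := forall x, mem x <= 2 ^ Ybound.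

Lemma capped_bounded mem : capped mem -> bounded W mem.
Proof. by move=> h x; apply: leq_ltn_trans (h x) _; rewrite ltn_exp2l. Qed.

Lemma capped_update mem a v : capped mem -> v <= 2 ^ Ybound -> capped (update mem a v).
Proof. by move=> bm lv x; rewrite /update; case: ifP. Qed.

Lemma cap_small x : x <= Ybound -> x <= 2 ^ Ybound.
Proof. by move=> h; apply: leq_trans h _; apply: ltnW (ltn_expl _ _). Qed.

Lemma prod_le : \prod_(x <- s) x.+2 <= 2 ^ Ybound.
Proof.
apply: leq_trans (ltnW (ltn_bits _)) _; rewrite -input_logE.
by rewrite leq_exp2l //; apply: leq_trans log_scale scale_Y.
Qed.

Lemma acc_lt a : \prod_(a <= i < size s) (nth 0 s i).+2 <= 2 ^ Ybound.
Proof. exact: leq_trans (sub_prod a) prod_le. Qed.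

Lemma size_log : size s < input_log.
Proof.
rewrite -(ltn_exp2l _ _ (ltnSn 1)) input_logE; apply: leq_ltn_trans (ltn_bits _).
elim: (s) => [|x l IH] /=; first by rewrite big_nil.
by rewrite big_cons expnS leq_mul.
Qed.

Lemma nth_acc_lt i : nth 0 s i <= 2 ^ Ybound.
Proof.
have [ge|lt] := leqP (size s) i; first by rewrite nth_default.
apply: leq_trans (acc_lt i); rewrite big_ltn //.
have : 0 < \prod_(i.+1 <= j < size s) (nth 0 s j).+2 by rewrite prodn_gt0.
nia.
Qed.

(* The unread part of the input is still in place: cell [i] is overwritten only
   when some input position [j < i] is moved. *)
Definition moving (k : nat) (mem : memory) : Prop :=
  [/\ capped mem, k <= size s,
      mem (width * size s + 5) = k,
      mem (width * size s + 6) = \prod_(k <= i < size s) (nth 0 s i).+2 &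
      (forall i, i < maxn 3 k -> mem i = nth 0 s i) /\
      (forall i, k <= i < size s -> mem (width * i + rIN) = nth 0 s i)].

Lemma eval_cell_len a mem : (forall i, i < 3 -> mem i = nth 0 s i) ->
  eval mem (cell a len) = width * size s + a.
Proof. by move=> h /=; rewrite lenP. Qed.

Lemma leq_size_W : size s <= 2 ^ Ybound.
Proof.
by apply: cap_small; apply: leq_trans scale_Y; apply: leq_trans log_scale; apply: ltnW size_log.
Qed.

Lemma moving_step k mem : moving k.+1 mem ->
  [/\ eval mem (Fetch ctr) != 0, eval_cost mem (Fetch ctr) <= ecost (Fetch ctr) * W &
   runs (Seq (Store ctr (Defs.Sub (Fetch ctr) (Const 1)))
    (Seq (Store (cell rIN (Fetch ctr)) cur)
         (Store acc (Mul (Fetch acc) (Add (Const 2) cur))))) mem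
    ((((ecost ctr + ecost (Defs.Sub (Fetch ctr) (Const 1))) * W).+1 +
     (((ecost (cell rIN (Fetch ctr)) + ecost cur) * W).+1 +
      ((ecost acc + ecost (Mul (Fetch acc) (Add (Const 2) cur))) * W).+1).+1).+1)
    (moving k)].
Proof.
move=> [bm lek c5 c6 [raw mv]].
have raw3 i : i < 3 -> mem i = nth 0 s i by move=> h; apply: raw; lia.
have e5 := eval_cell_len 5 raw3.
have ec : eval mem (Fetch ctr) = k.+1 by rewrite -[LHS]/(mem (eval mem ctr)) e5.
split; first by rewrite ec.
  exact: eval_cost_le (capped_bounded _).
apply: runs_seq (runs_store _ _ _ (capped_bounded bm)) _ => // _ ->.
set mem1 := update _ _ _.
have em1 : mem1 = update mem (width * size s + 5) k.
  by rewrite /mem1 e5; congr update; rewrite -[LHS]/(eval mem (Fetch ctr) - 1) ec subn1.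
have b1 : capped mem1.
  by rewrite em1; apply: capped_update => //; have := leq_size_W; lia.
have raw1 i : i < maxn 3 k.+1 -> mem1 i = nth 0 s i.
  by move=> h; rewrite em1 /update; case: eqP => [e|_]; [lia | apply: raw].
have raw13 i : i < 3 -> mem1 i = nth 0 s i by move=> h; apply: raw1; lia.
have e51 := eval_cell_len 5 raw13.
have ec1 : eval mem1 (Fetch ctr) = k.
  by rewrite -[LHS]/(mem1 (eval mem1 ctr)) e51 em1 /update eqxx.
have ecur1 : eval mem1 cur = nth 0 s k.
  by rewrite -[LHS]/(mem1 (eval mem1 (Fetch ctr))) ec1 raw1; last by lia.
apply: runs_seq (runs_store _ _ _ (capped_bounded b1)) _ => // _ ->.
set mem2 := update _ _ _.
have em2 : mem2 = update mem1 (width * k + rIN) (nth 0 s k).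
  by rewrite /mem2 ecur1; congr update; rewrite -[LHS]/(width * eval mem1 (Fetch ctr) + rIN) ec1.
have b2 : capped mem2 by rewrite em2; apply: capped_update => //; apply: nth_acc_lt.
have raw2 i : i < maxn 3 k.+1 -> mem2 i = nth 0 s i.
  by move=> h; rewrite em2 /update; case: eqP => [e|_]; [lia | apply: raw1].
have raw23 i : i < 3 -> mem2 i = nth 0 s i by move=> h; apply: raw2; lia.
have e52 := eval_cell_len 5 raw23; have e62 := eval_cell_len 6 raw23.
have m2e x : x != width * k + rIN -> x != width * size s + 5 -> mem2 x = mem x.
  by move=> /negPf h1 /negPf h2; rewrite em2 em1 /update h1 h2.
have c52 : mem2 (width * size s + 5) = k.
  by rewrite em2 em1 /update eqxx; case: eqP => //; lia.
have ecur2 : eval mem2 cur = nth 0 s k.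
  by rewrite -[LHS]/(mem2 (mem2 (eval mem2 ctr))) e52 c52 raw2 //; lia.
have eacc2 : eval mem2 (Fetch acc) = \prod_(k.+1 <= i < size s) (nth 0 s i).+2.
  by rewrite -[LHS]/(mem2 (eval mem2 acc)) e62 m2e //; lia.
apply: runs_weaken (runs_store _ _ _ (capped_bounded b2)) _ _ => // _ ->.
have -> : eval mem2 acc = width * size s + 6 by [].
have -> : eval mem2 (Mul (Fetch acc) (Add (Const 2) cur))
    = \prod_(k <= i < size s) (nth 0 s i).+2.
  rewrite -[LHS]/(eval mem2 (Fetch acc) * (2 + eval mem2 cur)) eacc2 ecur2.
  by rewrite [RHS]big_ltn // mulnC.
split.
- by apply: capped_update => //; apply: acc_lt.
- exact: ltnW.
- by rewrite /update; case: eqP => [|_]; [lia | exact: c52].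
- by rewrite /update eqxx.
- split=> i h; rewrite /update; case: eqP => [e|_]; try lia.
    by apply: raw2; lia.
  have [ik|nik] := eqVneq i k; first by rewrite ik em2 /update eqxx.
  by rewrite m2e; [apply: mv; lia | rewrite cell_inj // (negPf nik) andbF | lia].
Qed.

Definition measuring (k : nat) (mem : memory) : Prop :=
  [/\ capped mem, k <= input_log,
      mem (width * size s + 6) = \prod_(x <- s) x.+2 %/ 2 ^ (input_log - k),
      mem 7 = input_log - k &
      (forall i, i < 3 -> mem i = nth 0 s i) /\
      (forall i, i < size s -> mem (width * i + rIN) = nth 0 s i)].

Lemma measuring_step k mem : measuring k.+1 mem ->
  [/\ eval mem (Fetch acc) != 0, eval_cost mem (Fetch acc) <= ecost (Fetch acc) * W &
   runs (Seq (Store acc (Div (Fetch acc) (Const 2)))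
         (Store (Const 7) (Add (Fetch (Const 7)) (Const 1)))) mem
    ((((ecost acc + ecost (Div (Fetch acc) (Const 2))) * W).+1 +
     ((ecost (Const 7) + ecost (Add (Fetch (Const 7)) (Const 1))) * W).+1).+1)
    (measuring k)].
Proof.
move=> [bm lek c6 c7 [raw mv]].
have e6 := eval_cell_len 6 raw.
have ea : eval mem (Fetch acc) = \prod_(x <- s) x.+2 %/ 2 ^ (input_log - k.+1).
  by rewrite -[LHS]/(mem (eval mem acc)) e6.
have P0 : 0 < \prod_(x <- s) x.+2 by rewrite prodn_gt0.
split; last 1 first.
- apply: runs_seq (runs_store _ _ _ (capped_bounded bm)) _ => // _ ->.
  set mem1 := update _ _ _.
  have em1 : mem1 = update mem (width * size s + 6)
      (\prod_(x <- s) x.+2 %/ 2 ^ (input_log - k)).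
    rewrite /mem1 e6; congr update; rewrite -[LHS]/(eval mem (Fetch acc) %/ 2) ea.
    by rewrite -divnMA -expnSr; congr (_ %/ 2 ^ _); lia.
  have b1 : capped mem1.
    rewrite em1; apply: capped_update => //.
    exact: leq_trans (leq_div _ _) prod_le.
  apply: runs_weaken (runs_store _ _ _ (capped_bounded b1)) _ _ => // _ ->.
  have -> : eval mem1 (Add (Fetch (Const 7)) (Const 1)) = input_log - k.
    rewrite -[LHS]/(mem1 7 + 1) em1 /update; case: eqP => [e|_]; first by lia.
    by rewrite c7; lia.
  have -> : eval mem1 (Const 7) = 7 by [].
  split=> //.
  + apply: capped_update => //; apply: cap_small; apply: leq_trans (leq_subr _ _) _.
    exact: leq_trans log_scale scale_Y.
  + exact: ltnW.
  + by rewrite /update; case: eqP => [e|_]; [lia | rewrite em1 /update eqxx].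
  + split=> i h; rewrite /update; case: eqP => [e|_]; try lia.
    * by rewrite em1 /update; case: eqP => [e|_]; [lia | apply: raw].
    * by rewrite em1 /update; case: eqP => [e|_]; [lia | apply: mv].
- rewrite ea -lt0n divn_gt0 ?expn_gt0 //.
  apply: leq_trans (trunc_logP (p := 2) _ P0) => //; rewrite leq_exp2l //.
  by rewrite input_logE /bits in lek *; lia.
- exact: eval_cost_le (capped_bounded _).
Qed.

Definition clamping (k : nat) (mem : memory) : Prop :=
  [/\ capped mem /\ k <= Ybound,
      mem rY = Ybound, mem rL = scale, mem rZ = 2 ^ (Ybound - k) &
      mem 9 = k /\
      (forall i, i < size s -> mem (width * i + rIN) = nth 0 s i)].

Lemma clamping_step k mem : clamping k.+1 mem ->
  [/\ eval mem (Fetch (Const 9)) != 0,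
    eval_cost mem (Fetch (Const 9)) <= ecost (Fetch (Const 9)) * W &
   runs (Seq (Store (Const rZ) (Mul (Const 2) (Fetch (Const rZ))))
             (Store (Const 9) (Defs.Sub (Fetch (Const 9)) (Const 1)))) mem
    ((((ecost (Const rZ) + ecost (Mul (Const 2) (Fetch (Const rZ)))) * W).+1 +
     ((ecost (Const 9) + ecost (Defs.Sub (Fetch (Const 9)) (Const 1))) * W).+1).+1)
    (clamping k)].
Proof.
move=> [[bm lek] cY cL cZ [c9 mv]]; split.
- by rewrite -[X in X != 0]/(mem 9) c9.
- exact: eval_cost_le (capped_bounded _).
- apply: runs_seq (runs_store _ _ _ (capped_bounded bm)) _ => // _ ->.
  have -> : eval mem (Mul (Const 2) (Fetch (Const rZ))) = 2 ^ (Ybound - k).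
    rewrite -[LHS]/(2 * mem rZ) cZ -expnS; congr (_ ^ _); lia.
  have -> : eval mem (Const rZ) = rZ by [].
  have b1 : capped (update mem rZ (2 ^ (Ybound - k))).
    by apply: capped_update => //; rewrite leq_exp2l // leq_subr.
  apply: runs_weaken (runs_store _ _ _ (capped_bounded b1)) _ _ => // _ ->.
  have -> : forall u, eval (update mem rZ u) (Const 9) = 9 by [].
  have -> : forall u, eval (update mem rZ u) (Defs.Sub (Fetch (Const 9)) (Const 1)) = k.
    by move=> u; rewrite -[LHS]/(mem 9 - 1) c9 subn1.
  split; [|by rewrite /update /= cY|by rewrite /update /= cL|by rewrite /update /=|].
  + by split; [apply: capped_update => //; apply: cap_small; lia | exact: ltnW].
  + split; first by rewrite /update /=.
    by move=> i h; rewrite /update; do 2!(case: eqP => [e|_]; first by lia); apply: mv.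
Qed.

Lemma eval_power mem e k : eval mem (power e k) = eval mem e ^ k.
Proof. by elim: k => //= k ->; rewrite expnS. Qed.

Definition prelude_cost (Y : nat) : nat :=
  let W := Y.+1 in
  let st a e := ((ecost a + ecost e) * W).+1 in
  (st ctr len + (st acc (Const 1) + (Y.+1 * (ecost (Fetch ctr) * W +
    (st ctr (Defs.Sub (Fetch ctr) (Const 1)) + (st (cell rIN (Fetch ctr)) cur +
      st acc (Mul (Fetch acc) (Add (Const 2) cur))).+1).+1).+1 +
   (st (Const 7) (Const 0) + (Y.+1 * (ecost (Fetch acc) * W +
    (st acc (Div (Fetch acc) (Const 2)) +
     st (Const 7) (Add (Fetch (Const 7)) (Const 1))).+1).+1 +
   (st (Const rL) (Mul (Const 2000) (Fetch (Const 7))) +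
   (st (Const rY) (power (Fetch (Const rL)) 30) + (st (Const rZ) (Const 1) +
   (st (Const 9) (Fetch (Const rY)) + Y.+1 * (ecost (Fetch (Const 9)) * W +
    (st (Const rZ) (Mul (Const 2) (Fetch (Const rZ))) +
     st (Const 9) (Defs.Sub (Fetch (Const 9)) (Const 1))).+1).+1
   ).+1).+1).+1).+1).+1).+1).+1).+1).+1.

Lemma prelude_correct :
  runs prelude (init_memory s) (prelude_cost Ybound) (fun mem =>
    exists st : store, [/\ small Ybound (2 ^ Ybound) st, rep st mem,
      st rL 0 = scale & forall i, i < size s -> st rIN i = nth 0 s i]).
Proof.
have W0 : 0 < W by [].
have b0 : capped (init_memory s) by move=> x; apply: nth_acc_lt.
have sz_Y : size s <= Ybound.
  exact: leq_trans (ltnW size_log) (leq_trans log_scale scale_Y).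
have raw0 i : i < 3 -> init_memory s i = nth 0 s i by [].
apply: runs_seq (runs_store _ _ W0 (capped_bounded b0)) _ => _ ->.
have e5 := eval_cell_len 5 raw0; have e6 := eval_cell_len 6 raw0.
set mem1 := update _ _ _.
have em1 : mem1 = update (init_memory s) (width * size s + 5) (size s).
  by rewrite /mem1 e5; congr update; apply: lenP.
have b1 : capped mem1 by rewrite em1; apply: capped_update => //; apply: leq_size_W.
have raw1 i : i < size s -> mem1 i = nth 0 s i.
  by move=> h; rewrite em1 /update; case: eqP => //; lia.
have raw13 i : i < 3 -> mem1 i = nth 0 s i by move=> h; apply: raw1; lia.
have e61 := eval_cell_len 6 raw13.
apply: runs_seq (runs_store _ _ W0 (capped_bounded b1)) _ => _ ->.
have -> : eval mem1 (Const 1) = 1 by [].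
rewrite -/acc e61.
have M : moving (size s) (update mem1 (width * size s + 6) 1).
  split=> //; first by apply: capped_update => //; apply: cap_small; have := scale_Y; have := scale_ge; lia.
  - by rewrite /update em1 /update eqxx; case: eqP => //; lia.
  - by rewrite /update eqxx big_geq.
  - split=> i h; last by lia.
    by rewrite /update; case: eqP => [e|_]; [lia | apply: raw1; lia].
apply: runs_seq.
  apply: runs_weaken (runs_while (I := moving) moving_step _ M) _ (fun _ => id) => //.
    move=> mem [bm _ c5 _ [raw _]]; split; last exact: eval_cost_le (capped_bounded _).
    by rewrite -[LHS]/(mem (eval mem ctr)) (eval_cell_len 5).
  by rewrite leq_mul2r orbC ltnS sz_Y.
move=> mem2 [b2 _ _ c6 [raw2 mv2]].
apply: runs_seq (runs_store _ _ W0 (capped_bounded b2)) _ => _ ->.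
have -> : eval mem2 (Const 7) = 7 by [].
have -> : eval mem2 (Const 0) = 0 by [].
have M2 : measuring input_log (update mem2 7 0).
  split=> //; rewrite ?subnn //.
  - by apply: capped_update => //; rewrite expn_gt0.
  - by rewrite divn1 /update; case: eqP => [e|_]; [lia | rewrite c6 [RHS](big_nth 0)].
  - split=> i h; rewrite /update; case: eqP => [e|_]; try lia.
      by apply: raw2; lia.
    exact: mv2.
apply: runs_seq.
  apply: runs_weaken (runs_while (I := measuring) measuring_step _ M2) _ (fun _ => id) => //.
    move=> mem [bm _ c6' _ [raw _]]; split; last exact: eval_cost_le (capped_bounded _).
    rewrite -[LHS]/(mem (eval mem acc)) (eval_cell_len 6) // c6' subn0 divn_small //.
    by rewrite input_logE ltn_bits.
  by rewrite leq_mul2r orbC ltnS (leq_trans log_scale scale_Y).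
move=> mem3 [b3 _ _ c7 [_ mv3]]; rewrite subn0 in c7.
apply: runs_seq (runs_store _ _ W0 (capped_bounded b3)) _ => _ ->.
have -> : eval mem3 (Const rL) = rL by [].
have -> : eval mem3 (Mul (Const 2000) (Fetch (Const 7))) = scale.
  by rewrite -[LHS]/(2000 * mem3 7) c7 scaleE.
set mem4 := update _ _ _.
have b4 : capped mem4 by apply: capped_update => //; apply: cap_small; apply: scale_Y.
apply: runs_seq (runs_store _ _ W0 (capped_bounded b4)) _ => _ ->.
have -> : eval mem4 (Const rY) = rY by [].
have -> : eval mem4 (power (Fetch (Const rL)) 30) = Ybound by rewrite eval_power YboundE.
set mem5 := update _ _ _.
have b5 : capped mem5 by apply: capped_update => //; apply: cap_small.
apply: runs_seq (runs_store _ _ W0 (capped_bounded b5)) _ => _ ->.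
have -> : eval mem5 (Const rZ) = rZ by [].
have -> : eval mem5 (Const 1) = 1 by [].
set mem6 := update _ _ _.
have b6 : capped mem6.
  by apply: capped_update => //; apply: cap_small; have := scale_Y; have := scale_ge; lia.
apply: runs_seq (runs_store _ _ W0 (capped_bounded b6)) _ => _ ->.
have -> : eval mem6 (Const 9) = 9 by [].
have -> : eval mem6 (Fetch (Const rY)) = Ybound by [].
have C : clamping Ybound (update mem6 9 Ybound).
  split; [|by rewrite /update /=|by rewrite /update /=|by rewrite subnn /update /=|].
    by split; [apply: capped_update => //; apply: cap_small | ].
  split; first by rewrite /update /=.
  have ne j k : k < rIN \/ rIN < k < width -> (width * j + rIN == k) = false by lia.
  by move=> i h; rewrite /mem6 /mem5 /mem4 /update !ne ?mv3 //; auto.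
apply: runs_weaken (runs_while (I := clamping) clamping_step _ C) _ _ => //.
  by move=> mem [[bm _] _ _ _ [c9 _]]; split; [exact: c9 | exact: eval_cost_le (capped_bounded _)].
(* Every memory represents the store that it spells out. Leftovers of the prelude in other cells are
   allowed: the programs are proved correct for any such store. *)
move=> mem [[bm _] cY cL cZ [_ mv]]; exists (fun a i => mem (width * i + a)).
rewrite subn0 in cZ; split; [|by []|by rewrite muln0|exact: mv].
by split; [|rewrite muln0|rewrite muln0].
Qed.



End Prelude.

(** * Writing the output *)

Notation rOUT := 10.

(** The program leaves its output at the indices [n + c] of array [rOUT]. The shift by [n] puts the
    sources above all [3 * n] output cells and, when there is a job, above the low cells, so that
    copying down never destroys a source. *)
Definition out_cell (e : expr) : expr := Fetch (cell rOUT (Add (Fetch (Const 0)) e)).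

(* The cells below [width] hold the variables; they are overwritten last, and
   cell 0, which locates the output array, last of all. *)
Fixpoint write_low (k : nat) : cmd :=
  if k is k'.+1 then Seq (Store (Const k') (out_cell (Const k'))) (write_low k')
  else Skip.

Definition write_high : cmd :=
  While (Defs.Sub (Fetch (Const 1)) (Const width))
    (Seq (Store (Const 1) (Defs.Sub (Fetch (Const 1)) (Const 1)))
         (Store (Fetch (Const 1)) (out_cell (Fetch (Const 1))))).

Definition epilogue : cmd :=
  Seq (Store (Const 1) (Mul (Const 3) (Fetch (Const 0))))
 (Seq write_high (write_low width)).

Section Epilogue.

Variables (W n : nat) (out : nat -> nat).
Hypotheses (W_gt0 : 0 < W) (n_gt0 : 0 < n) (n_W : 3 * n < 2 ^ W).

Lemma bounded_upd mem a v : bounded W mem -> v < 2 ^ W -> bounded W (update mem a v).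
Proof. by move=> bm lv x; rewrite /update; case: ifP. Qed.

Fixpoint low_cost (k : nat) : nat :=
  if k is k'.+1 then
    (((ecost (Const k') + ecost (out_cell (Const k'))) * W).+1 + low_cost k').+1
  else 1.

Lemma write_low_correct k mem : k <= width -> bounded W mem ->
  (0 < k -> mem 0 = n) -> (forall c, mem (width * (n + c) + rOUT) = out c) ->
  (forall c, k <= c < 3 * n -> mem c = out c) ->
  runs (write_low k) mem (low_cost k) (fun mem' => forall c, c < 3 * n -> mem' c = out c).
Proof.
elim: k mem => [|k IHk] mem lek bm m0 src hi.
  by exists mem, 1; split=> //; exact: ExecSkip.
apply: runs_seq (runs_store _ _ W_gt0 bm) _ => _ ->.
have -> : eval mem (Const k) = k by [].
have -> : eval mem (out_cell (Const k)) = out k.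
  by rewrite -[LHS]/(mem (width * (mem 0 + k) + rOUT)) m0.
apply: IHk; first exact: ltnW.
- by apply: bounded_upd => //; rewrite -src.
- by move=> k0; rewrite /update; case: eqP => [e|_]; [lia | exact: m0].
- by move=> c; rewrite /update; case: eqP => [e|_]; [lia | exact: src].
- move=> c h; rewrite /update; case: eqP => [->//|ne]; apply: hi; lia.
Qed.

Definition writing (k : nat) (mem : memory) : Prop :=
  [/\ bounded W mem, k <= 3 * n - width, mem 0 = n /\ mem 1 = 3 * n - (3 * n - width - k),
     (forall c, mem (width * (n + c) + rOUT) = out c) &
     (forall c, width + k <= c < 3 * n -> mem c = out c)].

Lemma writing_step k mem : writing k.+1 mem ->
  [/\ eval mem (Defs.Sub (Fetch (Const 1)) (Const width)) != 0,
   eval_cost mem (Defs.Sub (Fetch (Const 1)) (Const width))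
     <= ecost (Defs.Sub (Fetch (Const 1)) (Const width)) * W &
   runs (Seq (Store (Const 1) (Defs.Sub (Fetch (Const 1)) (Const 1)))
         (Store (Fetch (Const 1)) (out_cell (Fetch (Const 1))))) mem
    ((((ecost (Const 1) + ecost (Defs.Sub (Fetch (Const 1)) (Const 1))) * W).+1 +
     ((ecost (Fetch (Const 1)) + ecost (out_cell (Fetch (Const 1)))) * W).+1).+1)
    (writing k)].
Proof.
move=> [bm lek [c0 c1] src hi]; split; last 1 first.
- apply: runs_seq (runs_store _ _ W_gt0 bm) _ => _ ->.
  have -> : eval mem (Defs.Sub (Fetch (Const 1)) (Const 1)) = width + k.
    by rewrite -[LHS]/(mem 1 - 1) c1; lia.
  have -> : eval mem (Const 1) = 1 by [].
  set mem1 := update _ _ _.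
  have b1 : bounded W mem1 by apply: bounded_upd => //; lia.
  apply: runs_weaken (runs_store _ _ W_gt0 b1) _ _ => // _ ->.
  have -> : eval mem1 (Fetch (Const 1)) = width + k by [].
  have src1 c : mem1 (width * (n + c) + rOUT) = out c.
    by rewrite /mem1 /update; case: eqP => [e|_]; [lia | exact: src].
  have -> : eval mem1 (out_cell (Fetch (Const 1))) = out (width + k).
    rewrite -[LHS]/(mem1 (width * (mem1 0 + mem1 1) + rOUT)).
    by rewrite (_ : mem1 0 = n) ?src1.
  split.
  + by apply: bounded_upd => //; rewrite -src.
  + exact: ltnW.
  + split; first by rewrite -c0.
    rewrite -[LHS]/(mem1 1) /mem1 /update eqxx; lia.
  + by move=> c; rewrite {1}/update; case: eqP => [e|_]; [lia | exact: src1].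
  + move=> c h; rewrite {1}/update; case: eqP => [->//|ne].
    by rewrite /mem1 /update; case: eqP => [e|_]; [lia | apply: hi; lia].
- rewrite -[X in X != 0]/(mem 1 - width) c1; lia.
- exact: eval_cost_le.
Qed.

Definition epilogue_cost (Y : nat) : nat :=
  (((ecost (Const 1) + ecost (Mul (Const 3) (Fetch (Const 0)))) * W).+1 +
   ((3 * Y).+1 * (ecost (Defs.Sub (Fetch (Const 1)) (Const width)) * W +
     (((ecost (Const 1) + ecost (Defs.Sub (Fetch (Const 1)) (Const 1))) * W).+1 +
     ((ecost (Fetch (Const 1)) + ecost (out_cell (Fetch (Const 1)))) * W).+1).+1).+1 +
   low_cost width).+1).+1.

Lemma epilogue_correct Y mem : n <= Y -> bounded W mem -> mem 0 = n ->
  (forall c, mem (width * (n + c) + rOUT) = out c) ->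
  runs epilogue mem (epilogue_cost Y) (fun mem' => forall c, c < 3 * n -> mem' c = out c).
Proof.
move=> nY bm m0 src.
apply: runs_seq (runs_store _ _ W_gt0 bm) _ => _ ->.
have -> : eval mem (Mul (Const 3) (Fetch (Const 0))) = 3 * n.
  by rewrite -[LHS]/(3 * mem 0) m0.
have -> : eval mem (Const 1) = 1 by [].
have I0 : writing (3 * n - width) (update mem 1 (3 * n)).
  split=> //; first exact: bounded_upd.
  - by split; rewrite /update //=; lia.
  - by move=> c; rewrite /update; case: eqP => [e|_]; [lia | exact: src].
  - by move=> c h; lia.
apply: runs_seq.
  apply: runs_weaken (runs_while (I := writing) writing_step _ I0) _ (fun _ => id) => //.
    move=> mem' [b' _ [_ c1] _ _]; split; last exact: eval_cost_le.
    by rewrite -[LHS]/(mem' 1 - width) c1; lia.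
  by rewrite leq_mul2r orbC ltnS; lia.
by move=> mem' [b' _ [c0 c1] src' hi]; apply: write_low_correct.
Qed.

End Epilogue.

(** * The complete RAM program and its time bound *)

Definition whole (len : expr) (c : hcmd) : cmd := Seq (prelude len) (Seq (ccmd c) (If (Fetch (Const 0)) epilogue Skip)).

Lemma prod_size (s : seq nat) : bits (\prod_(x <- s) x.+2) <= 3 * input_size s + 1.
Proof.
apply: bits_le; first by rewrite addn1.
rewrite addn1; apply: (@leq_ltn_trans (2 ^ (3 * input_size s))); last by rewrite ltn_exp2l.
rewrite /input_size; elim: s => [|x s IH]; first by rewrite !big_nil.
rewrite !big_cons mulnDr expnD leq_mul // mulnC expnM.
have : x < 2 ^ bits x by apply: ltn_bits.
set y := 2 ^ bits x; have : 1 < y by rewrite -{1}(expn1 2) leq_exp2l.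
rewrite !expnS expn0; nia.
Qed.

Lemma whole_poly len c : poly_bounded (fun x =>
  let Y := (2000 * (3 * x + 1)) ^ 30 in
  (prelude_cost len Y + (ccost Y Y.+3 c + (ecost (Fetch (Const 0)) * Y.+3 + epilogue_cost Y.+3 Y).+1).+1).+1).
Proof.
have pY : poly_bounded (fun x => (2000 * (3 * x + 1)) ^ 30) by poly_bnd.
(* The power is hidden behind a variable, so that unification does not unfold it. *)
have [f fE] : exists f, f = fun x => (2000 * (3 * x + 1)) ^ 30 by eexists.
rewrite -fE in pY; suff : poly_bounded (fun x => (prelude_cost len (f x) +
    (ccost (f x) (f x).+3 c + (ecost (Fetch (Const 0)) * (f x).+3 +
      epilogue_cost (f x).+3 (f x)).+1).+1).+1) by rewrite fE.
have pc : poly_bounded (fun x => ccost (f x) (f x).+3 c).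
  by apply: ccost_poly => //; poly_bnd.
have pl k : poly_bounded (fun x => low_cost (f x).+3 k).
  have pW : poly_bounded (fun x => (f x).+3) by poly_bnd.
  elim: k => [|k IHk]; first exact: poly_bounded_const.
  exact: (poly_bounded_succ (poly_bounded_add (poly_bounded_succ
    (poly_bounded_mul (poly_bounded_const _) pW)) IHk)).
rewrite /prelude_cost /epilogue_cost; have pw := pl width; poly_bnd.
Qed.

Lemma low_cost_mono k W W' : W <= W' -> low_cost W k <= low_cost W' k.
Proof.
move=> lW; elim: k => //= k IHk; rewrite ltnS leq_add // ltnS leq_mul2l lW orbT //.
Qed.

Lemma whole_cost_mono len c Y Y' : Y <= Y' ->
  (prelude_cost len Y + (ccost Y Y.+3 c + (ecost (Fetch (Const 0)) * Y.+3 + epilogue_cost Y.+3 Y).+1).+1).+1 <=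
  (prelude_cost len Y' + (ccost Y' Y'.+3 c + (ecost (Fetch (Const 0)) * Y'.+3 + epilogue_cost Y'.+3 Y').+1).+1).+1.
Proof.
move=> lY.
have mono := (ccost_mono c lY (W := Y.+3) (W' := Y'.+3) lY).
have lmono : low_cost Y.+3 width <= low_cost Y'.+3 width by apply: low_cost_mono.
rewrite /prelude_cost /epilogue_cost.
repeat first [assumption | exact: lY | match goal with
  | |- is_true (?x <= ?x) => exact: leqnn
  | |- is_true (_.+1 <= _.+1) => rewrite ltnS
  | |- is_true (_ + _ <= _ + _) => apply: leq_add
  | |- is_true (_ * _ <= _ * _) => apply: leq_mul
  end].
Qed.

(** Termination and the polynomial time bound come from the syntax of [c] alone; what remains to be
    shown about a program is a statement on its denotation. *)
Lemma whole_correct (s : seq nat) (len : expr) (c : hcmd) (n : nat) (Out : (nat -> nat) -> Prop) :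
  2 < size s -> wf c ->
  (forall mem : memory, (forall i, i < 3 -> mem i = nth 0 s i) -> eval mem len = size s) ->
  let l := 2000 * bits (\prod_(x <- s) x.+2) in let Y := l ^ 30 in
  (forall st : store, small Y (2 ^ Y) st -> st rL 0 = l ->
     (forall i, i < size s -> st rIN i = nth 0 s i) ->
     let st' := den Y (2 ^ Y) c st in
     [/\ n <= Y, st' 0 0 = n & Out (fun i => st' rOUT (n + i))]) ->
  runs (whole len c) (init_memory s)
    (let Y := (2000 * (3 * input_size s + 1)) ^ 30 in
     (prelude_cost len Y + (ccost Y Y.+3 c + (ecost (Fetch (Const 0)) * Y.+3 + epilogue_cost Y.+3 Y).+1).+1).+1)
    (fun mem => exists2 out, Out out & forall i, i < 3 * n -> mem i = out i).
Proof.
move=> s3 wfc lenP l Y main.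
have Yle : Y <= (2000 * (3 * input_size s + 1)) ^ 30.
  by rewrite leq_exp2r // leq_mul2l prod_size orbT.
apply: runs_weaken _ (whole_cost_mono len c Yle) (fun _ => id).
have [lg lgE] : exists lg, lg = bits (\prod_(x <- s) x.+2) by eexists.
rewrite -lgE in l Y main Yle *.
have [l' lE] : exists l', l' = l by eexists.
have [Y' YE] : exists Y', Y' = Y by eexists.
rewrite -/l -lE in main; rewrite -/l -/Y -YE in main *.
have Yl : Y' = l' ^ 30 by rewrite YE lE.
apply: runs_seq (prelude_correct s3 lenP lgE lE Yl) _ => mem [st [sm r stL stIN]].
have l0 : 2000 <= l' by rewrite lE /l lgE leq_pmulr.
have l'Y : l' <= Y' by rewrite Yl -{1}[l']expn1 leq_exp2l //; lia.
have [nY o0 oi] : [/\ n <= Y', den Y' (2 ^ Y') c st 0 0 = n &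
    Out (fun i => den Y' (2 ^ Y') c st rOUT (n + i))].
  exact: main.
have Y_Z : Y' < 2 ^ Y' by apply: ltn_expl.
have Z_W : 2 ^ Y' < 2 ^ Y'.+3 by rewrite ltn_exp2l // !ltnS; lia.
clear main Yle lE YE Yl; clear Y l.
have Z100 : 100 <= 2 ^ Y' by apply: ltnW; lia.
apply: runs_seq (ccmd_correct (isT : 0 < Y'.+3) (ltnW Y_Z) Z_W Z100 wfc sm r) _.
move=> mem1 [sm1 r1].
have W0 : 0 < Y'.+3 by [].
have b1 := rep_bounded Z_W sm1 r1.
have ec := eval_cost_le (Fetch (Const 0)) W0 b1.
have e0 : eval mem1 (Fetch (Const 0)) = n by rewrite -o0 -(r1 0 0).
(* With no job the sources would not be clear of the low cells that the epilogue overwrites, so it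
   is skipped; nothing has to be written. *)
have [n0|n0] := posnP n.
  exists mem1, (eval_cost mem1 (Fetch (Const 0)) + 1).+1; split.
  - by apply: ExecIfFalse; [rewrite e0 | exact: ExecSkip].
  - rewrite ltnS; apply: leq_add => //.
  - by exists (fun i => den Y' (2 ^ Y') c st rOUT (n + i)) => // i; rewrite n0.
have n_W : 3 * n < 2 ^ Y'.+3 by rewrite !expnS; lia.
have [||mem2 [t [ex lt Q]]] := @epilogue_correct Y'.+3 n (fun i => mem1 (width * (n + i) + rOUT))
  W0 n0 n_W Y' mem1 nY b1 => //.
exists mem2, (eval_cost mem1 (Fetch (Const 0)) + t).+1; split.
- by apply: ExecIfTrue ex; rewrite e0 -lt0n.
- by rewrite ltnS; apply: leq_add.
- by exists (fun i => den Y' (2 ^ Y') c st rOUT (n + i)) => // i h; rewrite Q // r1.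
Qed.

(** * Multiplicative weights for mixed packing and covering *)

Section Mwu.

Variables (mp mc nv N D : nat) (A C : nat -> nat -> nat) (L0 : nat -> nat).

(* [h] lists the columns chosen so far, most recent first. *)
Definition pweight (h : seq nat) (i : nat) : nat := \prod_(e <- h) (40 * D + A i e).
Definition coverage (h : seq nat) (r : nat) : nat := minn N (L0 r + \sum_(e <- h) C r e).
(** This is [40 ^ N] times (39/40) to the coverage, so one unit of coverage lowers the weight by a
    40th, in integers; a row covered [N] times is dropped. Likewise [pweight] is the product of the
    1 + A/(40 D), multiplied by [(40 * D) ^ size h]. *)
Definition cweight (h : seq nat) (r : nat) : nat :=
  if coverage h r < N then 39 ^ coverage h r * 40 ^ (N - coverage h r) else 0.
Definition pcol (h : seq nat) (e : nat) : nat := \sum_(i < mp) pweight h i * A i e.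
Definition ccol (h : seq nat) (e : nat) : nat := \sum_(r < mc) C r e * cweight h r.

(** Least ratio of packing weight to covering weight, compared by cross multiplication. *)
Definition best (h : seq nat) (e : nat) : Prop :=
  [/\ e < nv, 0 < ccol h e &
      forall e', e' < nv -> pcol h e * ccol h e' <= pcol h e' * ccol h e].

Inductive run : seq nat -> Prop :=
| run_nil : run [::]
| run_cons h e : run h -> best h e -> run (e :: h).

Hypothesis D_gt0 : 0 < D.
Hypothesis A_le : forall i e, A i e <= D.
Hypothesis C_le : forall r e, C r e <= 1.

Lemma pweight_cons h e i : pweight (e :: h) i = pweight h i * (40 * D + A i e).
Proof. by rewrite /pweight big_cons mulnC. Qed.

Lemma coverage_cons h e r : coverage (e :: h) r = minn N (coverage h r + C r e).
Proof. rewrite /coverage big_cons; lia. Qed.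

Lemma leq_exp2r_weak a b k : a <= b -> a ^ k <= b ^ k.
Proof. by case: k => // k ab; rewrite leq_exp2r. Qed.

Lemma leq_exp_pair p a r b c i j l k : p * a ^ i <= r * (b ^ j * c ^ l) ->
  p ^ k * a ^ (i * k) <= r ^ k * (b ^ (j * k) * c ^ (l * k)).
Proof. by move=> /(leq_exp2r_weak k); rewrite !expnMn !expnM. Qed.

Lemma leq_mul_cancel a b c d e : 0 < a -> 2 * a <= b -> b * c <= a * (d * e) -> 2 * c <= d * e.
Proof.
move=> a0 H1 H2; rewrite -(leq_pmul2l a0); apply: leq_trans H2.
by rewrite mulnA [a * 2]mulnC leq_mul2r H1 orbT.
Qed.

(* [(41/40)^21 * (39/40)^20 >= 1.012] and [1.012^60 >= 2]. *)
Lemma power_gain_base : 2 * 40 ^ (41 * 60) <= 41 ^ (21 * 60) * 39 ^ (20 * 60).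
Proof.
apply: (leq_mul_cancel (a := 1000 ^ 60) (b := 1012 ^ 60)).
- by rewrite expn_gt0.
- lia.
- apply: (@leq_exp_pair 1012 40 1000 41 39 41 21 20 60); lia.
Qed.

Lemma power_gain x :
  2 ^ x * (40 ^ (1260 * x) * 40 ^ (1200 * x)) <= 41 ^ (1260 * x) * 39 ^ (1200 * x).
Proof.
have fin b c d i j l y : 2 * b ^ i <= c ^ j * d ^ l ->
    2 ^ y * b ^ (i * y) <= c ^ (j * y) * d ^ (l * y).
  by rewrite -[c ^ j * _]mul1n => /leq_exp_pair-/(_ y); rewrite exp1n mul1n.
rewrite -expnD -mulnDl.
exact: (fin 40 41 39 (41 * 60) (21 * 60) (20 * 60) x power_gain_base).
Qed.

Lemma cweight_cons h e r : 40 * cweight (e :: h) r + C r e * cweight h r <= 40 * cweight h r.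
Proof.
rewrite /cweight coverage_cons; have := C_le r e; have lN : coverage h r <= N by apply: geq_minl.
case: (ltnP (coverage h r) N) => [lt|ge]; last by rewrite ifF ?muln0 //; lia.
case: (C r e) => [|[|]] // _; first by rewrite addn0 (minn_idPr lN) lt mul0n addn0.
rewrite mul1n addn1 (minn_idPr lt); case: ifP => [lt'|_]; last by rewrite muln0; lia.
rewrite (_ : N - coverage h r = (N - (coverage h r).+1).+1); last by lia.
rewrite !expnS; set x := 39 ^ _; set y := 40 ^ _; lia.
Qed.

Definition Phi_p h := \sum_(i < mp) pweight h i.
Definition Phi_c h := \sum_(r < mc) cweight h r.

Lemma Phi_p_cons h e : Phi_p (e :: h) = 40 * D * Phi_p h + pcol h e.
Proof.
rewrite /Phi_p /pcol big_distrr -big_split /=; apply: eq_bigr => i _.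
by rewrite pweight_cons mulnDr [pweight h i * (40 * D)]mulnC.
Qed.

Lemma Phi_c_cons h e : 40 * Phi_c (e :: h) + ccol h e <= 40 * Phi_c h.
Proof.
rewrite /Phi_c /ccol !big_distrr -big_split /=; apply: leq_sum => r _.
exact: cweight_cons.
Qed.

Lemma Phi_c_ge h e : 0 < ccol h e -> 39 ^ N <= Phi_c h.
Proof.
rewrite lt0n sum_nat_eq0 => /forallPn[r]; rewrite muln_eq0 negb_or /= => /andP[_].
rewrite /Phi_c (bigD1 r) //= /cweight; case: ifP => // lt _.
apply: leq_trans (leq_addr _ _); rewrite -{1}(subnKC (ltnW lt)) expnD.
by rewrite leq_mul // leq_exp2r // subn_gt0.
Qed.

Lemma pweight_le h i : pweight h i <= (41 * D) ^ size h.
Proof.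
elim: h => [|e h IHh]; first by rewrite /pweight big_nil.
rewrite pweight_cons /= expnS mulnC leq_mul //; have := A_le i e; lia.
Qed.

Lemma load_step c q x y z w S T a g : x * y * (S + g) <= z * w * T ->
  S * c <= q * ((S + g) * (S + a)) -> x * S * y * c <= z * (S + a) * (w * q) * T.
Proof.
move=> H H1; have H2 := leq_mul (leqnn (x * y)) H1.
have H3 := leq_mul H (leqnn (q * (S + a))).
have -> : x * S * y * c = x * y * (S * c) by ring.
have -> : z * (S + a) * (w * q) * T = z * w * T * (q * (S + a)) by ring.
apply: leq_trans H2 _; apply: leq_trans _ H3.
by apply: eq_leq; ring.
Qed.

(** Among loads in [0, 1] with sum k + f, the product of the factors 1 + a/40 is least when k of
    them equal 1 and one equals f, by concavity of the logarithm. The induction adds one load and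
    carries an overflow of the fractional part into [k]. *)
Lemma load_ge h i k f : f <= D -> \sum_(e <- h) A i e = k * D + f ->
  (40 * D) ^ size h * 41 ^ k * (40 * D + f) <= pweight h i * 40 ^ k * (40 * D).
Proof.
elim: h k f => [|e h IHh] k f fD; rewrite /pweight ?big_nil ?big_cons /=.
  move=> e; have k0 : k = 0 by nia.
  by rewrite k0 in e *; rewrite !expn0 !mul1n; lia.
rewrite -/(pweight h i) expnSr [(_ + _) * pweight _ _]mulnC.
have := A_le i e; move: (A i e) => a aD sE.
have [af|fa] := leqP a f.
  have gD : f - a <= D by lia.
  have sE' : \sum_(e <- h) A i e = k * D + (f - a) by lia.
  rewrite -[40 ^ k]muln1; apply: load_step (IHh _ _ gD sE') _; rewrite mul1n.
  have : f - a + a = f by lia.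
  move: (f - a) => g <-; nia.
case: k sE => [|k] sE; first by lia.
have gD : D + f - a <= D by lia.
have sE' : \sum_(e <- h) A i e = k * D + (D + f - a) by lia.
rewrite [41 ^ _]expnSr [40 ^ k.+1]expnSr [_ * (41 ^ k * 41)]mulnA -[_ * 41 * _]mulnA.
apply: load_step (IHh _ _ gD sE') _.
have : D + f - a + a = D + f by lia.
have : D + f - a <= D by lia.
move: (D + f - a) => g gD' gE.
have H0 : D * f <= g * a by nia.
nia.
Qed.

(* A solution with 0/1 entries: the set of columns [E]. *)
Variable E : pred nat.
Hypothesis E_pack : forall i, i < mp -> \sum_(e < nv | E e) A i e <= D.
Hypothesis E_cover : forall r, r < mc -> L0 r < N -> 0 < \sum_(e < nv | E e) C r e.

Lemma sum_pcol h : \sum_(e < nv | E e) pcol h e <= D * Phi_p h.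
Proof.
rewrite /pcol exchange_big /Phi_p big_distrr /=; apply: leq_sum => i _.
by rewrite -big_distrr /= mulnC leq_mul2r E_pack ?orbT.
Qed.

Lemma sum_ccol h : Phi_c h <= \sum_(e < nv | E e) ccol h e.
Proof.
rewrite /ccol exchange_big /Phi_c /=; apply: leq_sum => r _.
rewrite -big_distrl /=; have [lt|ge] := ltnP (coverage h r) N; last first.
  by rewrite {1}/cweight ltnNge ge.
by rewrite leq_pmull // E_cover //; move: lt; rewrite /coverage; lia.
Qed.

(** Summed over the columns of the 0/1 solution [E], the packing weights are at most [D * Phi_p h]
    and the covering weights at least [Phi_c h]. The least ratio of all columns cannot exceed the
    ratio of these sums. *)
Lemma best_ratio h e : best h e -> pcol h e * Phi_c h <= D * Phi_p h * ccol h e.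
Proof.
move=> [_ _ be]; apply: leq_trans (leq_mul (leqnn _) (sum_ccol h)) _.
apply: leq_trans (leq_mul (sum_pcol h) (leqnn _)).
by rewrite big_distrr big_distrl /=; apply: leq_sum => e' _; apply: be.
Qed.

(** A step multiplies the packing potential by 40 D (1 + x) and the covering potential by at most 1
    - y, where 40 x and 40 y are the shares of the chosen column in the potentials. By [best_ratio]
    x is at most y, so (1 + x)(1 - y) is at most 1. *)
Lemma potential h : run h ->
  Phi_p h * Phi_c h <= (40 * D) ^ size h * (mp * (mc.+1 * 40 ^ N)).
Proof.
elim=> {h} [|h e rh IHh be].
  rewrite expn0 mul1n leq_mul //.
    by rewrite /Phi_p -[leqRHS]muln1 -[mp in leqRHS]card_ord -sum_nat_const leq_sum // => i _; rewrite /pweight big_nil.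
  apply: (@leq_trans (mc * 40 ^ N)); last by rewrite leq_mul2r leqnSn orbT.
  rewrite -[mc in leqRHS]card_ord -sum_nat_const leq_sum // => r _.
  rewrite /cweight; case: ifP => // lt.
  by rewrite -{2}(subnKC (ltnW lt)) expnD leq_mul2r leq_exp2r_weak ?orbT.
have := best_ratio be; have := Phi_c_cons h e; rewrite Phi_p_cons /= expnS.
move: IHh; move: (Phi_c (e :: h)) (Phi_c h) (Phi_p h) (pcol h e) (ccol h e).
move: ((40 * D) ^ size h) (mp * _) => x y c' c p a b H1 H2 H3.
apply: (@leq_trans (40 * D * (p * c))); last by rewrite -[leqRHS]mulnA leq_mul2l H1 orbT.
rewrite -(@leq_pmul2l 40) //.
have H4 : (40 * D * p + a) * (40 * c') <= (40 * D * p + a) * (40 * c - b).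
  by rewrite leq_mul2l; apply/orP; right; lia.
apply: leq_trans (leq_trans _ H4) _; first by apply: eq_leq; ring.
rewrite mulnBr leq_subLR mulnDl; nia.
Qed.

(** At the end the covering potential may be 0. So [potential] is applied before the last step, when
    some row is still uncovered and weighs at least [39 ^ N]; the last step costs a factor of at
    most 41/40. *)
Lemma Phi_p_bound h : run h ->
  40 * (Phi_p h * 39 ^ N) <= 41 * ((40 * D) ^ size h * (mp * (mc.+1 * 40 ^ N))).
Proof.
case=> {h} [|h e rh be].
  rewrite expn0 mul1n; apply: leq_mul => //; apply: leq_mul.
    by rewrite /Phi_p -[leqRHS]muln1 -[mp in leqRHS]card_ord -sum_nat_const leq_sum // => i _; rewrite /pweight big_nil.
  by rewrite -[39 ^ N]mul1n leq_mul // leq_exp2r_weak.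
have [_ cgt _] := be; have cge := Phi_c_ge cgt; have pot := potential rh.
have pa : pcol h e <= D * Phi_p h.
  rewrite /pcol /Phi_p big_distrr /= leq_sum // => i _.
  by rewrite mulnC leq_mul2r A_le orbT.
rewrite Phi_p_cons /= expnS; move: (39 ^ N) (Phi_c h) (Phi_p h) (pcol h e) cge pot pa.
move: ((40 * D) ^ size h) (mp * _) => x y t c p a tc pc ad.
have pt : p * t <= x * y by apply: leq_trans pc; rewrite leq_mul2l tc orbT.
have : (40 * D * p + a) * t <= 41 * D * (x * y).
  apply: (@leq_trans (41 * D * (p * t))); last by rewrite leq_mul2l pt orbT.
  by rewrite [leqRHS]mulnA leq_mul2r; apply/orP; right; lia.
rewrite -[_ * x * y]mulnA; move: (x * y) => z; lia.
Qed.

(** With X the number of rows plus one, a load of 1260 X against a coverage of 1200 X would give 2^X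
    <= (41/40)^(1260 X) (39/40)^(1200 X) <= (41/40) mp (mc + 1), which is false. The ratio 1260/1200
    is the solver error 1.05. *)
Lemma load_lt h i : N = 1200 * (mp + mc).+1 -> run h -> i < mp ->
  \sum_(e <- h) A i e < 1260 * (mp + mc).+1 * D.
Proof.
set X := (mp + mc).+1 => NE rh lti; rewrite ltnNge; apply/negP => geS.
set S := \sum_(e <- h) A i e in geS.
have fD : S %% D <= D by apply: ltnW; rewrite ltn_mod.
have := load_ge (i := i) fD (divn_eq _ _); rewrite -/S.
have : 1260 * X <= S %/ D by rewrite leq_divRL.
move: (S %/ D) (S %% D) => k' f le_k H1.
have pw : pweight h i <= Phi_p h.
  by rewrite /Phi_p (bigD1 (Ordinal lti)) //= leq_addr.
have H2 := Phi_p_bound rh.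
have D0 : 0 < (40 * D) ^ size h by rewrite expn_gt0 muln_gt0 D_gt0.
have H3 : (40 * D) ^ size h * 41 ^ k' <= pweight h i * 40 ^ k'.
  rewrite -(@leq_pmul2r (40 * D)) ?muln_gt0 ?D_gt0 //; apply: leq_trans H1.
  by rewrite leq_mul2l leq_addr orbT.
have H4 : 40 * 41 ^ k' * 39 ^ N <= 41 * (mp * mc.+1) * 40 ^ N * 40 ^ k'.
  rewrite -(@leq_pmul2l _ _ _ D0).
  have := leq_mul (leqnn (40 * 39 ^ N)) H3.
  have := leq_mul (leqnn (40 * 39 ^ N * 40 ^ k')) pw.
  have := leq_mul (leqnn (40 ^ k')) H2.
  move: (_ ^ size h) (41 ^ k') (40 ^ k') (39 ^ N) (40 ^ N) (pweight h i) (Phi_p h).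
  move=> x a b c d p q h1 h2 h3.
  have e1 : x * (40 * a * c) = 40 * c * (x * a) by ring.
  have e2 : x * (41 * (mp * mc.+1) * d * b) = b * (41 * (x * (mp * (mc.+1 * d)))) by ring.
  rewrite e1 e2; apply: leq_trans h3 _; apply: leq_trans _ h1.
  have -> : 40 * c * (p * b) = 40 * c * b * p by ring.
  by apply: leq_trans h2 _; apply: eq_leq; ring.
have keyX := power_gain X; rewrite -NE in keyX.
have H5 : 40 * 41 ^ (1260 * X) * 39 ^ N <= 41 * (mp * mc.+1) * 40 ^ N * 40 ^ (1260 * X).
  have arith a b c d x y m : 0 < a -> a <= b ->
      40 * (b * c) * x <= 41 * m * y * (a * d) -> 40 * c * x <= 41 * m * y * d.
    move=> a0 ab H; rewrite -(leq_pmul2l a0); apply: (@leq_trans (b * (40 * c * x))).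
      by rewrite leq_mul2r ab orbT.
    apply: leq_trans (leq_trans _ H) _; first by apply: eq_leq; ring.
    by apply: eq_leq; ring.
  apply: (arith (40 ^ (k' - 1260 * X)) (41 ^ (k' - 1260 * X))).
  - by rewrite expn_gt0.
  - exact: leq_exp2r_weak.
  - by move: H4; rewrite -{1 2}(subnK le_k) (expnD 41) (expnD 40).
have T0 : 0 < 40 ^ N * 40 ^ (1260 * X) by rewrite muln_gt0 !expn_gt0.
have : 40 * 2 ^ X <= 41 * (mp * mc.+1).
  rewrite -(leq_pmul2r T0); move: keyX H5 {H4 T0}.
  move: (40 ^ N) (40 ^ _) (41 ^ _) (39 ^ N) (2 ^ X) (mp * _) => a b c d x m h1 h2.
  have -> : 41 * m * (a * b) = 41 * m * a * b by ring.
  apply: leq_trans h2; have := leq_mul (leqnn 40) h1.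
  by rewrite !mulnA [40 * x * a * b]mulnAC.
have l1 : mp < 2 ^ mp by apply: ltn_expl.
have l2 : mc < 2 ^ mc by apply: ltn_expl.
rewrite /X expnS expnD; move: (2 ^ mp) (2 ^ mc) l1 l2 => x y l1 l2.
have := leq_mul l1 l2; nia.
Qed.

End Mwu.

(** * Loop patterns *)

Declare Scope hexp_scope.
Delimit Scope hexp_scope with H.
Bind Scope hexp_scope with hexp.
Notation "x + y" := (B OAdd x y) : hexp_scope.
Notation "x - y" := (B OSub x y) : hexp_scope.
Notation "x * y" := (B OMul x y) : hexp_scope.
Notation "x %/ y" := (B ODiv x y) : hexp_scope.
Notation "x %% y" := (B OMod x y) : hexp_scope.
Notation "x < y" := (B OLt x y) : hexp_scope.
Notation "x <= y" := (B OLe x y) : hexp_scope.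
Notation "x == y" := (B OEq x y) : hexp_scope.
Notation "x && y" := (B OAnd x y) : hexp_scope.
Notation "x || y" := (B OMax x y) : hexp_scope.
Notation "# a" := (G a (K 0)) (at level 2, a at level 1, format "# a") : hexp_scope.
Notation "a $ i" := (G a i) (at level 8, i at level 1) : hexp_scope.
Declare Scope hcmd_scope.
Delimit Scope hcmd_scope with C.
Bind Scope hcmd_scope with hcmd.
Notation "c ;; d" := (Seq_ c d) (at level 90, right associativity) : hcmd_scope.
Notation "a ::= e" := (Set_ a (K 0) e%H) (at level 70) : hcmd_scope.

Definition fold (o : op) (v acc : nat) (cnt init body : hexp) : hcmd :=
  (acc ::= init ;; For v cnt (acc ::= B o (#acc) body))%C.

Definition fill (v a : nat) (cnt body : hexp) : hcmd :=
  For v cnt (Set_ a (#v)%H body).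

Section Patterns.

Variables Y Z : nat.
Local Notation den := (den Y Z).

Lemma clamp_id e x : x < Z -> clamp Z e x = x.
Proof. by move=> xZ; rewrite /clamp; case: ifP => // _; rewrite modn_small. Qed.

Lemma upd_same s a i v : upd s a i v a i = v.
Proof. by rewrite /upd !eqxx. Qed.

Lemma upd_other s a b i v : b != a -> upd s a i v b = s b.
Proof. by rewrite /upd => /negPf->. Qed.

Lemma fold_spec o (v acc : nat) cnt init body s N (f : nat -> nat) x0 :
  v != acc -> hev s init = x0 -> x0 < Z ->
  hev (upd s acc 0 x0) cnt = N -> N <= Y ->
  (forall k, k <= N -> iteri k (fun i x => op_eval o x (f i)) x0 < Z) ->
  (forall i s', i < N -> s' v 0 = i -> (forall a, a != v -> a != acc -> s' a = s a) ->
     hev s' body = f i) ->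
  den (fold o v acc cnt init body) s acc 0 = iteri N (fun i x => op_eval o x (f i)) x0.
Proof.
move=> va ix x0Z cN NY bnd bodyE; set s0 := upd s acc 0 x0.
have -> : den (fold o v acc cnt init body) s =
    den (For v cnt (acc ::= B o (#acc) body)%C) s0.
  by rewrite /fold [LHS]/= ix clamp_id.
pose I k (s' : store) := s' acc 0 = iteri k (fun i x => op_eval o x (f i)) x0.
have := @for_rule Y Z I v cnt (acc ::= B o (#acc) body)%C s0.
rewrite -/s0 in cN; rewrite cN; apply => //.
- by rewrite inE.
- by rewrite /I !upd_other 1?eq_sym // /s0 upd_same.
- move=> i s' lt vi fr Ii; rewrite /I upd_other 1?eq_sym // [den _ _]/= upd_same (bodyE i s') //.
    by rewrite Ii clamp_id //; apply: (bnd i.+1).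
  by move=> a av aacc; rewrite fr ?inE // /s0 upd_other.
Qed.

Lemma iteri_sum k (f : nat -> nat) : iteri k (fun i x => op_eval OAdd x (f i)) 0 = \sum_(i < k) f i.
Proof. by elim: k => [|k IH]; rewrite ?big_ord0 // big_ord_recr /= -IH. Qed.

Lemma iteri_prod k (f : nat -> nat) : iteri k (fun i x => op_eval OMul x (f i)) 1 = \prod_(i < k) f i.
Proof. by elim: k => [|k IH]; rewrite ?big_ord0 // big_ord_recr /= -IH. Qed.

Lemma iteri_max k (f : nat -> nat) : iteri k (fun i x => op_eval OMax x (f i)) 0 = \max_(i < k) f i.
Proof. by elim: k => [|k IH]; rewrite ?big_ord0 // big_ord_recr /= -IH. Qed.

Lemma sum_spec (v acc : nat) cnt body s N (f : nat -> nat) :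
  v != acc -> (forall x, hev (upd s acc 0 x) cnt = N) -> N <= Y ->
  \sum_(i < N) f i < Z ->
  (forall i s', i < N -> s' v 0 = i -> (forall a, a != v -> a != acc -> s' a = s a) ->
     hev s' body = f i) ->
  den (fold OAdd v acc cnt (K 0) body) s acc 0 = \sum_(i < N) f i.
Proof.
move=> va cN NY bnd bodyE; rewrite -iteri_sum; apply: fold_spec => //.
  by case: (Z) bnd.
move=> k kN; rewrite iteri_sum; apply: leq_ltn_trans bnd.
by rewrite -!(big_mkord xpredT) (@big_cat_nat _ _ _ k 0 N) //= leq_addr.
Qed.

Lemma max_spec (v acc : nat) cnt body s N (f : nat -> nat) :
  v != acc -> (forall x, hev (upd s acc 0 x) cnt = N) -> N <= Y -> 0 < Z ->
  (forall i, i < N -> f i < Z) ->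
  (forall i s', i < N -> s' v 0 = i -> (forall a, a != v -> a != acc -> s' a = s a) ->
     hev s' body = f i) ->
  den (fold OMax v acc cnt (K 0) body) s acc 0 = \max_(i < N) f i.
Proof.
move=> va cN NY Z0 bnd bodyE; rewrite -iteri_max; apply: fold_spec => //.
move=> k kN; rewrite iteri_max; elim/big_ind: _ => // [x y lx ly|i _].
  by rewrite gtn_max lx.
by apply: bnd; apply: leq_trans kN.
Qed.

Lemma prod_spec (v acc : nat) cnt body s N (f : nat -> nat) :
  v != acc -> (forall x, hev (upd s acc 0 x) cnt = N) -> N <= Y ->
  1 < Z -> (forall i, i < N -> 0 < f i) -> \prod_(i < N) f i < Z ->
  (forall i s', i < N -> s' v 0 = i -> (forall a, a != v -> a != acc -> s' a = s a) ->
     hev s' body = f i) ->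
  den (fold OMul v acc cnt (K 1) body) s acc 0 = \prod_(i < N) f i.
Proof.
move=> va cN NY Z1 f0 bnd bodyE; rewrite -iteri_prod; apply: fold_spec => //.
move=> k kN; rewrite iteri_prod; apply: leq_ltn_trans bnd.
rewrite -!(big_mkord xpredT) (@big_cat_nat _ _ _ k 0 N) //= leq_pmulr //.
rewrite big_nat_cond prodn_cond_gt0 // => i; rewrite andbT => /andP[_]; exact: f0.
Qed.

Lemma fill_spec (v a : nat) cnt body s N (f : nat -> nat) :
  v != a -> hev s cnt = N -> N <= Y ->
  (forall i, i < N -> f i < Z) ->
  (forall i s', i < N -> s' v 0 = i -> (forall b, b != v -> b != a -> s' b = s b) ->
     hev s' body = f i) ->
  forall i, i < N -> den (fill v a cnt body) s a i = f i.
Proof.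
move=> va cN NY bnd bodyE.
pose I k (s' : store) := forall i, i < k -> s' a i = f i.
have := @for_rule Y Z I v cnt (Set_ a (#v)%H body) s.
rewrite cN; apply => //.
- by rewrite inE.
- move=> i s' lt vi fr Ii j; rewrite ltnS leq_eqVlt upd_other 1?eq_sym // [den _ _]/= vi.
  rewrite (bodyE i s') // => [|b bv ba]; last by rewrite fr ?inE.
  rewrite clamp_id ?bnd //; have [->|ji] := eqVneq j i; first by rewrite upd_same.
  by rewrite /upd eqxx (negPf ji); apply: Ii.
Qed.

End Patterns.

Section Steps.

Variables Y Z : nat.
Local Notation den := (den Y Z).

Lemma den_seq c d s : den (Seq_ c d) s = den d (den c s).
Proof. by []. Qed.

Lemma den_nop s : den Nop s = s.
Proof. by []. Qed.

Lemma den_set a i e s : den (Set_ a i e) s = upd s a (hev s i) (clamp Z e (hev s e)).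
Proof. by []. Qed.

Lemma den_if e c d s : den (If_ e c d) s = if hev s e != 0 then den c s else den d s.
Proof. by []. Qed.

Lemma bool_neq0 (b : bool) : ((b : nat) != 0) = b.
Proof. by case: b. Qed.

Lemma maxb_neq0 (a b : bool) : (maxn a b != 0) = a || b.
Proof. by case: a; case: b. Qed.

Definition boolE := (bool_neq0, maxb_neq0).

Lemma clamp_safe e x : safe e -> clamp Z e x = x.
Proof. by rewrite /clamp => ->. Qed.

Lemma upd_cell s a i j v : upd s a i v a j = if j == i then v else s a j.
Proof. by rewrite /upd eqxx. Qed.

End Steps.

Global Opaque den.

(** * The multiplicative weights as a program *)

Notation aNV := 15. Notation aMP := 16. Notation aMC := 17. Notation aN := 18.
Notation aIT := 19. Notation aD := 20. Notation aA := 31. Notation aC := 32.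
Notation aPW := 33. Notation aCOV := 34. Notation aCW := 35. Notation aV := 36.
Notation aBC := 37. Notation aBA := 38. Notation aBE := 39. Notation aAS := 40.
Notation aCS := 41. Notation vT := 42. Notation vE := 43. Notation vI := 44.
Notation vR := 45. Notation aPOW := 46.

Definition scan : hcmd :=
  (fold OAdd vI aAS (#aMP) (K 0) (aPW $ (#vI) * aA $ (#vI * #aNV + #vE)) ;;
   fold OAdd vR aCS (#aMC) (K 0) (aC $ (#vR * #aNV + #vE) * aCW $ (#vR)) ;;
   If_ (#aCS && ((#aBC == K 0) || (#aAS * #aBC < #aBA * #aCS)))%H
     (aBC ::= #aCS ;; aBA ::= #aAS ;; aBE ::= #vE) Nop)%C.

Definition search : hcmd := (aBC ::= K 0 ;; For vE (#aNV) scan)%C.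

Definition bump_pack : hcmd :=
  fill vI aPW (#aMP) (aPW $ (#vI) * (K 40 * #aD + aA $ (#vI * #aNV + #aBE))).

(** Division by 40 is exact, because the weight of a row contains one factor 40 for every unit of
    coverage that it still lacks. *)
Definition bump_cover : hcmd :=
  For vR (#aMC)
    (If_ (aC $ (#vR * #aNV + #aBE) && (aCOV $ (#vR) < #aN))%H
       (Set_ aCOV (#vR) (aCOV $ (#vR) + K 1) ;;
        Set_ aCW (#vR) ((aCOV $ (#vR) < #aN) * (aCW $ (#vR) %/ K 40 * K 39))) Nop)%C.

Definition raise_column : hcmd :=
  (Set_ aV (#aBE) (aV $ (#aBE) + K 1) ;; bump_pack ;; bump_cover)%C.

(** The initial coverage of a row is 0 or [N], so the single power [40 ^ N] provides all initial
    covering weights. *)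
Definition solver_init : hcmd :=
  (fill vI aPW (#aMP) (K 1) ;; fill vE aV (#aNV) (K 0) ;;
   fold OMul vT aPOW (#aN) (K 1) (K 40) ;;
   fill vR aCW (#aMC) ((aCOV $ (#vR) < #aN) * #aPOW))%C.

Definition solver : hcmd :=
  (solver_init ;; For vT (#aIT) (search ;; If_ (#aBC) raise_column Nop))%C.

Section Solver.

Variables (Y Z mp mc nv N D It : nat) (A C : nat -> nat -> nat) (L0 : nat -> nat).
Local Notation den := (den Y Z).

Hypotheses (D_gt0 : 0 < D) (A_le : forall i e, A i e <= D) (C_le : forall r e, C r e <= 1).
Hypotheses (mpY : mp <= Y) (mcY : mc <= Y) (nvY : nv <= Y) (NY : N <= Y) (ItY : It <= Y).
Hypotheses (YZ : Y < Z) (packZ : mp * ((41 * D) ^ It * D) < Z) (packZ' : (41 * D) ^ It < Z)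
  (covZ : mc * 40 ^ N < Z) (covZ' : 40 ^ N < Z).
Hypotheses (L0_N : forall r, L0 r = 0 \/ L0 r = N).

Local Notation best := (best mp mc nv N D A C L0).
Local Notation run := (run mp mc nv N D A C L0).
Local Notation pcol := (pcol mp D A).
Local Notation ccol := (ccol mc N C L0).
Local Notation covered_of := (coverage N C L0).
Local Notation cover_weight := (cweight N C L0).
Local Notation pack_weight := (pweight D A).

Definition solver_ctx (s : store) : Prop :=
  [/\ s aMP 0 = mp, s aMC 0 = mc, s aNV 0 = nv, s aN 0 = N &
   [/\ s aD 0 = D, s aIT 0 = It,
    forall i e, i < mp -> e < nv -> s aA (i * nv + e) = A i e &
    forall r e, r < mc -> e < nv -> s aC (r * nv + e) = C r e]].

Lemma solver_ctx_eq s s' :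
  {in [:: aMP; aMC; aNV; aN; aD; aIT; aA; aC], forall a, s' a = s a} ->
  solver_ctx s -> solver_ctx s'.
Proof. by move=> fr; rewrite /solver_ctx !fr. Qed.

Definition solver_state (h : seq nat) (s : store) : Prop :=
  [/\ forall i, i < mp -> s aPW i = pack_weight h i,
      forall r, r < mc -> s aCOV r = covered_of h r,
      forall r, r < mc -> s aCW r = cover_weight h r &
      forall e, e < nv -> s aV e = count_mem e h].

Lemma solver_state_eq h s s' :
  {in [:: aPW; aCOV; aCW; aV], forall a, s' a = s a} ->
  solver_state h s -> solver_state h s'.
Proof. by move=> fr; rewrite /solver_state !fr. Qed.

Lemma Z_gt0 : 0 < Z. Proof. by apply: leq_ltn_trans YZ. Qed.

Lemma cweight_le h r : cover_weight h r <= 40 ^ N.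
Proof.
rewrite /cweight; case: ifP => // lt.
by rewrite -[X in _ <= 40 ^ X](subnKC (ltnW lt)) expnD leq_mul2r leq_exp2r_weak ?orbT.
Qed.

Lemma ccol_lt h e : ccol h e < Z.
Proof.
apply: leq_ltn_trans covZ; rewrite -[mc in leqRHS]card_ord -sum_nat_const.
apply: leq_sum => r _; rewrite -[leqRHS]mul1n; apply: leq_mul => //.
exact: cweight_le.
Qed.

Lemma pcol_lt h e : size h <= It -> pcol h e < Z.
Proof.
move=> hI; apply: leq_ltn_trans packZ; rewrite -[mp in leqRHS]card_ord -sum_nat_const.
apply: leq_sum => i _; apply: leq_mul => //.
apply: leq_trans (pweight_le D_gt0 A_le _ _) _.
by rewrite leq_pexp2l // muln_gt0.
Qed.

Definition scanned (h : seq nat) (k : nat) (s : store) : Prop :=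
  let bc := s aBC 0 in
  (bc = 0 /\ forall e, e < k -> ccol h e = 0) \/
  [/\ 0 < bc, s aBE 0 < k, bc = ccol h (s aBE 0), s aBA 0 = pcol h (s aBE 0) &
     forall e, e < k -> pcol h (s aBE 0) * ccol h e <= pcol h e * ccol h (s aBE 0)].

Lemma scan_correct h k s : size h <= It -> k < nv -> s vE 0 = k ->
  solver_ctx s -> solver_state h s -> scanned h k s -> scanned h k.+1 (den scan s).
Proof.
move=> hI knv vk cx st sc; rewrite /scan den_seq; set c1 := fold OAdd vI _ _ _ _; set s1 := den c1 s.
have asE : s1 aAS 0 = pcol h k.
  case: cx => mpE _ nvE _ [_ _ AE _]; case: st => pwE _ _ _.
  rewrite /s1 /c1 (@sum_spec Y Z _ _ _ _ _ mp (fun i => pack_weight h i * A i k)) //.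
  - exact: pcol_lt.
  - by move=> i s' lt vi fr /=; rewrite vi !fr // nvE vk pwE ?AE.
have fr1 a : a \notin assigned c1 -> s1 a = s a by apply: den_frame.
rewrite den_seq; set c2 := fold OAdd vR _ _ _ _; set s2 := den c2 s1.
have csE : s2 aCS 0 = ccol h k.
  case: cx => _ mcE nvE _ [_ _ _ CE]; case: st => _ _ cwE _.
  rewrite /s2 /c2 (@sum_spec Y Z _ _ _ _ _ mc (fun r => C r k * cover_weight h r)) //.
  - by move=> x /=; rewrite upd_other // fr1.
  - exact: ccol_lt.
  - by move=> i s' lt vi fr /=; rewrite vi !fr // !fr1 // nvE vk cwE ?CE.
have fr2 a : a \notin assigned c2 -> s2 a = s1 a by apply: den_frame.
have as2 : s2 aAS 0 = pcol h k by rewrite -asE fr2.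
rewrite den_if /= csE as2 !fr2 // !fr1 //.
move: sc; rewrite /scanned.
have [ck|ck] := posnP (ccol h k).
  rewrite ck /= den_nop !fr2 // !fr1 //; case=> [[b0 c0]|[b0 bk bE aE H]]; [left|right].
    by split=> // e; rewrite ltnS leq_eqVlt => /orP[/eqP->|/c0].
  split=> // [|e]; first exact: ltnW.
  by rewrite ltnS leq_eqVlt => /orP[/eqP->|/H //]; rewrite ck muln0.
rewrite [~~ false && _]/= !boolE.
rewrite !den_seq !den_set !clamp_safe // den_nop; set u := upd _ aBE _ _.
have uE : [/\ u aBC 0 = ccol h k, u aBA 0 = pcol h k & u aBE 0 = k].
  by rewrite /u /= /upd /= csE as2 !fr2 // !fr1 // vk.
case: uE => u1 u2 u3.
case=> [[b0 c0]|[b0 bk bE aE H]].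
  rewrite b0 /= u1 u2 u3; right; split=> // e.
  by rewrite ltnS leq_eqVlt => /orP[/eqP->//|/c0->]; rewrite muln0.
rewrite (gtn_eqF b0); case: ltnP => [lt|ge] /=; right; last first.
  rewrite !fr2 // !fr1 //; split=> // [|e]; first exact: ltnW.
  rewrite ltnS leq_eqVlt => /orP[/eqP->|/H //].
  by rewrite -bE -aE.
 rewrite u1 u2 u3; split=> // e; rewrite ltnS leq_eqVlt => /orP[/eqP->//|/H He].
  (* Cross-multiplied comparisons compose because the covering weight of the previous candidate is
     positive. *)
  rewrite bE aE in lt; rewrite bE in b0; rewrite -(leq_pmul2r b0).
  move: lt He b0; move: (pcol h _) (ccol h _) (pcol h _) (ccol h e) (pcol h e) => a b a' c' p.
  by nia.
Qed.

Lemma search_correct h s : size h <= It -> solver_ctx s -> solver_state h s ->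
  scanned h nv (den search s).
Proof.
move=> hI cx st; rewrite /search den_seq den_set.
set s0 := upd s aBC _ _.
have cx0 : solver_ctx s0 by apply: solver_ctx_eq cx => a; rewrite !inE => /or4P[|||/or4P[|||/orP[]]] /eqP->.
have st0 : solver_state h s0 by apply: solver_state_eq st => a; rewrite !inE => /or4P[] /eqP->.
have nvE : s0 aNV 0 = nv by case: cx0.
have := @for_rule Y Z (scanned h) vE (#aNV)%H scan s0; rewrite /= nvE; apply => //.
  by left.
move=> i s' lt vi fr sc.
have cx' : solver_ctx s'.
  by apply: solver_ctx_eq cx0 => a; rewrite !inE => /or4P[|||/or4P[|||/orP[]]] /eqP->; apply: fr.
have st' : solver_state h s'.
  by apply: solver_state_eq st0 => a; rewrite !inE => /or4P[] /eqP->; apply: fr.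
have := scan_correct hI lt vi cx' st' sc.
by rewrite /scanned !upd_other.
Qed.

Lemma bump_correct h s : size h < It -> best h (s aBE 0) ->
  solver_ctx s -> solver_state h s -> solver_state (s aBE 0 :: h) (den raise_column s).
Proof.
move=> hI be [mpE mcE nvE NE [DE _ AE CE]] [pwE covE cwE vE].
have [lt_e _ _] := be; set e := s aBE 0 in lt_e be *.
rewrite /raise_column den_seq den_set; set s1 := upd _ _ _ _; rewrite den_seq.
have fr1 a : a != aV -> s1 a = s a by move=> h1; rewrite /s1 upd_other.
set s2 := den bump_pack s1.
have fr2 a : a \notin assigned bump_pack -> s2 a = s1 a by apply: den_frame.
have pw2 i : i < mp -> s2 aPW i = pack_weight (e :: h) i.
  pose I k (s' : store) := forall i, s' aPW i = if i < k then pack_weight (e :: h) i else s1 aPW i.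
  have mpE1 : s1 aMP 0 = mp by rewrite fr1.
  have := @for_rule Y Z I vI (#aMP)%H
    (Set_ aPW (#vI)%H (aPW $ (#vI) * (K 40 * #aD + aA $ (#vI * #aNV + #aBE)))%H) s1.
  rewrite /= mpE1 => H; suff Hm : I mp s2 by move=> lti; rewrite Hm lti.
  rewrite /s2 /bump_pack /fill; apply: H => // {}i s' lt vi fr Ii j.
  rewrite upd_other // den_set upd_cell /= vi !Ii ltnn !fr // !fr1 // DE nvE -/e AE //.
  rewrite pwE // -pweight_cons clamp_id; last first.
    apply: leq_ltn_trans packZ'; apply: leq_trans (pweight_le D_gt0 A_le _ _) _.
    by rewrite leq_pexp2l // muln_gt0.
  have [->|ji] := eqVneq j i; first by rewrite ltnS leqnn.
  by rewrite ltnS [j <= i]leq_eqVlt (negPf ji).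
have bc3 := den_frame.
pose J k (s' : store) := (forall r, r < mc ->
   s' aCOV r = (if r < k then covered_of (e :: h) r else covered_of h r) /\
   s' aCW r = (if r < k then cover_weight (e :: h) r else cover_weight h r)).
set s3 := den bump_cover s2.
have cov3 : J mc s3.
  have mcE2 : s2 aMC 0 = mc by rewrite fr2.
  have := @for_rule Y Z J vR (#aMC)%H (If_ (aC $ (#vR * #aNV + #aBE) && (aCOV $ (#vR) < #aN))%H
       (Set_ aCOV (#vR)%H (aCOV $ (#vR) + K 1)%H ;;
        Set_ aCW (#vR)%H ((aCOV $ (#vR) < #aN) * (aCW $ (#vR) %/ K 40 * K 39))%H) Nop)%C s2.
  rewrite /= mcE2; apply => //.
    by move=> r lt; rewrite /= !upd_other // !fr2 // !fr1 // covE // cwE.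
  move=> i s' lt vi fr Ji r ltr; rewrite den_if /= vi (fr aC) // (fr aNV) // (fr aBE) //.
  rewrite (fr aN) // !fr2 // !fr1 // nvE -/e CE // NE.
  have [covi cwi] := Ji i lt; rewrite ltnn in covi cwi; have [covr cwr] := Ji r ltr.
  have Cle := C_le i e; rewrite covi.
  have cN : covered_of h i <= N by apply: geq_minl.
  have covC := coverage_cons N C L0 D_gt0 h e i.
  have cwC : cover_weight (e :: h) i = if (C i e != 0) && (covered_of h i < N)
      then (covered_of h i + 1 < N) * (cover_weight h i %/ 40 * 39) else cover_weight h i.
    rewrite /cweight covC; move: Cle; case: (C i e) => [|[|]] //= _.
      by rewrite addn0 (minn_idPr cN).
    case: (ltnP (covered_of h i) N) => [lt'|ge] /=; last by rewrite ifF //; lia.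
    rewrite addn1 (minn_idPr lt'); case: ifP => _; last by rewrite mul0n.
    rewrite mul1n (_ : N - covered_of h i = (N - (covered_of h i).+1).+1); last by lia.
    by rewrite [40 ^ _.+1]expnSr mulnA mulnK // expnSr mulnAC.
  have covC' : covered_of (e :: h) i = if (C i e != 0) && (covered_of h i < N)
      then covered_of h i + 1 else covered_of h i.
    rewrite covC; move: Cle; case: (C i e) => [|[|]] //= _; first by rewrite addn0 (minn_idPr cN).
    by case: ifP; lia.
  rewrite !boolE; case: ifP => cond; rewrite cond in cwC covC'.
    rewrite den_seq !den_set /= /upd /= vi ?eqxx covi cwi (fr aN) // fr2 // fr1 // NE.
    have [->|ri] := eqVneq r i; last by rewrite ltnS leq_eqVlt (negPf ri).
    have c1 : covered_of h i + 1 < Z.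
      by case/andP: cond => _ lt'; apply: leq_ltn_trans YZ; apply: leq_trans NY; rewrite addn1.
    rewrite ltnSn covC' cwC (clamp_id _ c1) clamp_id //.
    apply: leq_ltn_trans _ covZ'; case: (_ < N); rewrite ?mul0n // mul1n.
    apply: leq_trans (cweight_le h i).
    by apply: leq_trans (leq_divM (cover_weight h i) 40); rewrite leq_mul2l orbT.
  rewrite den_nop !upd_other //; have [->|ri] := eqVneq r i; last by rewrite ltnS leq_eqVlt (negPf ri).
  by rewrite ltnSn covi cwi covC' cwC.
have fr3 a : a \notin assigned bump_cover -> s3 a = s2 a by apply: den_frame.
split.
- by move=> i lt; rewrite fr3 // pw2.
- by move=> r lt; case: (cov3 r lt) => ->; rewrite lt.
- by move=> r lt; case: (cov3 r lt) => _ ->; rewrite lt.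
- move=> f ltf; rewrite fr3 // fr2 // /s1 upd_cell /= -/e.
  rewrite eq_sym clamp_id; last first.
    rewrite vE //; apply: leq_ltn_trans YZ; apply: leq_trans ItY.
    by rewrite addn1; apply: leq_ltn_trans (count_size _ _) hI.
  by case: eqP => [->|_]; rewrite vE // addn1.
Qed.

Lemma solver_init_correct s : solver_ctx s -> (forall r, r < mc -> s aCOV r = L0 r) ->
  solver_state [::] (den solver_init s).
Proof.
move=> [mpE mcE nvE NE _] covE; rewrite /solver_init den_seq.
set c1 := fill vI _ _ _; set s1 := den c1 s; rewrite den_seq.
set c2 := fill vE _ _ _; set s2 := den c2 s1; rewrite den_seq.
set c3 := fold _ _ _ _ _ _; set s3 := den c3 s2; set c4 := fill vR _ _ _; set s4 := den c4 s3.
have fr1 a : a \notin assigned c1 -> s1 a = s a by apply: den_frame.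
have fr2 a : a \notin assigned c2 -> s2 a = s1 a by apply: den_frame.
have fr3 a : a \notin assigned c3 -> s3 a = s2 a by apply: den_frame.
have fr4 a : a \notin assigned c4 -> s4 a = s3 a by apply: den_frame.
have Z1 : 1 < Z.
  by apply: leq_ltn_trans covZ'; rewrite expn_gt0.
have pow3 : s3 aPOW 0 = 40 ^ N.
  rewrite /s3 /c3 (@prod_spec Y Z _ _ _ _ _ N (fun _ => 40)) //.
  - by rewrite prod_nat_const card_ord.
  - by move=> x /=; rewrite upd_other // fr2 // fr1.
  - by rewrite prod_nat_const card_ord.
have cov0 r : r < mc -> covered_of [::] r = s aCOV r.
  by move=> lt; rewrite covE // /coverage big_nil addn0; case: (L0_N r) => ->; rewrite ?minn0 ?minnn.
split.
- move=> i lt; rewrite fr4 // fr3 // fr2 // /s1 /c1 (@fill_spec Y Z _ _ _ _ _ mp (fun _ => 1)) //.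
  by rewrite /pweight big_nil.
- by move=> r lt; rewrite fr4 // fr3 // fr2 // fr1 // cov0.
- move=> r lt; rewrite /s4 /c4 (@fill_spec Y Z _ _ _ _ _ mc (fun r => cover_weight [::] r)) //.
  + by rewrite /= fr3 // fr2 // fr1.
  + by move=> i _; apply: leq_ltn_trans (cweight_le _ _) covZ'.
  + move=> i s' lti vi fr; rewrite /= vi (fr aCOV) // (fr aN) // (fr aPOW) // pow3.
    rewrite !fr3 // !fr2 // !fr1 // NE /cweight cov0 // covE //.
    by case: (L0_N i) => ->; rewrite ?ltnn ?mul0n // subn0 expn0 mul1n; case: N => // n; rewrite mul1n.
- move=> e lt; rewrite fr4 // fr3 // /s2 /c2 (@fill_spec Y Z _ _ _ _ _ nv (fun _ => 0)) //.
    by rewrite /= fr1.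
  by move=> i _; apply: Z_gt0.
Qed.

Definition stuck (h : seq nat) : Prop := forall e, e < nv -> ccol h e = 0.

Lemma solver_correct s : solver_ctx s -> (forall r, r < mc -> s aCOV r = L0 r) ->
  exists h, [/\ run h, size h <= It, solver_state h (den solver s) & size h = It \/ stuck h].
Proof.
move=> cx covE; rewrite /solver den_seq; set s0 := den solver_init s.
have st0 : solver_state [::] s0 by apply: solver_init_correct.
have cx0 : solver_ctx s0.
  by apply: solver_ctx_eq cx => a; rewrite !inE => /or4P[|||/or4P[|||/orP[]]] /eqP->; apply: den_frame.
have itE : s0 aIT 0 = It by case: cx0 => _ _ _ _ [].
pose I k (s' : store) := exists h, [/\ run h, size h <= k, solver_state h s' & size h = k \/ stuck h].
have := @for_rule Y Z I vT (#aIT)%H (search ;; If_ (#aBC) raise_column Nop)%C s0.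
rewrite /= itE; apply => //.
  exists [::]; split=> //; [exact: run_nil | by left].
move=> i s' lt vi fr [h [rh hi st halt]].
have cx' : solver_ctx s'.
  by apply: solver_ctx_eq cx0 => a; rewrite !inE => /or4P[|||/or4P[|||/orP[]]] /eqP->; apply: fr.
have hIt : size h <= It by apply: leq_trans hi (ltnW lt).
have := search_correct hIt cx' st.
rewrite den_seq den_if; set s1 := den search s' => sc.
have fr1 a : a \notin assigned search -> s1 a = s' a by apply: den_frame.
have st1 : solver_state h s1.
  by apply: solver_state_eq st => a; rewrite !inE => /or4P[] /eqP->; apply: fr1.
have cx1 : solver_ctx s1.
  by apply: solver_ctx_eq cx' => a; rewrite !inE => /or4P[|||/or4P[|||/orP[]]] /eqP->; apply: fr1.
have upd_st h' s2 : solver_state h' s2 -> solver_state h' (upd s2 vT 0 i.+1).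
  by apply: solver_state_eq => a; rewrite !inE => /or4P[] /eqP->.
case: sc => [[b0 c0]|[b0 bk bE _ H]].
  rewrite /= b0 /= den_nop; exists h; split=> //; [exact: leqW|by right].
rewrite /= -lt0n b0; case: halt => [hE|st_h]; last first.
  by rewrite bE st_h in b0.
have be : best h (s1 aBE 0) by split=> //; rewrite -bE.
exists (s1 aBE 0 :: h); split=> //; first exact: run_cons.
  apply: upd_st; apply: bump_correct => //; lia.
by left; rewrite /= hE.
Qed.

(** A chosen column has positive covering weight, so it raises some row that is still below [N]. The
    total coverage is at most [mc * N], which fixes the number of rounds. *)
Lemma sum_coverage h : run h -> size h <= \sum_(r < mc) covered_of h r.
Proof.
elim=> {h} // h e rh IHh [_ cgt _]; apply: leq_ltn_trans IHh _.
move: cgt; rewrite lt0n sum_nat_eq0 => /forallPn[r]; rewrite muln_eq0 negb_or /= => /andP[C0 cw0].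
have cov_lt : covered_of h r < N by move: cw0; rewrite /cweight; case: ifP.
rewrite (bigD1 r) //= [in X in _ < X](bigD1 r) //= -addSn; apply: leq_add.
  by rewrite (coverage_cons N C L0 D_gt0); lia.
by apply: leq_sum => i _; rewrite (coverage_cons N C L0 D_gt0) leq_min leq_addr geq_minl.
Qed.

(** After all [It] rounds the total coverage leaves no row short. If the search failed earlier, an
    uncovered row would still have positive weight in a column of the 0/1 solution [E], which the
    search would have found. *)
Lemma all_covered (E : pred nat) h : It = mc * N ->
  (forall r, r < mc -> L0 r < N -> 0 < \sum_(e < nv | E e) C r e) ->
  run h -> size h = It \/ stuck h -> forall r, r < mc -> covered_of h r = N.
Proof.
move=> ItE E_cover rh halt r ltr.
have cN r' : covered_of h r' <= N by apply: geq_minl.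
apply/eqP; rewrite eqn_leq cN leqNgt; apply/negP => lt.
case: halt => [hE|st].
  have := sum_coverage rh; rewrite hE ItE; apply/negP; rewrite -ltnNge.
  rewrite (bigD1 (Ordinal ltr)) //=; apply: (@leq_trans (N + \sum_(i < mc | i != Ordinal ltr) N)).
    by rewrite -addSn leq_add // leq_sum.
  have : \sum_(i < mc) N = mc * N by rewrite sum_nat_const card_ord.
  by rewrite (bigD1 (Ordinal ltr)) //= => ->.
have lt0 : L0 r < N by move: lt; rewrite /coverage; lia.
have := E_cover r ltr lt0; rewrite lt0n sum_nat_eq0 => /forallPn[e].
rewrite negb_imply => /andP[_ Ce].
have := st e (ltn_ord e); apply/eqP; rewrite sum_nat_eq0; apply/forallPn.
exists (Ordinal ltr); rewrite muln_eq0 negb_or Ce /= /cweight lt -lt0n.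
by rewrite muln_gt0 !expn_gt0.
Qed.

End Solver.

(** * The linear program *)

Lemma sum_blocks p K (F : nat -> nat) :
  \sum_(e < p * K) F e = \sum_(a < p) \sum_(l < K) F (a * K + l).
Proof.
elim: p => [|p IHp]; first by rewrite mul0n !big_ord0.
rewrite big_ord_recr /= -IHp -!(big_mkord xpredT) /= mulSn addnC.
rewrite (@big_cat_nat _ _ _ (p * K)) ?leq_addr //=; congr (_ + _).
rewrite -{1}[p * K]add0n big_addn addKn ?big_mkord; apply: eq_bigr => i _.
by rewrite addnC.
Qed.

Lemma divn_block a K l : l < K -> (a * K + l) %/ K = a.
Proof. by move=> lK; rewrite divnMDl ?divn_small ?addn0 //; lia. Qed.

Lemma modn_block a K l : l < K -> (a * K + l) %% K = l.
Proof. by move=> lK; rewrite modnMDl modn_small. Qed.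

Lemma block_lt a p K l : a < p -> l < K -> a * K + l < p * K.
Proof. move=> ap lK; nia. Qed.

Lemma sum_count_mem (h : seq nat) nv (F : nat -> nat) : all (fun e => e < nv) h ->
  \sum_(e <- h) F e = \sum_(e < nv) count_mem (e : nat) h * F e.
Proof.
elim: h => [|e h IHh] /=; first by rewrite big_nil big1.
case/andP=> lt /IHh IH; rewrite big_cons IH.
under [RHS]eq_bigr do rewrite mulnDl; rewrite big_split /=; congr (_ + _).
rewrite (bigD1 (Ordinal lt)) //= eqxx mul1n big1 ?addn0 // => i.
by rewrite -val_eqE /= eq_sym => /negPf->.
Qed.

Section LinearProgram.

Variables (n m g K N Bd : nat) (P r s w : nat -> nat) (inc : nat -> nat -> bool) (th : nat -> nat).

(** A job without work and release date can complete at time 0, the grid time of level 0; it gets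
    block 0 and imposes no covering row. *)
Definition nontrivial (j : nat) : bool := 0 < P j + r j.
Definition top_speed : nat := \max_(i < m) s i.
Definition eligible (j l : nat) : bool := (r j <= th l) && (P j <= top_speed * th l).
(** By time [th k], a job at least as long as [j] can be done only on a machine that could also do
    [j] by then. The joint work of these machines bounds the total length of all such jobs. *)
Definition capacity (j k : nat) : nat := th k * \sum_(i < m) (P j <= s i * th k) * s i.
Definition cap1 (j k : nat) : nat := capacity j k + (capacity j k == 0).
Definition cap_prod : nat := \prod_(i < n * K) cap1 (i %/ K) (i %% K).
(** A common right-hand side for all packing rows: it is a multiple of every (nonzero) capacity and
    of the budget, so each row is scaled to it exactly. *)
Definition lp_D : nat := Bd * cap_prod.
Definition gap (k : nat) : nat := th k.+1 - th k.
(** The multiplicative weights need every entry of a packing row to be at most its right-hand side.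
    Columns violating this in the cost row are switched off; a solution within the budget cannot use
    them. [eligible] plays the same part for the job rows. *)
Definition affordable (S k : nat) : bool := w S * gap k <= Bd.

(* Column [a * K + l] is "job [a] is finished at [th l]" for [a < n], and "group
   [a - n] is unfinished at [th l]" otherwise. *)
Definition lp_A (i e : nat) : nat :=
  let a := e %/ K in let l := e %% K in
  if i < n * K then
    [&& a < n, l <= i %% K, eligible a l & P (i %/ K) <= P a] *
      (P a * (lp_D %/ cap1 (i %/ K) (i %% K)))
  else ((n <= a) && affordable (a - n) l) * (w (a - n) * gap l * cap_prod).

(** Row [(S * n + j) * K + k] says that at time [th k] the group [S] is unfinished or its member [j]
    is finished. If [j] is not a nontrivial member of [S], [lp_L0] declares the row covered from the
    start. *)
Definition lp_C (q e : nat) : nat :=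
  let a := e %/ K in let l := e %% K in
  let k := q %% K in let j := (q %/ K) %% n in let S := (q %/ K) %/ n in
  if a < n then [&& a == j, l <= k & eligible a l]
  else [&& a - n == S, l == k & affordable S k].

Definition lp_L0 (q : nat) : nat :=
  let j := (q %/ K) %% n in let S := (q %/ K) %/ n in
  if inc S j && nontrivial j then 0 else N.

Local Notation nv := ((n + g) * K).
Local Notation mp := (n * K).+1.
Local Notation mc := (g * n * K).

Hypothesis th_mono : forall k, th k <= th k.+1.
Hypothesis th0 : th 0 = 0.
Hypothesis Bd_gt0 : 0 < Bd.

Lemma th_le k l : k <= l -> th k <= th l.
Proof.
move=> /subnK <-; elim: (l - k) => // d IH; exact: leq_trans IH (th_mono _).
Qed.

Lemma cap1_gt0 j k : 0 < cap1 j k.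
Proof. by rewrite /cap1; case: (capacity j k). Qed.

Lemma cap_prod_gt0 : 0 < cap_prod.
Proof. by rewrite /cap_prod prodn_gt0 // => i; apply: cap1_gt0. Qed.

Lemma lp_D_gt0 : 0 < lp_D.
Proof. by rewrite muln_gt0 Bd_gt0 cap_prod_gt0. Qed.

Lemma lp_D_cap i : i < n * K -> lp_D %/ cap1 (i %/ K) (i %% K) * cap1 (i %/ K) (i %% K) = lp_D.
Proof.
move=> lt; rewrite divnK // /lp_D /cap_prod (bigD1 (Ordinal lt)) //=.
by rewrite dvdn_mull // dvdn_mulr.
Qed.

(** An eligible job fits on a fastest machine by time [th k]. As [j] is not longer, that machine is
    counted in the capacity, whose contribution alone is large enough. *)
Lemma work_le_cap a l j k : l <= k -> eligible a l -> P j <= P a -> P a <= cap1 j k.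
Proof.
move=> lk /andP[_ Pa] Pj; apply: leq_trans (leq_addr _ _).
have [m0|m0] := posnP m.
  by move: Pa; rewrite /top_speed m0 big_ord0 mul0n leqn0 => /eqP->.
have [|i0 i0E] := @bigop.eq_bigmax _ (fun i : 'I_m => s i); first by rewrite card_ord.
rewrite -/top_speed in i0E.
rewrite /capacity; have thk := th_le lk.
have Pk : P a <= s i0 * th k by rewrite -i0E; apply: leq_trans Pa _; rewrite leq_mul2l thk orbT.
rewrite (bigD1 i0) //= (leq_trans Pj Pk) mul1n mulnDr mulnC.
by apply: leq_trans Pk _; rewrite mulnC leq_addr.
Qed.

Lemma lp_A_le i e : lp_A i e <= lp_D.
Proof.
rewrite /lp_A; case: ifP => [lt|_].
  case: (boolP [&& _, _, _ & _]) => [/and4P[_ lk el Pj]|_]; last by rewrite mul0n.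
  rewrite mul1n -[X in _ <= X](lp_D_cap lt) mulnC leq_mul2l.
  by rewrite (work_le_cap lk el Pj) orbT.
case: (boolP (_ && _)) => [/andP[_ af]|_]; last by rewrite mul0n.
by rewrite mul1n /lp_D leq_mul2r (af : _ <= Bd) orbT.
Qed.

Lemma lp_C_le q e : lp_C q e <= 1.
Proof. by rewrite /lp_C; case: ifP => _; case: [&& _, _ & _]. Qed.

(** ** The 0/1 solution given by a schedule *)

Section Comparator.

Variable lev : nat -> nat.
Hypothesis lev_le : forall j, lev j <= K.
Hypothesis lev_eligible : forall j, j < n -> nontrivial j -> lev j < K -> eligible j (lev j).
Hypothesis lev_capacity : forall j k, j < n -> k < K ->
  \sum_(a < n | [&& nontrivial a, lev a <= k & P j <= P a]) P a <= cap1 j k.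

Definition group_lev (S : nat) : nat := \max_(j < n | inc S j && nontrivial j) lev j.
Definition lev_cost : nat := \sum_(S < g) w S * th (group_lev S).
Hypothesis cost_le : lev_cost <= Bd.

Definition lev_cols : pred nat := fun e =>
  let a := e %/ K in let l := e %% K in
  if a < n then nontrivial a && (l == lev a) else l < group_lev (a - n).

Lemma group_lev_le S : group_lev S <= K.
Proof. by apply/bigmax_leqP => j _; apply: lev_le. Qed.

Lemma sum_gap k : \sum_(l < k) gap l = th k.
Proof.
elim: k => [|k IHk]; first by rewrite big_ord0 th0.
by rewrite big_ord_recr /= IHk /gap subnKC.
Qed.

Lemma lev_pack i : i < mp -> \sum_(e < nv | lev_cols e) lp_A i e <= lp_D.
Proof.
move=> lti; rewrite big_mkcond /=.
rewrite (sum_blocks _ _ (fun e => if lev_cols e then lp_A i e else 0)) big_split_ord /=.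
have [lt|ge] := ltnP i (n * K).
  rewrite [X in _ + X]big1 ?addn0 => [|S _]; last first.
    apply: big1 => l _; rewrite /lp_A lt divn_block // ltnNge leq_addr /= mul0n.
    by case: ifP.
  have ik : i %% K < K by rewrite ltn_mod; case: (K) lt => //; rewrite muln0.
  have ij : i %/ K < n by rewrite ltn_divLR //; apply: leq_ltn_trans ik.
  rewrite -[X in _ <= X](lp_D_cap lt) mulnC.
  apply: (@leq_trans (\sum_(a < n | [&& nontrivial a, lev a <= i %% K & P (i %/ K) <= P a])
      P a * (lp_D %/ cap1 (i %/ K) (i %% K)))); last first.
    by rewrite -big_distrl /= leq_mul2r lev_capacity ?orbT.
  rewrite [X in _ <= X]big_mkcond /=; apply: leq_sum => a _.
  set rhs := if _ then _ else _.
  have [lK|Kl] := ltnP (lev a) K; last first.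
    rewrite big1 // => l _; rewrite /lev_cols divn_block // modn_block // ltn_ord.
    by rewrite [_ == lev a]ltn_eqF ?andbF //; apply: leq_trans Kl.
  rewrite (bigD1 (Ordinal lK)) //= big1 ?addn0 => [|l nl]; last first.
    rewrite /lev_cols divn_block // modn_block // ltn_ord.
    by rewrite -val_eqE /= in nl; rewrite (negPf nl) andbF.
  rewrite /lev_cols /lp_A lt divn_block // modn_block // ltn_ord eqxx andbT /rhs.
  case: (nontrivial a) => //=; case: (lev a <= _) => //=; case: (P _ <= _); rewrite ?andbF //.
  by case: eligible; rewrite ?mul1n ?mul0n.
rewrite big1 ?add0n => [|a _]; last first.
  by apply: big1 => l _; rewrite /lp_A (ltnNge i) ge divn_block //= leqNgt ltn_ord /= mul0n; case: ifP.
rewrite /lp_D; apply: leq_trans (leq_mul cost_le (leqnn _)); rewrite big_distrl /=.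
apply: leq_sum => S _; rewrite -sum_gap big_distrr big_distrl /=.
rewrite (big_ord_widen K (fun l => w S * gap l * cap_prod) (group_lev_le S)) [X in _ <= X]big_mkcond /=; apply: leq_sum => l _.
rewrite /lev_cols /lp_A (ltnNge i) ge divn_block // modn_block // ltnNge leq_addr addKn /=.
by case: ifP => //; case: affordable; rewrite ?mul1n ?mul0n.
Qed.

Lemma lev_cover q : q < mc -> lp_L0 q < N -> 0 < \sum_(e < nv | lev_cols e) lp_C q e.
Proof.
move=> ltq; rewrite /lp_L0; case: ifP => [/andP[iS nj] _|]; last by rewrite ltnn.
have K0 : 0 < K by case: (K) ltq => //; rewrite muln0.
have n0 : 0 < n by case: (n) ltq => //; rewrite muln0.
have kK : q %% K < K by rewrite ltn_mod.
have jn : (q %/ K) %% n < n by rewrite ltn_mod.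
have Sg : (q %/ K) %/ n < g by rewrite !ltn_divLR // mulnAC.
suff [e [lte Ee Ce]] : exists e, [/\ e < nv, lev_cols e & lp_C q e = 1].
  by rewrite (bigD1 (Ordinal lte)) //= Ce.
set k := q %% K in kK *; set j := (q %/ K) %% n in jn iS nj *.
set S := (q %/ K) %/ n in Sg iS *.
have [lk|kl] := leqP (lev j) k.
  exists (j * K + lev j); have lK := leq_ltn_trans lk kK; split.
  - by apply: block_lt => //; apply: ltn_addr.
  - by rewrite /lev_cols divn_block // modn_block // jn nj eqxx.
  - by rewrite /lp_C divn_block // modn_block // jn -/k -/j eqxx lk lev_eligible.
have kS : k < group_lev S.
  apply: leq_trans kl _; have iSnj : inc S (Ordinal jn) && nontrivial (Ordinal jn) by rewrite iS.
  exact: (@bigop.leq_bigmax_cond _ _ (fun i : 'I_n => lev i) (Ordinal jn)).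
exists ((n + S) * K + k); split.
- by apply: block_lt => //; rewrite ltn_add2l.
- by rewrite /lev_cols divn_block // modn_block // ltnNge leq_addr addKn.
- rewrite /lp_C divn_block // modn_block // ltnNge leq_addr addKn /= -/S -/k !eqxx /=.
  (* A gap before the level of the group costs no more than the whole solution, hence is within the
     budget. *)
  rewrite (_ : affordable S k) //; apply: leq_trans cost_le.
  rewrite /lev_cost (bigD1 (Ordinal Sg)) //=; apply: leq_trans (leq_addr _ _).
  by rewrite leq_mul2l; apply/orP; right; apply: leq_trans (leq_subr _ _) (th_le kS).
Qed.

End Comparator.

(** ** The fractional solution found by the multiplicative weights *)

(** A chosen column covers some row, and [lp_C] vanishes on columns that are not eligible or not
    affordable: the run needs no separate test for these conditions. *)
Lemma run_col h e : run mp mc nv N lp_D lp_A lp_C lp_L0 h -> e \in h ->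
  e < nv /\ exists2 q, q < mc & lp_C q e != 0.
Proof.
elim=> {h} // h e' _ IHh [lt cgt _]; rewrite inE => /orP[/eqP->|/IHh //].
split=> //; move: cgt; rewrite lt0n sum_nat_eq0 => /forallPn[q].
by rewrite muln_eq0 negb_or => /andP[Ce _]; exists q.
Qed.

Section Fractional.

Variable h : seq nat.
Hypothesis run_h : run mp mc nv N lp_D lp_A lp_C lp_L0 h.

(** The fractional solution in units of 1/N, read off as multiplicities of columns in the run: the
    part of job [j] finished by level [k]. *)
Definition frac (j k : nat) : nat := \sum_(l < k.+1) count_mem (j * K + l) h.
Definition unfinished (S k : nat) : nat := count_mem ((n + S) * K + k) h.

Lemma run_all : all (fun e => e < nv) h.
Proof. by apply/allP => e /(run_col run_h)[]. Qed.

Lemma count_eligible j l : j < n -> l < K -> 0 < count_mem (j * K + l) h -> eligible j l.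
Proof.
move=> jn lK; rewrite -has_count has_pred1 => /(run_col run_h)[_ [q _]].
by rewrite /lp_C divn_block // modn_block // jn; case: eligible => //; rewrite !andbF.
Qed.

Lemma count_affordable S l : l < K -> 0 < count_mem ((n + S) * K + l) h -> affordable S l.
Proof.
move=> lK; rewrite -has_count has_pred1 => /(run_col run_h)[_ [q _]].
rewrite /lp_C divn_block // modn_block // ltnNge leq_addr addKn /=.
by case: (S =P _) => // <-; case: (l =P _) => // <-; case: affordable.
Qed.

Lemma frac_eligible j k : j < n -> k < K -> 0 < frac j k -> eligible j k.
Proof.
move=> jn kK; rewrite lt0n sum_nat_eq0 => /forallPn[l]; rewrite /= -lt0n => cl.
have lk : l <= k by rewrite -ltnS.
have /andP[rl Pl] := count_eligible jn (leq_ltn_trans lk kK) cl.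
have thl := th_le lk; apply/andP; split; first exact: leq_trans thl.
by apply: leq_trans Pl _; rewrite leq_mul2l thl orbT.
Qed.

Hypothesis cov_h : forall q, q < mc -> coverage N lp_C lp_L0 h q = N.

Lemma frac_cover S j k : S < g -> j < n -> k < K -> inc S j -> nontrivial j ->
  N <= unfinished S k + frac j k.
Proof.
move=> Sg jn kK iS nj; have q_lt : (S * n + j) * K + k < mc.
  by apply: block_lt => //; apply: block_lt.
have := cov_h q_lt; rewrite /coverage /lp_L0 !divn_block // modn_block // iS nj add0n => cN.
have {cN} : N <= \sum_(e <- h) lp_C ((S * n + j) * K + k) e by rewrite -{1}cN geq_minr.
rewrite (sum_count_mem _ run_all) => /leq_trans; apply.
rewrite (sum_blocks _ _ (fun e => count_mem e h * lp_C ((S * n + j) * K + k) e)).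
rewrite big_split_ord /= [X in _ <= X]addnC; apply: leq_add; last first.
- rewrite (bigD1 (Ordinal Sg)) //= [X in _ + X]big1 ?addn0 => [|S' nS]; last first.
    apply: big1 => l _; rewrite /lp_C !divn_block // modn_block // ltnNge leq_addr addKn /=.
    by rewrite -val_eqE /= in nS; rewrite (negPf nS) muln0.
  rewrite (bigD1 (Ordinal kK)) //= [X in _ + X]big1 ?addn0 => [|l nl]; last first.
    rewrite /lp_C !divn_block // !modn_block // ltnNge leq_addr addKn /= eqxx.
    by rewrite -val_eqE /= in nl; rewrite (negPf nl) muln0.
  by rewrite -[X in _ <= X]muln1 leq_mul2l lp_C_le orbT.
- rewrite (bigD1 (Ordinal jn)) //= [X in _ + X]big1 ?addn0 => [|a na]; last first.
    apply: big1 => l _; rewrite /lp_C !divn_block // !modn_block // ltn_ord.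
    by rewrite -val_eqE /= in na; rewrite (negPf na) muln0.
  rewrite /frac (big_ord_widen K (fun l => count_mem (j * K + l) h) kK) [X in _ <= X]big_mkcond /=.
  apply: leq_sum => l _; rewrite /lp_C !divn_block // !modn_block // jn eqxx /= ltnS.
  by case: (l <= k); rewrite /= ?muln0 // -[X in _ <= X]muln1 leq_mul2l leq_b1 orbT.
Qed.

Variable Lmax : nat.
Hypothesis load_h : forall i, i < mp -> \sum_(e <- h) lp_A i e <= Lmax * lp_D.

Lemma frac_pack j k : j < n -> k < K ->
  \sum_(a < n | P j <= P a) P a * frac a k <= Lmax * cap1 j k.
Proof.
move=> jn kK; have lt : j * K + k < n * K by apply: block_lt.
rewrite -(leq_pmul2r lp_D_gt0) mulnAC.
have := load_h (leqW lt); set i := j * K + k => ld.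
have iE : (i %/ K = j) * (i %% K = k) by rewrite divn_block // modn_block.
apply: leq_trans (leq_mul ld (leqnn (cap1 j k))).
rewrite -[X in _ * X <= _](lp_D_cap lt) -/i !iE mulnA leq_mul2r; apply/orP; right.
rewrite (sum_count_mem _ run_all).
rewrite (sum_blocks _ _ (fun e => count_mem e h * lp_A i e)) big_split_ord /=.
apply: leq_trans (leq_addr _ _); rewrite big_distrl /= big_mkcond /=; apply: leq_sum => a _.
case: ifP => // Pja; rewrite /frac big_distrr big_distrl /=.
rewrite (big_ord_widen K (fun l => P a * count_mem (a * K + l) h * (lp_D %/ cap1 j k)) kK).
rewrite big_mkcond /=; apply: leq_sum => l _; case: ifP => //; rewrite ltnS => lk.
have [->|c0] := posnP (count_mem (a * K + l) h); first by rewrite muln0.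
rewrite /lp_A lt divn_block // modn_block // !iE ltn_ord lk Pja count_eligible //.
by rewrite mul1n mulnCA !mulnA.
Qed.

Lemma frac_cost : \sum_(S < g) \sum_(k < K) w S * gap k * unfinished S k <= Lmax * Bd.
Proof.
have := load_h (ltnSn (n * K)); rewrite (sum_count_mem _ run_all).
rewrite (sum_blocks _ _ (fun e => count_mem e h * lp_A (n * K) e)) big_split_ord /=.
move=> ld; rewrite -(leq_pmul2r cap_prod_gt0) -mulnA -/lp_D.
apply: leq_trans (leq_trans (leq_addl _ _) ld).
rewrite big_distrl /=; apply: leq_sum => S _; rewrite big_distrl /=; apply: leq_sum => k _.
rewrite /unfinished; have [->|c0] := posnP (count_mem ((n + S) * K + k) h); first by rewrite muln0.
rewrite /lp_A ltnn divn_block // modn_block // leq_addr addKn count_affordable // mul1n.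
by rewrite mulnAC mulnC mulnCA.
Qed.

End Fractional.

End LinearProgram.

(** * Greedy scheduling of a sequence of blocks *)

Notation an := 0. Notation am := 11. Notation ag := 12. Notation aP := 22.
Notation aR := 23. Notation aS := 24. Notation aW := 25. Notation aTH := 27.
Notation aRANK := 29. Notation aBLK := 47. Notation aLOAD := 48. Notation aMACH := 49.
Notation aSTART := 50. Notation aCOMP := 51. Notation aT := 52. Notation aBASE := 53.
Notation aBT := 54. Notation aBS := 55. Notation aBI := 56. Notation aST := 57.
Notation aCT := 58. Notation vB := 59. Notation vX := 60. Notation vJ := 61.
Notation aNBLK := 62. Notation aCM := 63. Notation aCOST := 64. Notation vG := 65.
Notation aINC := 66. Notation aBEST := 67. Notation aHAS := 68. Notation aBM := 69.
Notation aBST := 70.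

Definition try_machine : hcmd :=
  (aST ::= aLOAD $ (#vI) || (#aBASE || aR $ (#vJ)) ;;
   aCT ::= #aST + aP $ (#vJ) %/ aS $ (#vI) ;;
   If_ ((#vI == K 0) || (#aCT < #aBT))%H
     (aBT ::= #aCT ;; aBS ::= #aST ;; aBI ::= #vI) Nop)%C.

Definition assign_job : hcmd :=
  (For vI (#am) try_machine ;;
   Set_ aMACH (#vJ) (#aBI) ;; Set_ aSTART (#vJ) (#aBS) ;; Set_ aCOMP (#vJ) (#aBT) ;;
   Set_ aLOAD (#aBI) (#aBT) ;; aT ::= #aT || #aBT)%C.

Definition place_job : hcmd :=
  If_ ((aBLK $ (#vJ) == #vB) && (aRANK $ (#vJ) == #vX))%H assign_job Nop.

Definition place (reset : bool) : hcmd :=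
  (aT ::= K 0 ;; fill vI aLOAD (#am) (K 0) ;;
   For vB (#aNBLK)
     (aBASE ::= (if reset then #aT || aTH $ (#vB) else aTH $ (#vB)) ;;
      For vX (#an) (For vJ (#an) place_job)))%C.

Definition put (f : nat -> nat) (i v : nat) : nat -> nat := fun k => if k == i then v else f k.

Section Greedy.

Variables (reset : bool) (n m : nat) (P r sp th blk rank : nat -> nat).

Definition new_base (b T : nat) : nat := if reset then maxn T (th b) else th b.
Definition begin (ld : nat -> nat) (bs j i : nat) : nat := maxn (ld i) (maxn bs (r j)).
Definition finish (ld : nat -> nat) (bs j i : nat) : nat := begin ld bs j i + P j %/ sp i.
Definition ikey (j : nat) : nat := rank j * n + j.

(** States of the greedy rule when block [b] has been handled up to key [t]: loads, machines,
    starts, completions, latest completion [T], base [bs] of the block. A relation leaves ties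
    between machines open and separates the scheduling arguments from the program. *)
Inductive reach : nat -> nat -> (nat -> nat) -> (nat -> nat) -> (nat -> nat) ->
    (nat -> nat) -> nat -> nat -> Prop :=
| reach_init ld mc st cp : (forall i, i < m -> ld i = 0) ->
    reach 0 0 ld mc st cp 0 (new_base 0 0)
| reach_block b ld mc st cp T bs : reach b (n * n) ld mc st cp T bs ->
    reach b.+1 0 ld mc st cp T (new_base b.+1 T)
| reach_skip b t ld mc st cp T bs : reach b t ld mc st cp T bs ->
    (forall a, a < n -> ~~ ((blk a == b) && (ikey a == t))) ->
    reach b t.+1 ld mc st cp T bs
| reach_step b ld mc st cp T bs j i : reach b (ikey j) ld mc st cp T bs ->
    j < n -> blk j = b -> i < m ->
    (forall i', i' < m -> finish ld bs j i <= finish ld bs j i') ->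
    reach b (ikey j).+1 (put ld i (finish ld bs j i)) (put mc j i)
      (put st j (begin ld bs j i)) (put cp j (finish ld bs j i))
      (maxn T (finish ld bs j i)) bs.

Hypothesis m_gt0 : forall j, j < n -> 0 < m.
Hypothesis rank_lt : forall j, j < n -> rank j < n.

Definition done (b t a : nat) : bool := (blk a < b) || ((blk a == b) && (ikey a < t)).

Lemma ikey_inj a j : a < n -> j < n -> ikey a = ikey j -> a = j.
Proof. by move=> an jn e; rewrite -(modn_block (rank a) an) -(modn_block (rank j) jn); congr (_ %% _). Qed.

Lemma doneS b t a : done b t.+1 a = done b t a || ((blk a == b) && (ikey a == t)).
Proof. by rewrite /done ltnS [ikey a <= t]leq_eqVlt andb_orr orbA orbAC. Qed.

Lemma ikey_lt a : a < n -> ikey a < n * n.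
Proof. by move=> an; apply: block_lt => //; apply: rank_lt. Qed.

Lemma done_block b a : a < n -> done b.+1 0 a = done b (n * n) a.
Proof.
by move=> an; rewrite /done ltnS [blk a <= b]leq_eqVlt ikey_lt // andbT ltn0 andbF orbF orbC.
Qed.

Lemma done0 a : done 0 0 a = false.
Proof. by rewrite /done ltn0 andbF. Qed.

(** ** Feasibility and a bound on all times *)

Variable H : nat.
Hypotheses (th_H : forall b, th b <= H) (r_H : forall j, j < n -> r j <= H).

(** Jobs are only appended to a machine, whence feasibility. The bound by [H] plus the work already
    placed holds since each new job starts at the latest at the larger of [T], the base and its
    release date; it keeps all times below the clamping modulus. *)
Lemma reach_feasible b t ld mc st cp T bs : reach b t ld mc st cp T bs ->
  [/\ forall a, a < n -> done b t a ->
        [/\ r a <= st a, cp a = st a + P a %/ sp (mc a), mc a < m & cp a <= ld (mc a)],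
      forall a a', a < n -> a' < n -> a != a' -> done b t a -> done b t a' ->
        mc a = mc a' -> cp a <= st a' \/ cp a' <= st a,
      forall i, i < m -> ld i <= T,
      T <= H + \sum_(a < n | done b t a) P a &
      bs <= H + \sum_(a < n | done b t a) P a].
Proof.
elim=> {b t ld mc st cp T bs}
  [ld mc st cp ld0|b ld mc st cp T bs _ [i1 i2 i3 i4 i5]
  |b t ld mc st cp T bs _ [i1 i2 i3 i4 i5] nokey
  |b ld mc st cp T bs j i rc [i1 i2 i3 i4 i5] jn bj im mini].
- split=> [a _|a a' _ _ _|i /ld0->||] //; rewrite ?done0 //.
  by apply: leq_trans (leq_addr _ _); rewrite /new_base; case: reset; rewrite ?max0n.
- have dE : \sum_(a < n | done b.+1 0 a) P a = \sum_(a < n | done b (n * n) a) P a.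
    by apply: eq_bigl => a; rewrite done_block.
  split=> // [a an|a a' an an'||]; rewrite ?done_block // ?dE //; [exact: i1|exact: i2|].
  rewrite /new_base; case: reset; last by apply: leq_trans (leq_addr _ _).
  by rewrite geq_max i4; apply: leq_trans (leq_addr _ _).
- have dE a : a < n -> done b t.+1 a = done b t a.
    by move=> an; rewrite doneS (negPf (nokey a an)) orbF.
  have sE : \sum_(a < n | done b t.+1 a) P a = \sum_(a < n | done b t a) P a.
    by apply: eq_bigl => a; rewrite dE.
  by split=> // [a an|a a' an an'||]; rewrite ?dE // ?sE //; [exact: i1|exact: i2].
- have dE a : a < n -> done b (ikey j).+1 a = (a == j) || done b (ikey j) a.
    move=> an; rewrite doneS orbC; congr (_ || _).
    apply/andP/eqP => [[_ /eqP e]|->]; first exact: ikey_inj.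
    by rewrite bj !eqxx.
  have ndj : ~~ done b (ikey j) j by rewrite /done bj !ltnn andbF.
  have neq a : done b (ikey j) a -> a == j = false.
    by move=> da; apply/eqP => aj; rewrite aj (negPf ndj) in da.
  set c := finish ld bs j i; set t0 := begin ld bs j i.
  have ldc : ld i <= t0 by rewrite /t0 /begin leq_maxl.
  have t0c : t0 <= c by rewrite leq_addr.
  have cb : c <= H + \sum_(a < n | done b (ikey j) a) P a + P j.
    rewrite leq_add ?leq_div // !geq_max i5 (leq_trans (i3 i im) i4) /=.
    by apply: leq_trans (leq_addr _ _); apply: r_H.
  have sE : \sum_(a < n | done b (ikey j).+1 a) P a = P j + \sum_(a < n | done b (ikey j) a) P a.
    rewrite (bigD1 (Ordinal jn)) /= ?dE ?eqxx //; congr (_ + _).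
    apply: eq_bigl => a; rewrite dE // -val_eqE /=; case: eqP => [e|_] /=.
      by rewrite e (negPf ndj).
    by rewrite andbT.
  split.
  + move=> a an; rewrite dE // /put => /orP[/eqP->|da].
      rewrite !eqxx; split=> //; by rewrite /t0 /begin !leq_max leqnn !orbT.
    have [h1 h2 h3 h4] := i1 a an da; rewrite neq //; split=> //.
    by case: eqP => [e|_] //; apply: leq_trans h4 _; rewrite e; apply: leq_trans t0c.
  + have later a : a < n -> done b (ikey j) a -> mc a = i -> cp a <= t0.
      by move=> an da e; have [_ _ _ h4] := i1 a an da; apply: leq_trans h4 _; rewrite e.
    move=> a a' an an' aa'; rewrite !dE // /put => /orP[/eqP ea|da] /orP[/eqP ea'|da'].
    * by rewrite ea ea' eqxx in aa'.
    * by rewrite ea eqxx neq // => e; right; apply: later.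
    * by rewrite ea' eqxx neq // => e; left; apply: later.
    * by rewrite !neq //; apply: i2.
  + move=> i' im'; rewrite /put; case: eqP => _; first by rewrite leq_maxr.
    by apply: leq_trans (i3 _ im') _; rewrite leq_maxl.
  + by rewrite sE geq_max addnCA addnC cb andbT; apply: leq_trans i4 (leq_addr _ _).
  + by rewrite sE addnCA addnC; apply: leq_trans i5 (leq_addr _ _).
Qed.

Lemma finish_le b ld mc st cp T bs j i : reach b (ikey j) ld mc st cp T bs ->
  j < n -> blk j = b -> i < m -> finish ld bs j i <= H + \sum_(a < n) P a.
Proof.
move=> rc jn bj im; have [_ _ i3 i4 i5] := reach_feasible rc.
apply: (@leq_trans (H + (P j + \sum_(a < n | done b (ikey j) a) P a))); last first.
  rewrite leq_add2l [X in _ <= X](bigID (fun a : 'I_n => done b (ikey j) a)) /= addnC leq_add2l.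
  by rewrite (bigD1 (Ordinal jn)) ?leq_addr //= /done bj !ltnn andbF.
rewrite addnCA addnC leq_add ?leq_div // !geq_max i5 (leq_trans (i3 i im) i4) /=.
by apply: leq_trans (leq_addr _ _); apply: r_H.
Qed.

End Greedy.

(** * The greedy rule as a program *)

Section PlaceProgram.

Variables (Y Z : nat) (reset : bool) (n m nb H : nat) (P r sp th blk rank : nat -> nat).
Local Notation den := (den Y Z).
Local Notation begin := (begin r).
Local Notation finish := (finish P r sp).
Local Notation ikey := (ikey n rank).
Local Notation reach := (reach reset n m P r sp th blk rank).

Hypotheses (nY : n <= Y) (mY : m <= Y) (nbY : nb <= Y) (YZ : Y < Z).
Hypothesis m_gt0 : forall j, j < n -> 0 < m.
Hypothesis rank_lt : forall j, j < n -> rank j < n.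
Hypotheses (th_H : forall b, th b <= H) (r_H : forall j, j < n -> r j <= H).
Hypothesis HZ : H + \sum_(a < n) P a < Z.

Definition place_ctx (s : store) : Prop :=
  [/\ s an 0 = n, s am 0 = m, s aNBLK 0 = nb, forall b, b < nb -> s aTH b = th b &
   [/\ forall j, j < n -> s aP j = P j, forall j, j < n -> s aR j = r j,
    forall j, j < n -> s aRANK j = rank j, forall j, j < n -> s aBLK j = blk j &
    forall i, i < m -> s aS i = sp i]].

Lemma place_ctx_eq s s' :
  {in [:: an; am; aNBLK; aTH; aP; aR; aRANK; aBLK; aS], forall a, s' a = s a} ->
  place_ctx s -> place_ctx s'.
Proof. by move=> fr; rewrite /place_ctx !fr. Qed.

Definition reached (b t : nat) (s : store) : Prop :=
  reach b t (s aLOAD) (s aMACH) (s aSTART) (s aCOMP) (s aT 0) (s aBASE 0).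

Lemma assign_correct b j s : place_ctx s -> s vJ 0 = j -> j < n -> blk j = b ->
  reached b (ikey j) s -> reached b (ikey j).+1 (den assign_job s).
Proof.
move=> cx vj jn bj rc; have [_ mE _ _ [PE RE _ _ SE]] := cx.
have fin_Z i : i < m -> finish (s aLOAD) (s aBASE 0) j i < Z.
  by move=> im; apply: leq_ltn_trans HZ; apply: finish_le rc _ _ _.
rewrite /assign_job den_seq; set s1 := den _ s.
pose I k (s' : store) := k = 0 \/ [/\ s' aBI 0 < k,
  s' aBS 0 = begin (s aLOAD) (s aBASE 0) j (s' aBI 0),
  s' aBT 0 = finish (s aLOAD) (s aBASE 0) j (s' aBI 0) &
  forall i, i < k -> s' aBT 0 <= finish (s aLOAD) (s aBASE 0) j i].
have I1 : I m s1.
  have := @for_rule Y Z I vI (#am)%H try_machine s; rewrite /= mE; apply => //.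
    by left.
  move=> i s' lt vi fr Ii; rewrite /try_machine den_seq den_set; set s2 := upd s' _ _ _.
  have stE : s2 aST 0 = begin (s aLOAD) (s aBASE 0) j i.
    by rewrite /s2 upd_cell /= vi !fr // vj RE // clamp_safe.
  have fr2 a : a != aST -> s2 a = s' a by move=> ha; rewrite /s2 upd_other.
  rewrite den_seq den_set; set s3 := upd s2 _ _ _.
  have ctE : s3 aCT 0 = finish (s aLOAD) (s aBASE 0) j i.
    rewrite /s3 upd_cell /= stE !fr2 // vi !fr // vj PE // SE // clamp_id //.
    exact: fin_Z.
  have fr3 a : a != aCT -> a != aST -> s3 a = s' a.
    by move=> h1 h2; rewrite /s3 upd_other // fr2.
  have st3 : s3 aST 0 = s2 aST 0 by [].
  rewrite den_if /= ctE !fr3 // vi !boolE.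
  case: ifP => c.
    right; rewrite !den_seq !den_set /= !clamp_safe //= /upd /= ctE st3 stE fr3 // vi; split=> //.
    move=> i'; rewrite ltnS leq_eqVlt => /orP[/eqP->//|lt'].
    case: Ii => [i0|[_ _ bt H']]; first by rewrite i0 in lt'.
    apply: leq_trans (H' _ lt'); case/orP: c => [/eqP i0|]; first by rewrite i0 in lt'.
    exact: ltnW.
  rewrite den_nop; case: Ii => [i0|[h1 h2 h3 h4]]; first by rewrite i0 in c.
  right; rewrite !upd_other // !fr3 //; split=> //; first exact: ltnW.
  move=> i'; rewrite ltnS leq_eqVlt => /orP[/eqP->|/h4 //].
  by move: c => /norP[_]; rewrite -leqNgt.
have fr1 a : a \notin assigned (For vI (#am)%H try_machine) -> s1 a = s a by apply: den_frame.
case: I1 => [m0|[bi bs bt mini]]; first by have := m_gt0 jn; rewrite m0.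
rewrite bt in mini.
have := reach_step rc jn bj bi mini; rewrite /reached.
have -> : den (Set_ aMACH (#vJ) (#aBI) ;; Set_ aSTART (#vJ) (#aBS) ;; Set_ aCOMP (#vJ) (#aBT) ;;
   Set_ aLOAD (#aBI) (#aBT) ;; aT ::= #aT || #aBT)%C s1 =
  upd (upd (upd (upd (upd s1 aMACH j (s1 aBI 0)) aSTART j (s1 aBS 0)) aCOMP j (s1 aBT 0))
    aLOAD (s1 aBI 0) (s1 aBT 0)) aT 0 (maxn (s aT 0) (s1 aBT 0)).
  rewrite !den_seq !den_set !clamp_safe //= !upd_other // fr1 // vj.
  by rewrite (fr1 aT).
rewrite -bs -bt -(fr1 aLOAD) // -(fr1 aMACH) // -(fr1 aSTART) // -(fr1 aCOMP) //.
by rewrite -(fr1 aBASE) // -(fr1 aT).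
Qed.

Lemma place_correct s : 0 < nb -> place_ctx s -> reached nb.-1 (n * n) (den (place reset) s).
Proof.
move=> nb0 cx; rewrite /place den_seq den_set; set s0 := upd s _ _ _; rewrite den_seq.
set c1 := fill _ _ _ _; set s1 := den c1 s0.
have fr1 a : a \notin assigned c1 -> s1 a = s0 a by apply: den_frame.
have cx1 : place_ctx s1.
  apply: place_ctx_eq cx => a; rewrite !inE.
  by move=> /or4P[|||/or4P[|||/orP[|/orP[]]]] /eqP->; rewrite fr1.
have ld1 i : i < m -> s1 aLOAD i = 0.
  case: cx => _ mE _ _ _ im.
  rewrite /s1 /c1 (@fill_spec Y Z _ _ _ _ _ m (fun _ => 0)) //.
  by move=> *; apply: leq_ltn_trans YZ.
pose J b (s' : store) := if b is b'.+1 then reached b' (n * n) s' else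
  (forall i, i < m -> s' aLOAD i = 0) /\ s' aT 0 = 0.
have nbE : s1 aNBLK 0 = nb by case: cx1.
pose body := (aBASE ::= (if reset then #aT || aTH $ (#vB) else aTH $ (#vB)) ;;
      For vX (#an) (For vJ (#an) place_job))%C.
suff : J nb (den (For vB (#aNBLK)%H body) s1) by rewrite /J; case: (nb) nb0.
have := @for_rule Y Z J vB (#aNBLK)%H body s1; rewrite /= nbE; apply => //.
  by split; [exact: ld1 | rewrite -[LHS]/(s1 aT 0) fr1 // /s0 upd_cell clamp_safe].
move=> b s' lt vb fr Jb.
have cx' : place_ctx s'.
  apply: place_ctx_eq cx1 => a; rewrite !inE.
  by move=> /or4P[|||/or4P[|||/orP[|/orP[]]]] /eqP->; apply: fr.
rewrite /body den_seq den_set; set s2 := upd s' _ _ _.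
have base2 : s2 aBASE 0 = new_base reset th b (s' aT 0).
  rewrite /s2 upd_cell /new_base; have [_ _ _ thE _] := cx'.
  by case: (reset); rewrite clamp_safe //= vb thE.
have R0 : reached b 0 s2.
  rewrite /reached base2 -[s2 aLOAD]/(s' aLOAD) -[s2 aMACH]/(s' aMACH) -[s2 aSTART]/(s' aSTART).
  rewrite -[s2 aCOMP]/(s' aCOMP) -[s2 aT]/(s' aT).
  case: b lt vb Jb base2 => [|b] lt vb Jb base2; last exact: (reach_block Jb).
  by case: Jb => ld0 ->; apply: reach_init.
have cx2 : place_ctx s2 by apply: place_ctx_eq cx' => a; rewrite !inE => /or4P[|||/or4P[|||/orP[|/orP[]]]] /eqP->.
suff : reached b (n * n) (den (For vX (#an)%H (For vJ (#an)%H place_job)) s2) by [].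
have nE2 : s2 an 0 = n by case: cx2.
pose JX x (s' : store) := reached b (x * n) s'.
have := @for_rule Y Z JX vX (#an)%H (For vJ (#an)%H place_job) s2; rewrite /= nE2; apply => //.
move=> x s3 ltx vx fr3 Jx.
have cx3 : place_ctx s3.
  apply: place_ctx_eq cx2 => a; rewrite !inE.
  by move=> /or4P[|||/or4P[|||/orP[|/orP[]]]] /eqP->; apply: fr3.
have nE3 : s3 an 0 = n by case: cx3.
pose JJ j (s' : store) := reached b (x * n + j) s'.
suff : JJ n (den (For vJ (#an)%H place_job) s3) by rewrite /JJ /JX -mulSnr.
have := @for_rule Y Z JJ vJ (#an)%H place_job s3; rewrite /= nE3; apply => //.
  by rewrite /JJ addn0.
move=> j s4 ltj vj fr4 Jj.
have cx4 : place_ctx s4.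
  apply: place_ctx_eq cx3 => a; rewrite !inE.
  by move=> /or4P[|||/or4P[|||/orP[|/orP[]]]] /eqP->; apply: fr4.
have [_ _ _ _ [_ _ RE BE _]] := cx4.
rewrite /place_job den_if /= vj RE // BE // (fr4 vB) // (fr3 vB) // (fr4 vX) // vx.
rewrite -[s2 vB 0]/(s' vB 0) vb !boolE /JJ addnS.
case: ifP => [/andP[/eqP bj /eqP rj]|nk].
  have tE : x * n + j = ikey j by rewrite /ikey rj.
  have := assign_correct cx4 vj ltj bj; rewrite -tE => /(_ Jj).
  by [].
suff : reached b (x * n + j).+1 s4 by [].
apply: reach_skip => // a an'; apply/negP => /andP[/eqP ba /eqP ka].
have aj : a = j.
  by rewrite -(modn_block (rank a) an') -(modn_block x ltj) -ka.
have ra : rank a = x.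
  by rewrite -(divn_block (rank a) an') -(divn_block x ltj) -ka.
by move: nk; rewrite -aj ba ra !eqxx.
Qed.

End PlaceProgram.

(** ** Completion times of the greedy schedule *)

Lemma sum_put m (f : nat -> nat) q x : q < m ->
  \sum_(i < m) put f q (f q + x) i = \sum_(i < m) f i + x.
Proof.
move=> qm; rewrite (bigD1 (Ordinal qm)) //= {1}/put eqxx [in RHS](bigD1 (Ordinal qm)) //=.
rewrite addnAC; congr (_ + _ + _); apply: eq_bigr => i; rewrite -val_eqE /= /put.
by move=> /negPf->.
Qed.

Section Quality.

Variables (n m : nat) (P r sp th blk rank : nat -> nat) (i : nat).
Local Notation finish_on := (finish P r sp).
Local Notation key_of := (ikey n rank).
Local Notation done_by := (done n blk rank).

Hypotheses (i_gt0 : 0 < i) (i_le : i <= 40).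
Hypothesis sp_gt0 : forall q, q < m -> 0 < sp q.
Hypothesis sp_dvd : forall j q, j < n -> q < m -> sp q %| P j.
Hypothesis rank_lt : forall j, j < n -> rank j < n.
Hypothesis th0 : th 0 = 0.
Hypothesis th_mono : forall k, th k <= th k.+1.
Hypothesis zero_block : forall j, j < n -> blk j = 0 -> P j = 0 /\ r j = 0.

(** If all machines in [E] were busy beyond [ref + 42 * tb / i], the work done on them after [ref]
    would exceed the total of [wk]. So one of them is free by then, and it processes [j] within
    [tb]. *)
Lemma greedy_step (E : pred nat) ref tb (ld wk : nat -> nat) bs j :
  (exists2 q, q < m & E q) -> (forall q, q < m -> E q -> P j <= sp q * tb) ->
  i * \sum_(q < m) wk q <= 42 * tb * \sum_(q < m) E q * sp q ->
  bs <= ref -> r j <= ref -> (forall q, q < m -> ld q * sp q <= ref * sp q + wk q) ->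
  exists2 q, q < m & i * finish_on ld bs j q <= i * ref + (i + 42) * tb.
Proof.
move=> [q0 q0m Eq0] PE Ewk bsr rjr ldw.
suff [q qm [Eq lq]] : exists2 q, q < m & E q /\ i * ld q <= i * ref + 42 * tb.
  exists q => //; rewrite /finish /begin mulnDr maxnA.
  have dP : P j %/ sp q <= tb.
    by rewrite -(mulKn tb (sp_gt0 qm)) leq_div2r //; apply: PE.
  have : i * maxn (maxn (ld q) bs) (r j) <= i * ref + 42 * tb.
    by rewrite !maxnMr !geq_max lq /=; apply/andP; split; nia.
  have : i * (P j %/ sp q) <= i * tb by rewrite leq_mul2l dP orbT.
  by lia.
have [/existsP[q /andP[Eq lq]]|/existsPn none] :=
  boolP [exists q : 'I_m, E q && (i * ld q <= i * ref + 42 * tb)].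
  by exists q.
exfalso; pose SE := \sum_(q < m) E q * sp q.
have SE0 : 0 < SE.
  by rewrite /SE (bigD1 (Ordinal q0m)) //= Eq0 mul1n ltn_addr // sp_gt0.
have h1 : \sum_(q < m) E q * sp q * (i * ref + 42 * tb).+1 <= \sum_(q < m) E q * (i * (ld q * sp q)).
  apply: leq_sum => q _; have := none q.
  case: (E q) => //=; rewrite !mul1n -ltnNge => lt.
  by rewrite mulnA [X in X <= _]mulnC leq_mul2r lt orbT.
have h2 : \sum_(q < m) E q * (i * (ld q * sp q)) <= i * ref * SE + i * \sum_(q < m) wk q.
  rewrite /SE !big_distrr -big_split /=; apply: leq_sum => q _.
  case: (E q) => //=; rewrite !mul1n -mulnA -mulnDr leq_mul2l ldw ?orbT //.
have absurd x y z t : 0 < x -> z <= y * x -> x * (t + y).+1 <= t * x + z -> False by nia.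
by apply: absurd SE0 Ewk _; rewrite big_distrl /=; apply: leq_trans h1 h2.
Qed.

(** As speeds divide lengths, a job adds exactly its length to the ledger [wk] of work done after
    [ref]. *)
Lemma dvd_finish ld bs j q ref wk : j < n -> q < m -> bs <= ref -> r j <= ref ->
  ld q * sp q <= ref * sp q + wk ->
  finish_on ld bs j q * sp q <= ref * sp q + (wk + P j).
Proof.
move=> jn qm bsr rjr ldw; rewrite /finish mulnDl divnK ?sp_dvd // addnA leq_add2r.
rewrite /begin !maxnMl !geq_max ldw /=.
have h x : x <= ref -> x * sp q <= ref * sp q + wk.
  by move=> le; apply: leq_trans (leq_addr _ _); rewrite leq_mul2r le orbT.
by rewrite !h.
Qed.

Lemma th_leq k l : k <= l -> th k <= th l.
Proof. by move=> kl; exact: (th_le th_mono kl). Qed.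

Lemma sum_doneS (D D' : pred nat) j : j < n -> ~~ D j ->
  (forall a, a < n -> D' a = (a == j) || D a) ->
  \sum_(a < n | D' a) P a = \sum_(a < n | D a) P a + P j.
Proof.
move=> jn Dj DD'; rewrite (bigD1 (Ordinal jn)) /= ?DD' ?eqxx // addnC; congr (_ + _).
apply: eq_bigl => a; rewrite DD' // -val_eqE /=; case: eqP => [->|_]; rewrite ?andbT //=.
by rewrite (negPf Dj).
Qed.

Lemma doneE b a j : a < n -> j < n -> blk j = b ->
  done_by b (key_of j).+1 a = (a == j) || done_by b (key_of j) a.
Proof.
move=> an jn bj; rewrite doneS orbC; congr (_ || _).
by apply/andP/eqP => [[_ /eqP e]|->]; [apply: ikey_inj e | rewrite bj !eqxx].
Qed.

(** *** Identical speeds, no waiting for the previous blocks *)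

Section NoReset.

Hypothesis same_speed : forall q q', q < m -> q' < m -> sp q = sp q'.
Hypothesis block_ok : forall j, j < n -> 0 < blk j ->
  [/\ r j <= th (blk j), exists2 q, q < m & P j <= sp q * th (blk j) &
   i * \sum_(a < n | blk a <= blk j) P a <= 42 * th (blk j) * \sum_(q < m) sp q].

(** Without waiting, the loads of earlier blocks persist, so the ledger [wk] sums all jobs placed so
    far and [block_ok] has to count all blocks up to the current one. The base contributes once the
    grid time, [greedy_step] the remaining 1 + 42/i; with equal speeds every machine is admissible
    for it. *)
Lemma no_reset_quality b t ld mc st cp T bs :
  reach false n m P r sp th blk rank b t ld mc st cp T bs ->
  forall a, a < n -> done_by b t a -> i * cp a <= (i + (i + 42)) * th (blk a).
Proof.
move=> rc; suff [] : [/\ bs = th b,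
    exists2 wk, forall q, q < m -> ld q * sp q <= th b * sp q + wk q &
      \sum_(q < m) wk q = \sum_(a < n | done_by b t a) P a &
    forall a, a < n -> done_by b t a -> i * cp a <= (i + (i + 42)) * th (blk a)] by [].
elim: rc => {b t ld mc st cp T bs}
  [ld mc st cp ld0|b ld mc st cp T bs _ [bsE [wk w1 w2] c1]
  |b t ld mc st cp T bs _ [bsE [wk w1 w2] c1] nokey
  |b ld mc st cp T bs j q _ [bsE [wk w1 w2] c1] jn bj qm mini].
- split=> //; last by move=> a an; rewrite done0.
  exists (fun _ => 0) => [q qm|]; first by rewrite ld0.
  by rewrite big1 //; apply/esym/big_pred0 => a; apply: done0.
- split=> //.
    exists wk => [q qm|].
      by apply: leq_trans (w1 q qm) _; rewrite leq_add2r leq_mul2r th_mono orbT.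
    by rewrite w2; apply: eq_bigl => a; rewrite (done_block _ rank_lt).
  by move=> a an; rewrite (done_block _ rank_lt) //; apply: c1.
- have dE a : a < n -> done_by b t.+1 a = done_by b t a.
    by move=> an; rewrite doneS (negPf (nokey a an)) orbF.
  split=> // [|a an]; last by rewrite dE //; apply: c1.
  by exists wk => //; rewrite w2; apply: eq_bigl => a; rewrite dE.
- have ndj : ~~ done_by b (key_of j) j by rewrite /done bj !ltnn andbF.
  have sE := sum_doneS jn ndj (fun a an => doneE an jn bj).
  have rj : r j <= th b.
    have [b0|b0] := posnP b; last by case: (block_ok jn); rewrite bj.
    by rewrite b0 in bj; have [_ ->] := zero_block jn bj.
  have bsb : bs <= th b by rewrite bsE.
  have fin : i * finish_on ld bs j q <= (i + (i + 42)) * th b.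
    have [b0|b0] := posnP b.
      rewrite b0 in bj; have [Pj rj0] := zero_block jn bj.
      rewrite b0 th0 in w1 bsE.
      have wk0 : \sum_(q < m) wk q = 0.
        rewrite w2 big1 // => a; rewrite /done b0 ltn0 /= => /andP[/eqP ba _].
        by case: (zero_block (ltn_ord a) ba).
      rewrite b0 th0 muln0 leqn0 muln_eq0; apply/orP; right.
      have := w1 q qm; rewrite mul0n add0n.
      have /eqP := wk0; rewrite sum_nat_eq0 => /forallP/(_ (Ordinal qm))/= /eqP->.
      rewrite leqn0 muln_eq0 eqn0Ngt [sp q == 0]eqn0Ngt sp_gt0 // orbF -eqn0Ngt => /eqP ld0.
      by rewrite /finish /begin ld0 bsE rj0 Pj div0n.
    have [_ [q0 q0m Pq0] ld_ok] := block_ok jn ltac:(by rewrite bj); rewrite bj in Pq0 ld_ok.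
    have g1 : exists2 q, q < m & xpredT q by exists q0.
    have g2 q' : q' < m -> xpredT q' -> P j <= sp q' * th b.
      by move=> q'm _; rewrite (same_speed q'm q0m).
    have g3 : i * \sum_(q < m) wk q <= 42 * th b * \sum_(q < m) xpredT q * sp q.
      under [X in _ <= _ * X]eq_bigr do rewrite mul1n.
      apply: leq_trans ld_ok; rewrite leq_mul2l; apply/orP; right; rewrite w2.
      rewrite big_mkcond [X in _ <= X]big_mkcond /=; apply: leq_sum => a _.
      rewrite /done; case: ifP => // d; rewrite ifT //.
      by case/orP: d => [/ltnW//|/andP[/eqP->]].
    have [q' q'm lq'] := greedy_step g1 g2 g3 bsb rj w1.
    apply: leq_trans (leq_mul (leqnn i) (mini _ q'm)) _; apply: leq_trans lq' _.
    by rewrite -mulnDl.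
  split=> //.
    exists (put wk q (wk q + P j)) => [q' q'm|]; last by rewrite sum_put // w2 sE.
    rewrite /put; case: eqP => [->|_]; last exact: w1.
    by apply: dvd_finish => //; apply: w1.
  move=> a an; rewrite doneE // /put => /orP[/eqP->|da].
    by rewrite eqxx bj.
  by case: eqP => [e|_]; [rewrite e (negPf ndj) in da | apply: c1].
Qed.

End NoReset.

(** *** Arbitrary speeds *)

Section Reset.

Hypothesis rank_order : forall j a, j < n -> a < n -> P a < P j -> rank j < rank a.
Hypothesis block_ok : forall j, j < n -> 0 < blk j ->
  [/\ r j <= th (blk j), exists2 q, q < m & P j <= sp q * th (blk j) &
   i * \sum_(a < n | (blk a == blk j) && (P j <= P a)) P a <=
     42 * th (blk j) * \sum_(q < m) (P j <= sp q * th (blk j)) * sp q].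
Hypothesis block_gap : forall j a, j < n -> a < n -> 0 < blk a -> blk a < blk j ->
  265 * th (blk a) <= 100 * th (blk j).

(* The bases of the blocks grow by a factor 2.65, and 1.607 bounds the sum of the
   geometric series of ratio 1/2.65. *)
Lemma reset_quality b t ld mc st cp T bs :
  reach true n m P r sp th blk rank b t ld mc st cp T bs ->
  forall a, a < n -> done_by b t a -> i * (1000 * cp a) <= (i + 42) * (1607 * th (blk a)).
Proof.
move=> rc; suff [] : [/\
    (th b <= bs) && ((b == 0) ==> (bs == 0)) /\ (forall j, j < n -> blk j = b -> 0 < b ->
      i * (1000 * bs) <= (i + 42) * (607 * th b)),
    exists2 wk, forall q, q < m -> ld q * sp q <= bs * sp q + wk q &
      \sum_(q < m) wk q = \sum_(a < n | (blk a == b) && (key_of a < t)) P a,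
    forall q, q < m -> ld q <= T,
    T = 0 \/ (exists a, [/\ a < n, 0 < blk a, done_by b t a &
      i * (1000 * T) <= (i + 42) * (1607 * th (blk a))]) &
    forall a, a < n -> done_by b t a ->
      i * (1000 * cp a) <= (i + 42) * (1607 * th (blk a))] by [].
elim: rc => {b t ld mc st cp T bs}
  [ld mc st cp ld0|b ld mc st cp T bs _ [_ _ ldT TE c1]
  |b t ld mc st cp T bs _ [bsE [wk w1 w2] ldT TE c1] nokey
  |b ld mc st cp T bs j q _ [[/andP[thbs bs0] bsE] [wk w1 w2] ldT TE c1] jn bj qm mini].
- split; [|exists (fun _ => 0)|by move=> q /ld0->|by left|by move=> a an; rewrite done0].
  + by rewrite /new_base th0.
  + by move=> q qm; rewrite ld0.
  + by rewrite big1 //; apply/esym/big_pred0 => a; rewrite ltn0 andbF.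
- split=> //.
  + split; first by rewrite /new_base leq_maxr.
    move=> j jn bj _; rewrite /new_base.
    (* The base of a block is kept below 0.607 (1 + 42/i) times its grid time. For the grid time
       itself this holds since [i <= 40]; for the end of the previous blocks since 1.607 / 2.65 <
       0.607. Adding the block's own 1 + 42/i restores 1.607. *)
    have h1 : i * (1000 * th b.+1) <= (i + 42) * (607 * th b.+1) by nia.
    have h2 : i * (1000 * T) <= (i + 42) * (607 * th b.+1).
      case: TE => [->|[a [an ba da Ta]]]; first by rewrite !muln0.
      have lt : blk a < blk j.
        by rewrite bj ltnS; case/orP: da => [/ltnW//|/andP[/eqP-> _]].
      have := block_gap jn an ba lt; rewrite bj; nia.
    by rewrite /maxn; case: ifP.
  + exists (fun _ => 0) => [q qm|].
      rewrite addn0 leq_mul2r; apply/orP; right.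
      by apply: leq_trans (ldT q qm) _; rewrite /new_base leq_maxl.
    by rewrite big1 //; apply/esym/big_pred0 => a; rewrite ltn0 andbF.
  + case: TE => [->|[a [an ba da Ta]]]; [by left | right].
    by exists a; split=> //; rewrite (done_block _ rank_lt).
  + by move=> a an; rewrite (done_block _ rank_lt) //; apply: c1.
- have dE a : a < n -> done_by b t.+1 a = done_by b t a.
    by move=> an; rewrite doneS (negPf (nokey a an)) orbF.
  split=> //.
  + exists wk => //; rewrite w2; apply: eq_bigl => a; rewrite ltnS [key_of a <= t]leq_eqVlt.
    by rewrite andb_orr (negPf (nokey a _)).
  + case: TE => [->|[a [an ba da Ta]]]; [by left | right].
    by exists a; split=> //; rewrite dE.
  + by move=> a an; rewrite dE //; apply: c1.
- have ndj : ~~ done_by b (key_of j) j by rewrite /done bj !ltnn andbF.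
  have rj : r j <= bs.
    apply: leq_trans thbs.
    have [b0|b0] := posnP b; last by case: (block_ok jn); rewrite bj.
    by rewrite b0 in bj; have [_ ->] := zero_block jn bj.
  have fin : i * (1000 * finish_on ld bs j q) <= (i + 42) * (1607 * th b).
    have [b0|b0] := posnP b.
      rewrite b0 in bj; have [Pj rj0] := zero_block jn bj.
      have T0 : T = 0.
        case: TE => // -[a [an ba]]; rewrite b0 /done ltn0 => /andP[/eqP ba0].
        by rewrite ba0 in ba.
      have := ldT q qm; rewrite T0 leqn0 => /eqP ld0.
      rewrite b0 /= in bs0; rewrite /finish /begin ld0 (eqP bs0) rj0 Pj div0n.
      by rewrite !muln0.
    have [_ elig ld_ok] := block_ok jn ltac:(by rewrite bj); rewrite bj in elig ld_ok.
    have g3 : i * \sum_(q < m) wk q <= 42 * th b * \sum_(q < m) (P j <= sp q * th b) * sp q.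
      apply: leq_trans ld_ok; rewrite leq_mul2l; apply/orP; right; rewrite w2.
      rewrite big_mkcond [X in _ <= X]big_mkcond /=; apply: leq_sum => a _.
      case: ifP => // /andP[/eqP ba ka]; rewrite ba eqxx /=.
      (* Longest first: a job of the block placed before [j] is at least as long, so the packing row
         of [j] counts it. *)
      rewrite ifT // leqNgt; apply/negP => lt.
      have := rank_order jn (ltn_ord a) lt; move: ka; rewrite /ikey.
      have := ltn_ord a; nia.
    have [q' q'm lq'] := greedy_step (E := fun q => P j <= sp q * th b) elig (fun _ _ h => h)
      g3 (leqnn bs) rj w1.
    have := bsE j jn bj b0; have := leq_mul (leqnn i) (mini _ q'm); nia.
  have kE a : a < n -> (blk a == b) && (key_of a < (key_of j).+1) =
      (a == j) || ((blk a == b) && (key_of a < key_of j)).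
    move=> an; rewrite ltnS [key_of a <= _]leq_eqVlt andb_orr; congr (_ || _).
    by apply/andP/eqP => [[_ /eqP e]|->]; [apply: ikey_inj e | rewrite bj !eqxx].
  have sE := sum_doneS (D := fun a => (blk a == b) && (key_of a < key_of j))
    (D' := fun a => (blk a == b) && (key_of a < (key_of j).+1)) jn ltac:(by rewrite /= ltnn andbF) kE.
  split=> //.
  + by split=> //; rewrite thbs.
  + exists (put wk q (wk q + P j)) => [q' q'm|]; last by rewrite sum_put // w2 sE.
    rewrite /put; case: eqP => [->|_]; last exact: w1.
    by apply: dvd_finish => //; apply: w1.
  + move=> q' q'm; rewrite /put; case: eqP => _; first by rewrite leq_maxr.
    by apply: leq_trans (ldT _ q'm) _; rewrite leq_maxl.
  + have [b0|b0] := posnP b.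
      left; have T0 : T = 0.
        case: TE => // -[a [an ba]]; rewrite b0 /done ltn0 => /andP[/eqP ba0].
        by rewrite ba0 in ba.
      by move: fin; rewrite T0 max0n b0 th0 !muln0 leqn0 !muln_eq0 eqn0Ngt i_gt0 => /eqP.
    right; exists j; rewrite doneE // eqxx bj; split=> //.
    case: TE => [->|[a [an ba da Ta]]]; first by rewrite max0n.
    have thab : th (blk a) <= th b.
      by apply: th_leq; case/orP: da => [/ltnW//|/andP[/eqP-> _]].
    by rewrite /maxn; case: ifP => // _; nia.
  + move=> a an; rewrite doneE // /put => /orP[/eqP->|da].
      by rewrite eqxx bj.
    by case: eqP => [e|_]; [rewrite e (negPf ndj) in da | apply: c1].
Qed.

End Reset.

End Quality.

(** * Averaging over thresholds and offsets *)

(* The least block index [>= k] that is congruent to the offset [o] modulo [h],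
   for a suitable indexing of the offsets. *)
Definition next_block (h o k : nat) : nat := k + (o + h.-1 * k) %% h.

Lemma next_block_congr h o k : 0 < h -> next_block h o k = o %[mod h].
Proof.
move=> h0; rewrite /next_block modnDmr (_ : k + (o + h.-1 * k) = k * h + o) ?modnMDl //.
by case: h h0 => //= h _; rewrite mulnS [h * k]mulnC; lia.
Qed.

Lemma sum_shift_mod h c (F : nat -> nat) : 0 < h ->
  \sum_(o < h) F ((o + c) %% h) = \sum_(d < h) F d.
Proof.
case: h => // h _; elim: c => [|c IHc].
  by apply: eq_bigr => o _; rewrite addn0 modn_small.
rewrite -IHc big_ord_recr [RHS]big_ord_recl /= addnC; congr (_ + _).
  by rewrite add0n addnS -addSn addnC modnDr.
by apply: eq_bigr => o _; rewrite /= /bump leq0n addnS -addSn.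
Qed.

(** At most V/N of the multiples N, 2N, ..., pN lie below V: averaging over a uniform threshold in
    discrete form. *)
Lemma count_gap p N V : \sum_(i < p) ((p - i) * N < V) * N <= V.
Proof.
elim: p => [|p IHp]; first by rewrite big_ord0.
rewrite big_ord_recl /= subn0; case: ltnP => [lt|ge] /=.
  apply: leq_trans (ltnW lt); rewrite [true * N]mul1n mulSn leq_add2l.
  rewrite -[X in _ <= X * _]card_ord -sum_nat_const leq_sum // => i _.
  by case: (_ < _) => //; rewrite mul1n.
by rewrite mul0n add0n; under eq_bigr do rewrite /bump leq0n subSS.
Qed.

Lemma geometric_sum (th : nat -> nat) k d :
  (forall l, 0 < l -> 40 * th l.+1 <= 41 * th l) -> 0 < k ->
  40 ^ d * \sum_(e < d) th (k + e) <= 40 * ((41 ^ d - 40 ^ d) * th k).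
Proof.
move=> th41 k0; have thd e : 40 ^ e * th (k + e) <= 41 ^ e * th k.
  elim: e => [|e IHe]; first by rewrite addn0.
  have := th41 (k + e) ltac:(by rewrite addn_gt0 k0); rewrite addnS !expnS.
  move: IHe; move: (40 ^ e) (41 ^ e) (th _) (th _) (th k) => a b x y z h1 h2.
  have := leq_mul (leqnn 41) h1; have := leq_mul (leqnn a) h2; nia.
elim: d => [|d IHd]; first by rewrite big_ord0 muln0.
rewrite big_ord_recr /= mulnDr; have := thd d.
have : 40 ^ d <= 41 ^ d by apply: leq_exp2r_weak.
move: IHd; rewrite !expnS; move: (40 ^ d) (41 ^ d) (\sum_(e < d) _) (th _) (th k).
move=> a b x y z h1 h2 h3.
rewrite !mulnBl in h1 *; nia.
Qed.

Lemma mono_count K (p : pred nat) k : (forall l, l.+1 < K -> p l.+1 -> p l) -> k < K ->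
  (k < \sum_(l < K) p l) = p k.
Proof.
elim: K => // K IHK pmono; rewrite ltnS big_ord_recr /= => kK.
have down l d : l + d < K.+1 -> p (l + d) -> p l.
  elim: d => [|d IHd]; first by rewrite addn0.
  by rewrite addnS => lt /(pmono _ lt); apply: IHd; apply: ltnW.
have [pK|npK] := boolP (p K).
  have all l : l < K.+1 -> p l.
    by rewrite ltnS => lK; apply: (@down l (K - l)); rewrite subnKC.
  rewrite (_ : \sum_(l < K) p l = K) ?addn1 ?ltnS ?kK ?all //.
  rewrite -[RHS]card_ord -sum1_card; apply: eq_bigr => l _; rewrite all //.
  by apply: ltnW; rewrite ltnS.
rewrite addn0; move: kK; rewrite leq_eqVlt => /orP[/eqP->|kK].
  rewrite (negPf npK) ltnNge (_ : _ <= _) // -[X in _ <= X]card_ord -sum1_card.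
  by apply: leq_sum => l _; apply: leq_b1.
by rewrite IHK // => l lt; apply: pmono; apply: ltnW.
Qed.

Section Averaging.

Variables (n g K N Lmax Bd h : nat) (w th : nat -> nat) (inc : nat -> nat -> bool).
Variables (nz : pred nat) (x u : nat -> nat -> nat).

(** The first level at which the fraction of a nontrivial job reaches [i / 40], or [K] if there is
    none. It is written as a count, which a loop computes; fractions grow with the level, so the
    count is that first index. *)
Definition kappa (i j : nat) : nat := if nz j then \sum_(k < K) (40 * x j k < i * N) else 0.
Definition group_kappa (i S : nat) : nat := \max_(j < n | inc S j && nz j) kappa i j.

Hypothesis N_gt0 : 0 < N.
Hypothesis th0 : th 0 = 0.
Hypothesis th_mono : forall k, th k <= th k.+1.
Hypothesis x_mono : forall j k, x j k <= x j k.+1.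
Hypothesis x_cover : forall S j k, S < g -> j < n -> k < K -> inc S j -> nz j -> N <= u S k + x j k.
Hypothesis u_cost : \sum_(S < g) \sum_(k < K) w S * gap th k * u S k <= Lmax * Bd.

Lemma kappa_le i j : kappa i j <= K.
Proof.
rewrite /kappa; case: ifP => // _; rewrite -[X in _ <= X]card_ord -sum1_card.
by apply: leq_sum => k _; apply: leq_b1.
Qed.

Lemma lt_kappa i j k : nz j -> k < K -> (k < kappa i j) = (40 * x j k < i * N).
Proof.
move=> nj kK; rewrite /kappa nj (mono_count (p := fun k => 40 * x j k < i * N)) // => l _.
by apply: leq_ltn_trans; rewrite leq_mul2l x_mono orbT.
Qed.

Lemma group_kappa_le i S : group_kappa i S <= K.
Proof. by apply/bigmax_leqP => j _; apply: kappa_le. Qed.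

(** If level [k] comes before the level of the group for threshold [i.+1], some member has a
    fraction below [i.+1 / 40] there, so [40 * u S k] exceeds [(39 - i) * N]. By [count_gap] this
    happens for at most 40 u/N thresholds, and summing over the gaps gives the cost of the group in
    the program. *)
Lemma group_kappa_cost S : S < g ->
  (\sum_(i < 39) th (group_kappa i.+1 S)) * N <= 40 * \sum_(k < K) gap th k * u S k.
Proof.
move=> Sg; rewrite big_distrl big_distrr /=.
have thE i : th (group_kappa i S) = \sum_(k < K) (k < group_kappa i S) * gap th k.
  rewrite -(sum_gap th_mono th0) (big_ord_widen K (gap th) (group_kappa_le i S)).
  by rewrite big_mkcond; apply: eq_bigr => k _; case: ifP; rewrite ?mul1n ?mul0n.
under eq_bigr do rewrite thE big_distrl /=.
rewrite exchange_big /=; apply: leq_sum => k _.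
apply: (@leq_trans (gap th k * \sum_(i < 39) ((39 - i) * N < 40 * u S k) * N)); last first.
  by rewrite mulnCA leq_mul2l count_gap orbT.
rewrite big_distrr /=; apply: leq_sum => i _; rewrite -mulnA mulnCA leq_mul2l; apply/orP; right.
rewrite leq_mul2r; apply/orP; right.
case: (ltnP k (group_kappa i.+1 S)) => // lt; rewrite (_ : _ < _ = true) //.
have [j /andP[iS nj] ltj] : exists2 j : 'I_n, inc S j && nz j & k < kappa i.+1 j.
  apply/exists_inP; apply: contraLR lt => /exists_inPn none; rewrite -leqNgt.
  by apply/bigmax_leqP => j cj; rewrite leqNgt none.
move: ltj; rewrite lt_kappa // => ltx.
have := x_cover Sg (ltn_ord j) (ltn_ord k) iS nj; have := ltn_ord i; nia.
Qed.

Variables (best E Gc : nat) (om : nat -> nat).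
Hypothesis best_le : forall i o, i < 39 -> o < h -> om i * best <= E * \sum_(S < g) w S *
  (if group_kappa i.+1 S == 0 then 0 else th (next_block h o (group_kappa i.+1 S))).
Hypothesis sum_next : forall k, 0 < k ->
  10 * \sum_(o < h) th (next_block h o k) <= Gc * th k.

(** The weights [om] are moved to the left, so every threshold enters the right-hand side with the
    same factor [E]. Averaging over offsets then costs [Gc], and the sum over thresholds is bounded
    group by group by the fractional cost. *)
Lemma averaging : h * best * (\sum_(i < 39) om i) * (10 * N) <= E * Gc * (40 * (Lmax * Bd)).
Proof.
pose TH o k := if k == 0 then 0 else th (next_block h o k).
have sTH k : 10 * \sum_(o < h) TH o k <= Gc * th k.
  rewrite /TH; case: eqP => [->|/eqP]; first by rewrite big1.
  by rewrite -lt0n => /sum_next.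
apply: (@leq_trans ((\sum_(i < 39) \sum_(S < g) E * (w S * \sum_(o < h) TH o (group_kappa i.+1 S))) * (10 * N))).
  rewrite leq_mul2r; apply/orP; right; rewrite big_distrr /=; apply: leq_sum => i _.
  apply: (@leq_trans (\sum_(o < h) om i * best)); first by rewrite sum_nat_const card_ord -!mulnA [best * _]mulnC.
  apply: (@leq_trans (\sum_(o < h) E * \sum_(S < g) w S * TH o (group_kappa i.+1 S))).
    by apply: leq_sum => o _; apply: best_le.
  rewrite -big_distrr -big_distrr leq_mul2l; apply/orP; right.
  by rewrite exchange_big /=; apply: leq_sum => S _; rewrite big_distrr.
apply: (@leq_trans (\sum_(S < g) E * Gc * (w S * (\sum_(i < 39) th (group_kappa i.+1 S) * N)))).
  rewrite exchange_big big_distrl /=; apply: leq_sum => S _; rewrite !big_distrl !big_distrr /=.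
  apply: leq_sum => i _; have := sTH (group_kappa i.+1 S).
  move: (\sum_(o < h) _) (th _) => a b; move: (w S) => ws H.
  have := leq_mul (leqnn (E * ws * N)) H.
  by congr (_ <= _); ring.
rewrite -big_distrr /= leq_mul2l; apply/orP; right.
apply: leq_trans (leq_mul (leqnn 40) u_cost); rewrite big_distrr /=; apply: leq_sum => S _.
rewrite -big_distrl /=; apply: leq_trans (leq_mul (leqnn (w S)) (group_kappa_cost (ltn_ord S))) _.
rewrite mulnCA leq_mul2l; apply/orP; right; rewrite big_distrr /=; apply: leq_sum => k _.
by rewrite mulnA.
Qed.

End Averaging.

Lemma geometric_const : 10 * (40 * (41 ^ 40 - 40 ^ 40)) <= 675 * 40 ^ 40.
Proof.
have le : 10 * (40 * 41 ^ 40) <= 675 * 40 ^ 40 + 10 * (40 * 40 ^ 40) by lia.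
by rewrite !mulnBr leq_subLR addnC.
Qed.

(** As the offset varies, the next block runs through 40 consecutive levels, so a geometric series
    bounds the sum: 40 ((41/40)^40 - 1) <= 67.5, an average loss of 1.6875. *)
Lemma sum_next_block (th : nat -> nat) k : (forall l, 0 < l -> 40 * th l.+1 <= 41 * th l) ->
  0 < k -> 10 * \sum_(o < 40) th (next_block 40 o k) <= 675 * th k.
Proof.
move=> th41 k0; rewrite /next_block (sum_shift_mod _ (fun d => th (k + d))) //.
have conclude a b x t : 0 < a -> 10 * (40 * b) <= 675 * a -> a * x <= 40 * (b * t) ->
    10 * x <= 675 * t.
  move=> a0 h1 h2; rewrite -(leq_pmul2l a0).
  have := leq_mul (leqnn 10) h2; have := leq_mul h1 (leqnn t); lia.
have p0 a : 0 < a.+1 ^ 40 by rewrite expn_gt0.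
exact: (conclude _ _ _ _ (p0 39) geometric_const (geometric_sum 40 th41 k0)).
Qed.

(** * The time grid *)

(** First positive grid time. All scaled data are made large enough for nontrivial jobs to last
    until it. It is so large that rounding down in a grid step loses a relative 1/40000 at most,
    which keeps the growth above 1.02475. *)
Definition time_unit : nat := 100 * 400.

Lemma time_unitE : time_unit = 40 * 1000.
Proof. by []. Qed.

Lemma time_unit_factors : time_unit = 100 * 400.
Proof. by []. Qed.

Global Opaque time_unit.

Fixpoint grid1 (k : nat) : nat :=
  if k is k'.+1 then grid1 k' + grid1 k' %/ 40 else time_unit.

Definition grid (k : nat) : nat := if k is k'.+1 then grid1 k' else 0.

Lemma grid1_ge k : time_unit <= grid1 k.
Proof. by elim: k => // k IH; apply: leq_trans IH (leq_addr _ _). Qed.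

Lemma grid_mono k : grid k <= grid k.+1.
Proof. by case: k => // k; apply: leq_addr. Qed.

Lemma grid_up k : 0 < k -> 40 * grid k.+1 <= 41 * grid k.
Proof. by case: k => // k _ /=; have := leq_divM (grid1 k) 40; lia. Qed.

Lemma grid_down k : 0 < k -> 4099 * grid k <= 4000 * grid k.+1.
Proof.
case: k => // k _; have := grid1_ge k; rewrite time_unitE [grid _]/= [grid _]/=.
have := ltn_pmod (grid1 k) (isT : 0 < 40); have := divn_eq (grid1 k) 40.
move: (grid1 k) (_ %/ 40) (_ %% 40) => x y z; lia.
Qed.

(** Each of 40 steps adds at least [1000 * 2 ^ k], a 40th of the bound at their start, which is an
    integer, so rounding does no harm. Polynomially many levels thus reach any time of polynomial
    bit length. *)
Lemma grid_doubling k : time_unit * 2 ^ k <= grid (40 * k).+1.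
Proof.
elim: k => [|k IHk]; first by rewrite muln1 muln0.
rewrite mulnS [40 + _]addnC; move: IHk; rewrite ![grid _.+1]/=.
have add d x : 40 * x <= grid1 (40 * k) -> grid1 (40 * k) + d * x <= grid1 (40 * k + d).
  move=> ge; elim: d => [|d IHd]; first by rewrite mul0n !addn0.
  rewrite addnS [grid1 _.+1]/= mulSn addnCA addnC; apply: leq_add => //.
  rewrite leq_divRL // mulnC; apply: leq_trans ge _; apply: leq_trans IHd; apply: leq_addr.
rewrite time_unitE => ge; apply: leq_trans (add 40 (1000 * 2 ^ k) _); last by rewrite mulnA.
move: ge; rewrite expnS; move: (2 ^ k) (grid1 _) => x y; lia.
Qed.

Lemma grid_le k : grid k <= time_unit * 2 ^ k.
Proof.
case: k => // k; rewrite [grid _]/=.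
suff : grid1 k <= time_unit * 2 ^ k by rewrite expnS; move: (2 ^ k) (grid1 k) => x y; lia.
elim: k => [|k IHk]; first by rewrite muln1.
have := leq_div (grid1 k) 40; rewrite expnS [grid1 _.+1]/=.
move: IHk; move: (grid1 k %/ 40) (2 ^ k) (grid1 k) => x y z; lia.
Qed.

(* The grid grows by a factor 1.02475 at least, and its 40th power exceeds 2.65. *)
Lemma grid_gap_const : 265 * 4000 ^ 40 <= 100 * 4099 ^ 40.
Proof. lia. Qed.

Lemma grid_gap h k l : 0 < k -> 40 <= h -> k + h <= l -> 265 * grid k <= 100 * grid l.
Proof.
move=> k0 h40 khl.
apply: (@leq_trans (100 * grid (k + 40))).
  have pw d : 4099 ^ d * grid k <= 4000 ^ d * grid (k + d).
    elim: d => [|d IHd]; first by rewrite addn0.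
    have := grid_down (leq_trans k0 (leq_addr d k)); rewrite addnS !expnS.
    move: IHd; move: (4099 ^ d) (4000 ^ d) (grid k) (grid (k + d)) (grid _) => a b x y z h1 h2.
    have := leq_mul (leqnn 4099) h1; have := leq_mul (leqnn b) h2; lia.
  have conclude a b x y : 0 < a -> 265 * a <= 100 * b -> b * x <= a * y -> 265 * x <= 100 * y.
    move=> a0 h1 h2; rewrite -(leq_pmul2l a0).
    have := leq_mul (leqnn 100) h2; have := leq_mul h1 (leqnn x); lia.
  have p0 a : 0 < a.+1 ^ 40 by rewrite expn_gt0.
  exact: (conclude _ _ _ _ (p0 3999) grid_gap_const (pw 40)).
by rewrite leq_mul2l (th_le grid_mono) //; lia.
Qed.

(** * Size classes *)

Section Sizes.

Variables (l Y Z : nat).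
Hypothesis l_ge : 2000 <= l.

(** Bit length below the k-th power of [l]. Sums and products of numbers of smaller classes belong
    to class [c], powers add classes, and every class up to 30 lies below [Z]: tracking this one
    index shows that clamping never acts. *)
Definition sz (k x : nat) : Prop := x < 2 ^ (l ^ k).

Lemma l_gt0 : 0 < l. Proof. by apply: leq_trans l_ge. Qed.

Lemma exp_le a b : a <= b -> l ^ a <= l ^ b.
Proof. by move=> ab; rewrite leq_pexp2l // l_gt0. Qed.

Lemma exp_add a b c : a < c -> b < c -> l ^ a + l ^ b <= l ^ c.
Proof.
case: c => // c; rewrite !ltnS => ac bc; rewrite expnS.
have := exp_le ac; have := exp_le bc; have := l_ge; nia.
Qed.

Lemma sz_weak a b x : sz a x -> a <= b -> sz b x.
Proof. by move=> sx ab; apply: leq_trans sx _; rewrite leq_exp2l // exp_le. Qed.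

Lemma sz_le a x y : x <= y -> sz a y -> sz a x.
Proof. exact: leq_ltn_trans. Qed.

Lemma sz_poly a x : x <= l ^ a -> sz a x.
Proof. by move=> h; apply: leq_ltn_trans h _; apply: ltn_expl. Qed.

Lemma sz_mul a b c x y : sz a x -> sz b y -> a < c -> b < c -> sz c (x * y).
Proof.
move=> sx sy ac bc; apply: (@leq_trans (2 ^ (l ^ a + l ^ b))).
  by rewrite expnD ltn_mul.
by rewrite leq_exp2l // exp_add.
Qed.

Lemma sz_add a b c x y : sz a x -> sz b y -> a < c -> b < c -> sz c (x + y).
Proof.
move=> sx sy ac bc; apply: (@leq_trans (2 ^ (l ^ a + l ^ b))).
  by rewrite expn2D_gt // expn_gt0 l_gt0.
by rewrite leq_exp2l // exp_add.
Qed.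

Lemma sz_prod a b c p (f : nat -> nat) : p <= l ^ b -> (forall i, i < p -> sz a (f i)) ->
  a + b < c -> sz c (\prod_(i < p) f i).
Proof.
move=> pb sf abc; apply: (@leq_ltn_trans (\prod_(i < p) 2 ^ (l ^ a))).
  by apply: leq_prod => i _; apply: ltnW; apply: sf.
rewrite prod_nat_const card_ord -expnM; apply: leq_trans (_ : 2 ^ (l ^ (a + b)).+1 <= _).
  by rewrite ltn_exp2l // ltnS expnD leq_mul2l pb orbT.
rewrite leq_exp2l //; apply: leq_trans (exp_le abc).
by rewrite ltn_exp2l //; lia.
Qed.

Lemma sz_sum a b c p (f : nat -> nat) : p <= l ^ b -> (forall i, i < p -> sz a (f i)) ->
  a < c -> b < c -> sz c (\sum_(i < p) f i).
Proof.
move=> pb sf ac bc; apply: (@sz_le _ _ (p * 2 ^ (l ^ a))).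
  rewrite -[p in X in _ <= X]card_ord -sum_nat_const leq_sum // => i _.
  exact/ltnW/sf.
apply: (@leq_trans (2 ^ (l ^ b) * 2 ^ (l ^ a))).
  rewrite ltn_mul2r expn_gt0 /=; apply: leq_ltn_trans pb _; exact: ltn_expl.
by rewrite -expnD leq_exp2l // exp_add.
Qed.

Lemma sz_exp a b c x k : sz a x -> k <= l ^ b -> a + b < c -> sz c (x ^ k).
Proof.
move=> sx kb abc; have := @sz_prod a b c k (fun _ => x) kb (fun _ _ => sx) abc.
by rewrite prod_nat_const card_ord.
Qed.

Lemma le_expM a b c x y : x <= l ^ a -> y <= l ^ b -> a + b <= c -> x * y <= l ^ c.
Proof. by move=> xa yb abc; apply: leq_trans (exp_le abc); rewrite expnD leq_mul. Qed.

Lemma le_expD a b c x y : x <= l ^ a -> y <= l ^ b -> a < c -> b < c -> x + y <= l ^ c.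
Proof. by move=> xa yb ac bc; apply: leq_trans (exp_add ac bc); rewrite leq_add. Qed.

Lemma sz_grid k a : k <= l ^ a -> sz a.+2 (grid k).
Proof.
move=> ka; apply: sz_le (grid_le k) _; apply: (@sz_mul a.+1 a.+1) => //.
  apply: sz_weak (_ : sz 1 _) _ => //; rewrite /sz expn1 time_unitE.
  apply: (@leq_trans (2 ^ (6 + 10))); last by rewrite leq_exp2l //; lia.
  by rewrite expnD (@leq_ltn_trans (2 ^ 6 * 1000)) // ?leq_mul2r // ltn_mul2l.
apply: leq_trans (_ : 2 ^ (l ^ a).+1 <= _); first by rewrite ltn_exp2l // ltnS.
by rewrite leq_exp2l // ltn_exp2l //; lia.
Qed.

Hypotheses (YE : Y = l ^ 30) (ZE : Z = 2 ^ Y).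

Lemma sz_Z k x : sz k x -> k <= 30 -> x < Z.
Proof. by move=> sx k30; rewrite ZE YE; apply: leq_trans sx _; rewrite leq_exp2l // exp_le. Qed.

Lemma poly_Y k x : x <= l ^ k -> k <= 30 -> x <= Y.
Proof. by move=> h k30; rewrite YE; apply: leq_trans h (exp_le k30). Qed.

Lemma poly_Z k x : x <= l ^ k -> k <= 30 -> x < Z.
Proof. by move=> h; apply: sz_Z; apply: sz_poly. Qed.

Lemma Y_lt_Z : Y < Z. Proof. by rewrite ZE; apply: ltn_expl. Qed.

End Sizes.

(** * The scheduling program *)

Notation aK := 13. Notation aKB := 14. Notation aNK := 72. Notation vQ := 73.
Notation aTOP := 30. Notation aCAP := 28. Notation aCP := 21. Notation aNZ := 26.
Notation vA := 74. Notation aACC := 75. Notation vTHR := 76. Notation vOFF := 77.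
Notation aKAP := 78. Notation vK := 79. Notation aBD := 80. Notation aLAM := 81.

Section Program.

Variable h : nat.
Variable reset : bool.

(** The squared measure of the input gives enough grid levels for every completion time, its cube
    enough guesses for every cost. The [h] extra blocks make room for moving up to the next block of
    the given offset. *)
Definition setup_counts : hcmd :=
  (aK ::= #rL * #rL ;; aKB ::= #rL * #aK ;; aNBLK ::= #aK + K h ;;
   aNV ::= (#an + #ag) * #aK ;; aNK ::= #an * #aK ;; aMP ::= #aNK + K 1 ;;
   aMC ::= #ag * #an * #aK ;; aN ::= K 1200 * (#aMP + #aMC + K 1) ;;
   aIT ::= #aMC * #aN)%C.

Definition setup_grid : hcmd :=
  (Set_ aTH (K 0) (K 0) ;; Set_ aTH (K 1) (K 100 * K 400) ;;
   For vA (#aKB) (Set_ aTH (#vA + K 2) (aTH $ (#vA + K 1) + aTH $ (#vA + K 1) %/ K 40)))%C.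

Definition cap_exp : hexp := (aTH $ (#vA %% #aK) * #aACC)%H.

Definition setup_caps : hcmd :=
  (fold OMax vI aTOP (#am) (K 0) (aS $ (#vI)) ;;
   For vA (#aNK)
     (fold OAdd vI aACC (#am) (K 0)
        ((aP $ (#vA %/ #aK) <= aS $ (#vI) * aTH $ (#vA %% #aK)) * aS $ (#vI)) ;;
      Set_ aCAP (#vA) (cap_exp + (cap_exp == K 0))) ;;
   fold OMul vA aCP (#aNK) (K 1) (aCAP $ (#vA)))%C.

Definition setup_jobs : hcmd :=
  (fill vA aNZ (#an) (K 0 < aP $ (#vA) + aR $ (#vA)) ;;
   For vA (#an)
     (fold OAdd vI aACC (#an) (K 0) (aP $ (#vA) < aP $ (#vI)) ;;
      Set_ aRANK (#vA) (#aACC)))%C.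

Definition setup : hcmd := (setup_counts ;; setup_grid ;; setup_caps ;; setup_jobs)%C.

(** ** Building the linear program *)

Definition col_a : hexp := ((#vA %% #aNV) %/ #aK)%H.
Definition col_l : hexp := ((#vA %% #aNV) %% #aK)%H.
Definition row_i : hexp := (#vA %/ #aNV)%H.
Definition row_k : hexp := (row_i %% #aK)%H.
Definition elig_exp : hexp :=
  ((aR $ col_a <= aTH $ col_l) && (aP $ col_a <= #aTOP * aTH $ col_l))%H.
Definition gap_exp : hexp := (aTH $ (col_l + K 1) - aTH $ col_l)%H.
Definition wgap_exp : hexp := (aW $ (col_a - #an) * gap_exp)%H.

Definition A_exp : hexp :=
  ((row_i < #aNK) * (((col_a < #an) && ((col_l <= row_k) && (elig_exp &&
       (aP $ (row_i %/ #aK) <= aP $ col_a)))) * (aP $ col_a * (#aD %/ aCAP $ row_i))) +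
   (#aNK <= row_i) * (((#an <= col_a) && (wgap_exp <= #aBD)) * (wgap_exp * #aCP)))%H.

Definition C_exp : hexp :=
  ((col_a < #an) * ((col_a == (row_i %/ #aK) %% #an) && ((col_l <= row_k) && elig_exp)) +
   (#an <= col_a) * ((col_a - #an == (row_i %/ #aK) %/ #an) &&
     ((col_l == row_k) && (wgap_exp <= #aBD))))%H.

Definition setup_lp : hcmd :=
  (aBD ::= aTH $ (#vQ + K 1) ;; aD ::= #aBD * #aCP ;;
   fill vA aA (#aMP * #aNV) A_exp ;; fill vA aC (#aMC * #aNV) C_exp ;;
   fill vA aCOV (#aMC)
     (#aN * (K 1 - (aINC $ (#vA %/ #aK) && aNZ $ ((#vA %/ #aK) %% #an)))))%C.

(** ** Rounding and scheduling *)

Definition set_blocks : hcmd :=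
  For vA (#an)
    ((aACC ::= K 0 ;; aKAP ::= K 0 ;;
      For vK (#aK)
        (aACC ::= #aACC + aV $ (#vA * #aK + #vK) ;;
         aKAP ::= #aKAP + (K 40 * #aACC < (#vTHR + K 1) * #aN))) ;;
     Set_ aBLK (#vA) (aNZ $ (#vA) * (#aKAP + (#vOFF + K h.-1 * #aKAP) %% K h)))%C.

Definition set_cost : hcmd :=
  (aCOST ::= K 0 ;;
   For vG (#ag)
     (fold OMax vA aCM (#an) (K 0) (aINC $ (#vG * #an + #vA) * aCOMP $ (#vA)) ;;
      aCOST ::= #aCOST + aW $ (#vG) * #aCM))%C.

Definition keep_best : hcmd :=
  If_ ((#aHAS == K 0) || (#aCOST < #aBEST))%H
    (aHAS ::= K 1 ;; aBEST ::= #aCOST ;; fill vA aBM (#an) (aMACH $ (#vA)) ;;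
     fill vA aBST (#an) (aSTART $ (#vA))) Nop.

Definition attempt : hcmd := (set_blocks ;; place reset ;; set_cost ;; keep_best)%C.

Definition guess : hcmd :=
  (setup_lp ;; solver ;; For vTHR (K 39) (For vOFF (K h) attempt))%C.

Definition core : hcmd := (setup ;; aHAS ::= K 0 ;; For vQ (#aKB) guess)%C.

Definition output : hcmd :=
  For vA (#an)
    (Set_ rOUT (#an + K 3 * #vA) (aBM $ (#vA)) ;;
     Set_ rOUT (#an + K 3 * #vA + K 1) (aBST $ (#vA)) ;;
     Set_ rOUT (#an + K 3 * #vA + K 2) (#aLAM))%C.

End Program.

(** * Correctness of the scheduling program *)

Section Core.

Variables (l Y Z n m g h : nat) (reset : bool) (P r sp w : nat -> nat) (inc : nat -> nat -> bool).
Local Notation den := (den Y Z).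

Hypotheses (l_ge : 2000 <= l) (YE : Y = l ^ 30) (ZE : Z = 2 ^ Y).
Hypotheses (n_le : n <= l) (m_le : m <= l) (g_le : g <= l) (h_gt0 : 0 < h) (h_le : h <= 40).
Hypotheses (P_sz : forall j, j < n -> sz l 2 (P j)) (r_sz : forall j, j < n -> sz l 2 (r j))
  (sp_sz : forall i, i < m -> sz l 1 (sp i)) (w_sz : forall S, S < g -> sz l 2 (w S)).

Local Notation Kc := (l * l).
Local Notation KB := (l * (l * l)).
Local Notation nv := ((n + g) * Kc).
Local Notation mp := (n * Kc).+1.
Local Notation mc := (g * n * Kc).
Local Notation N := (1200 * (mp + mc).+1).
Local Notation It := (mc * N).
Local Notation cap i := (cap1 m P sp grid (i %/ Kc) (i %% Kc)).
Local Notation nz := (nontrivial P r).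
(** Number of strictly longer jobs: placing by increasing rank is placing longest first, without
    sorting; equal lengths share a rank. *)
Definition prank (j : nat) : nat := \sum_(a < n) (P j < P a).

Record base_ctx (s : store) : Prop := BaseCtx {
  b_n : s an 0 = n; b_m : s am 0 = m; b_g : s ag 0 = g; b_l : s rL 0 = l;
  b_P : forall j, j < n -> s aP j = P j; b_r : forall j, j < n -> s aR j = r j;
  b_s : forall i, i < m -> s aS i = sp i; b_w : forall S, S < g -> s aW S = w S;
  b_inc : forall S j, S < g -> j < n -> s aINC (S * n + j) = inc S j }.

Record counts_ctx (s : store) : Prop := CountsCtx {
  c_K : s aK 0 = Kc; c_KB : s aKB 0 = KB; c_NBLK : s aNBLK 0 = Kc + h;
  c_NV : s aNV 0 = nv; c_NK : s aNK 0 = n * Kc; c_MP : s aMP 0 = mp; c_MC : s aMC 0 = mc;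
  c_N : s aN 0 = N; c_IT : s aIT 0 = It }.

Record tables_ctx (s : store) : Prop := TablesCtx {
  t_TH : forall k, k <= KB.+1 -> s aTH k = grid k;
  t_TOP : s aTOP 0 = top_speed m sp;
  t_CAP : forall i, i < n * Kc -> s aCAP i = cap i;
  t_CP : s aCP 0 = cap_prod n m Kc P sp grid;
  t_NZ : forall j, j < n -> s aNZ j = nz j;
  t_RANK : forall j, j < n -> s aRANK j = prank j }.

Lemma base_ctx_eq s s' : {in [:: an; am; ag; rL; aP; aR; aS; aW; aINC], forall a, s' a = s a} ->
  base_ctx s -> base_ctx s'.
Proof. by move=> fr [] *; split; move=> *; rewrite fr; auto. Qed.

Lemma counts_ctx_eq s s' :
  {in [:: aK; aKB; aNBLK; aNV; aNK; aMP; aMC; aN; aIT], forall a, s' a = s a} ->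
  counts_ctx s -> counts_ctx s'.
Proof. by move=> fr [] *; split; rewrite fr. Qed.

Lemma tables_ctx_eq s s' :
  {in [:: aTH; aTOP; aCAP; aCP; aNZ; aRANK], forall a, s' a = s a} ->
  tables_ctx s -> tables_ctx s'.
Proof. by move=> fr [] *; split; move=> *; rewrite fr; auto. Qed.

Let Zsz k x : sz l k x -> k <= 30 -> x < Z.
Proof. by move=> *; apply: (sz_Z l_ge YE ZE (k := k)). Qed.
Let Zp k x : x <= l ^ k -> k <= 30 -> x < Z.
Proof. by move=> *; apply: (poly_Z l_ge YE ZE (k := k)). Qed.
Let Yp k x : x <= l ^ k -> k <= 30 -> x <= Y.
Proof. by move=> *; apply: (poly_Y l_ge YE (k := k)). Qed.

Lemma Kc_le : Kc <= l ^ 2. Proof. by rewrite expnS expn1. Qed.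
Lemma KB_le : KB <= l ^ 3. Proof. by rewrite !expnS expn0 muln1. Qed.
Lemma nK_le : n * Kc <= l ^ 3. Proof. by rewrite !expnS expn0 muln1 leq_mul. Qed.
Lemma Kc_KB : Kc <= KB. Proof. by rewrite leq_pmull //; lia. Qed.
Lemma one_le k : 1 <= l ^ k. Proof. by rewrite expn_gt0; lia. Qed.

Lemma mp_le : mp <= l ^ 4.
Proof. rewrite -[mp]addn1. by apply: (le_expD l_ge nK_le (one_le 0)). Qed.

Lemma mc_le : mc <= l ^ 4.
Proof. by rewrite !expnS expn0 muln1 -mulnA leq_mul // leq_mul. Qed.

Lemma nv_le : nv <= l ^ 4.
Proof.
apply: (le_expM l_ge (a := 2) (b := 2) _ Kc_le) => //.
by apply: (le_expD l_ge (a := 1) (b := 1)); rewrite ?expn1.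
Qed.

Lemma N_le : N <= l ^ 6.
Proof.
apply: (le_expM l_ge (a := 1) (b := 5)) => //; first by rewrite expn1; lia.
rewrite -[(_ + g * n * Kc).+1]addn1; apply: (@leq_trans (l ^ 4 + l ^ 4 + 1)); first by rewrite !leq_add ?mp_le ?mc_le.
have := one_le 4; rewrite [l ^ 5]expnS; nia.
Qed.

Lemma It_le : It <= l ^ 10. Proof. exact: (le_expM l_ge mc_le N_le). Qed.

Lemma set_cell a e s x : hev s e = x -> x < Z -> den (Set_ a (K 0) e) s = upd s a 0 x.
Proof. by move=> <- xZ; rewrite den_set clamp_id. Qed.

Lemma setup_counts_correct s : base_ctx s -> counts_ctx (den (setup_counts h) s).
Proof.
move=> [nE mE gE lE _ _ _ _ _]; rewrite /setup_counts.
have kz := Zp Kc_le isT; have kbz := Zp KB_le isT; have nkz := Zp nK_le isT.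
have mpz := Zp mp_le isT; have mcz := Zp mc_le isT; have nvz := Zp nv_le isT.
have Nz := Zp N_le isT; have itz := Zp It_le isT.
have nbz : Kc + h < Z.
  apply: (@Zp 3) => //; apply: (le_expD l_ge (a := 2) (b := 1)) => //; rewrite expn1; lia.
rewrite den_seq (@set_cell _ _ _ Kc) //=; last by rewrite lE.
rewrite den_seq (@set_cell _ _ _ KB) //=; last by rewrite [_ rL 0]lE.
rewrite den_seq (@set_cell _ _ _ (Kc + h)) //=.
rewrite den_seq (@set_cell _ _ _ nv) //=; last by rewrite [_ an 0]nE [_ ag 0]gE.
rewrite den_seq (@set_cell _ _ _ (n * Kc)) //=; last by rewrite [_ an 0]nE.
rewrite den_seq (@set_cell _ _ _ mp) //=; last by rewrite addn1.
rewrite den_seq (@set_cell _ _ _ mc) //=; last by rewrite [_ an 0]nE [_ ag 0]gE.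
rewrite den_seq (@set_cell aN _ _ N) //=; last by rewrite addn1.
by rewrite (@set_cell _ _ _ It).
Qed.

Lemma setup_grid_correct s : counts_ctx s ->
  forall k, k <= KB.+1 -> den setup_grid s aTH k = grid k.
Proof.
move=> cx; have kbE := c_KB cx; rewrite /setup_grid den_seq den_set; set s1 := upd _ _ _ _.
rewrite den_seq den_set; set s2 := upd _ _ _ _.
have gZ k : k <= l ^ 4 -> grid k < Z.
  by move=> k4; apply: (@Zsz 6) => //; apply: sz_grid.
pose I i (s' : store) := forall k, k <= i.+1 -> s' aTH k = grid k.
have U_Z : 100 * 400 < Z by apply: (gZ 1); apply: one_le.
have kb2 : s2 aKB 0 = KB by rewrite -kbE.
have := @for_rule Y Z I vA (#aKB)%H
  (Set_ aTH (#vA + K 2)%H (aTH $ (#vA + K 1) + aTH $ (#vA + K 1) %/ K 40)%H) s2.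
rewrite /= kb2; apply => //.
- by apply: (@Yp 3) => //; apply: KB_le.
- move=> k; rewrite upd_other // upd_other // /s2 /s1 !upd_cell /= clamp_id //.
  by case: k => [|[|]].
- move=> i s' lt vi fr Ii k; rewrite leq_eqVlt upd_other // den_set upd_cell /= vi.
  have -> : i + 2 = i.+2 by rewrite addn2.
  have -> : i + 1 = i.+1 by rewrite addn1.
  rewrite !(Ii i.+1) // clamp_id; last first.
    apply: (gZ i.+2); apply: (@leq_trans KB.+1) => //; rewrite -[KB.+1]addn1.
    by apply: (le_expD l_ge KB_le (one_le 0)).
  by case: (k =P i.+2) => [->//|_] /=; apply: Ii.
Qed.

Lemma in_frame c s (L : seq nat) : all (fun a => a \notin assigned c) L ->
  {in L, forall a, den c s a = s a}.
Proof. by move=> /allP ac a /ac; apply: den_frame. Qed.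

Lemma table_spec v a cnt c e s k (f : nat -> nat) :
  v \notin assigned c -> a \notin assigned c -> v != a -> hev s cnt = k -> k <= Y ->
  (forall i, i < k -> f i < Z) ->
  (forall i s', i < k -> s' v 0 = i ->
     (forall b, b != v -> b != a -> b \notin assigned c -> s' b = s b) ->
     hev (den c s') e = f i) ->
  forall i, i < k -> den (For v cnt (Seq_ c (Set_ a (#v)%H e))) s a i = f i.
Proof.
move=> vc ac va cN kY fZ bodyE.
pose I k (s' : store) := forall i, i < k -> s' a i = f i.
have := @for_rule Y Z I v cnt (Seq_ c (Set_ a (#v)%H e)) s.
rewrite cN; apply => //; first by rewrite /= mem_cat inE negb_or vc.
move=> i s' lt vi fr Ii j; rewrite ltnS leq_eqVlt => jlt; rewrite upd_other 1?eq_sym // den_seq den_set.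
rewrite upd_cell [hev _ _]/= (den_frame _ _ _ vc) vi.
have -> : hev (den c s') e = f i.
  by apply: bodyE => // b bv ba bc; rewrite fr //= mem_cat inE negb_or bc.
by rewrite clamp_id ?fZ //; case: (j =P i) jlt => [->//|_] /=; rewrite (den_frame _ _ _ ac); apply: Ii.
Qed.

Lemma speed_sum_sz (p : pred nat) : sz l 2 (\sum_(i < m) p i * sp i).
Proof.
apply: (@sz_sum l l_ge 1 1 2 m (fun i => p i * sp i)) => // i im.
by apply: sz_le (sp_sz im); case: (p i); rewrite ?mul1n.
Qed.

Lemma capacity_sz j k : k < Kc -> sz l 5 (capacity m P sp grid j k).
Proof.
move=> kK; apply: (@sz_mul l l_ge 4 2) => //; last exact: (speed_sum_sz (fun i => P j <= sp i * grid k)).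
by apply: (sz_grid l_ge (a := 2)); apply: leq_trans (ltnW kK) Kc_le.
Qed.

Lemma cap_sz j k : k < Kc -> sz l 6 (cap1 m P sp grid j k).
Proof.
move=> kK; apply: (@sz_add l l_ge 5 0) => //; first exact: capacity_sz.
by apply: (@sz_poly l 0); case: (_ == _).
Qed.

Let Kc_gt0 : 0 < Kc. Proof. by rewrite muln_gt0; lia. Qed.
Let Y_Z : Y < Z. Proof. exact: (Y_lt_Z ZE). Qed.
Let n_Y : n <= Y. Proof. by apply: (@Yp 1) => //; rewrite expn1. Qed.
Let m_Y : m <= Y. Proof. by apply: (@Yp 1) => //; rewrite expn1. Qed.
Let g_Y : g <= Y. Proof. by apply: (@Yp 1) => //; rewrite expn1. Qed.
Lemma cap_prod_sz : sz l 10 (cap_prod n m Kc P sp grid).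
Proof.
apply: (@sz_prod l l_ge 6 3 10 _ (fun i => cap i) nK_le) => // i _.
by apply: cap_sz; rewrite ltn_mod.
Qed.

Lemma setup_caps_correct s : base_ctx s -> counts_ctx s ->
  (forall k, k <= KB.+1 -> s aTH k = grid k) ->
  [/\ den setup_caps s aTOP 0 = top_speed m sp,
      forall i, i < n * Kc -> den setup_caps s aCAP i = cap i &
      den setup_caps s aCP 0 = cap_prod n m Kc P sp grid].
Proof.
move=> bx cx thE; rewrite /setup_caps den_seq; set c1 := fold OMax _ _ _ _ _.
set s1 := den c1 s; rewrite den_seq; set c2 := For vA _ _; set s2 := den c2 s1.
set c3 := fold OMul _ _ _ _ _.
have fr1 a : a \notin assigned c1 -> s1 a = s a by apply: den_frame.
have fr2 a : a \notin assigned c2 -> s2 a = s1 a by apply: den_frame.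
have fr3 a : a \notin assigned c3 -> den c3 s2 a = s2 a by apply: den_frame.
have nkY : n * Kc <= Y by apply: (Yp nK_le).
have capE i : i < n * Kc -> s2 aCAP i = cap i.
  move: i; apply: table_spec => //.
  - by rewrite /= fr1 // (c_NK cx).
  - by move=> i _; apply: (@Zsz 6) => //; apply: cap_sz; rewrite ltn_mod.
  move=> i s' lt vi fr; set c := fold OAdd _ _ _ _ _.
  have frc a : a \notin assigned c -> den c s' a = s' a by apply: den_frame.
  have kK : i %% Kc < Kc by rewrite ltn_mod.
  have jn : i %/ Kc < n by rewrite ltn_divLR.
  have kKB : i %% Kc <= KB.+1 by apply: leq_trans (ltnW kK) (leqW Kc_KB).
  have accE : den c s' aACC 0 = \sum_(i0 < m) (P (i %/ Kc) <= sp i0 * grid (i %% Kc)) * sp i0.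
    apply: (sum_spec (f := fun i0 => (P (i %/ Kc) <= sp i0 * grid (i %% Kc)) * sp i0)) => //.
    + by move=> x /=; rewrite upd_other // fr // fr1 // (b_m bx).
    + by apply: (Zsz (speed_sum_sz (fun i0 => P (i %/ Kc) <= sp i0 * grid (i %% Kc)))).
    + move=> i0 s'' lt0 vi0 fr0; rewrite /= vi0 !fr0 // vi (fr aK) // (fr aP) // (fr aS) // (fr aTH) //.
      by rewrite !fr1 // (c_K cx) (b_P bx) // (b_s bx) // thE.
  rewrite /= accE !frc // vi (fr aK) // (fr aTH) // !fr1 // (c_K cx) thE //.
split.
- rewrite fr3 // fr2 // /s1 /c1; apply: max_spec => //.
  + by move=> x /=; rewrite upd_other // (b_m bx).
  + by apply: leq_ltn_trans Y_Z.
  + by move=> i im; apply: (Zsz (sp_sz im)).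
  + by move=> i s' lt vi fr; rewrite /= vi fr // (b_s bx).
- by move=> i lt; rewrite fr3 // capE.
- rewrite (@prod_spec Y Z _ _ _ _ _ (n * Kc) (fun i => cap i)) //.
  + by move=> x /=; rewrite upd_other // fr2 // fr1 // (c_NK cx).
  + by apply: (@Zp 0).
  + by move=> i _; apply: cap1_gt0.
  + exact: (Zsz cap_prod_sz).
  + by move=> i s' lt vi fr; rewrite /= vi fr // capE.
Qed.

Lemma setup_jobs_correct s : base_ctx s ->
  (forall j, j < n -> den setup_jobs s aNZ j = nz j) /\
  (forall j, j < n -> den setup_jobs s aRANK j = prank j).
Proof.
move=> bx; rewrite /setup_jobs den_seq; set c1 := fill _ _ _ _; set s1 := den c1 s.
set c2 := For _ _ _; have fr1 a : a \notin assigned c1 -> s1 a = s a by apply: den_frame.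
have fr2 a : a \notin assigned c2 -> den c2 s1 a = s1 a by apply: den_frame.
have bZ (b : bool) : b < Z by apply: (@Zp 0) => //; case: b.
have rZ j : prank j <= n.
  by rewrite -[X in _ <= X]card_ord -sum1_card leq_sum // => a _; case: (_ < _).
split=> j.
  rewrite fr2 //; move: j; apply: fill_spec => // [|i s' lt vi fr]; first by rewrite /= (b_n bx).
  by rewrite /= vi !fr // (b_P bx) // (b_r bx).
move: j; apply: table_spec => //.
- by rewrite /= fr1 // (b_n bx).
- by move=> i _; apply: leq_ltn_trans (rZ i) (leq_ltn_trans n_Y Y_Z).
move=> i s' lt vi fr; rewrite /=.
apply: (sum_spec (f := fun a => P i < P a)) => //.
- by move=> x /=; rewrite upd_other // fr // fr1 // (b_n bx).
- by apply: leq_ltn_trans (rZ i) (leq_ltn_trans n_Y Y_Z).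
- by move=> a s'' lta va fr'; rewrite /= va !fr' // vi (fr aP) // fr1 // !(b_P bx).
Qed.

Lemma setup_correct s : base_ctx s ->
  [/\ base_ctx (den (setup h) s), counts_ctx (den (setup h) s) & tables_ctx (den (setup h) s)].
Proof.
move=> bx; rewrite /setup den_seq; set c1 := setup_counts _; set s1 := den c1 s.
rewrite den_seq; set c2 := setup_grid; set s2 := den c2 s1.
rewrite den_seq; set c3 := setup_caps; set s3 := den c3 s2; set c4 := setup_jobs.
have fr1 a : a \notin assigned c1 -> s1 a = s a by apply: den_frame.
have fr2 a : a \notin assigned c2 -> s2 a = s1 a by apply: den_frame.
have fr3 a : a \notin assigned c3 -> s3 a = s2 a by apply: den_frame.
have fr4 a : a \notin assigned c4 -> den c4 s3 a = s3 a by apply: den_frame.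
have bx1 : base_ctx s1 by apply: base_ctx_eq bx; apply: in_frame.
have bx2 : base_ctx s2 by apply: base_ctx_eq bx1; apply: in_frame.
have bx3 : base_ctx s3 by apply: base_ctx_eq bx2; apply: in_frame.
have cx1 : counts_ctx s1 by apply: setup_counts_correct.
have cx2 : counts_ctx s2 by apply: counts_ctx_eq cx1; apply: in_frame.
have cx3 : counts_ctx s3 by apply: counts_ctx_eq cx2; apply: in_frame.
have th2 := setup_grid_correct cx1.
have [t3 c3E p3] := setup_caps_correct bx2 cx2 th2.
have [z4 r4] := setup_jobs_correct bx3.
split; [by apply: base_ctx_eq bx3; apply: in_frame|by apply: counts_ctx_eq cx3; apply: in_frame|].
split=> //.
- by move=> k kK; rewrite fr4 // fr3 //; apply: th2.
- by rewrite fr4.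
- by move=> i lt; rewrite fr4 //; apply: c3E.
- by rewrite fr4.
Qed.

Definition ready (s : store) : Prop := [/\ base_ctx s, counts_ctx s & tables_ctx s].

Lemma ready_eq s s' :
  {in [:: an; am; ag; rL; aP; aR; aS; aW; aINC] ++ [:: aK; aKB; aNBLK; aNV; aNK; aMP; aMC; aN; aIT]
     ++ [:: aTH; aTOP; aCAP; aCP; aNZ; aRANK], forall a, s' a = s a} ->
  ready s -> ready s'.
Proof.
move=> fr [bx cx tx]; split; [apply: base_ctx_eq bx|apply: counts_ctx_eq cx|apply: tables_ctx_eq tx];
  by move=> a ain; apply: fr; rewrite !mem_cat ain ?orbT.
Qed.

(** * The linear program built for one guess of the cost *)

Section Guess.

Variable q : nat.
Hypothesis q_lt : q < KB.
Local Notation Bd := (grid q.+1).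
Local Notation D := (lp_D n m Kc Bd P sp grid).
Local Notation A := (lp_A n m Kc Bd P r sp w grid).
Local Notation C := (lp_C n m Kc Bd P r sp w grid).
Local Notation L0 := (lp_L0 n Kc N P r inc).

Let Bd_gt0 : 0 < Bd.
Proof. by apply: leq_trans (grid1_ge q); rewrite time_unitE. Qed.

Lemma lp_D_sz : sz l 11 D.
Proof.
apply: (@sz_mul l l_ge 5 10) => //; last exact: cap_prod_sz.
by apply: (sz_grid l_ge (a := 3)); apply: leq_trans KB_le.
Qed.

Let A_le i e : A i e <= D.
Proof. by apply: lp_A_le; apply: grid_mono. Qed.

Lemma A_exp_correct s x : ready s -> s aBD 0 = Bd -> s aD 0 = D -> s vA 0 = x -> x < mp * nv ->
  hev s A_exp = A (x %/ nv) (x %% nv).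
Proof.
move=> [bx cx tx] bdE dE vx xlt.
have nv0 : 0 < nv by case: (nv) xlt; rewrite ?muln0.
have elt : x %% nv < nv by rewrite ltn_mod.
set e := x %% nv in elt *; set i := x %/ nv.
have alt : e %/ Kc < n + g by rewrite ltn_divLR.
have lK : e %% Kc < Kc by rewrite ltn_mod.
have ikK : i %% Kc < Kc by rewrite ltn_mod.
have th_l := t_TH tx (leq_trans (ltnW lK) (leqW Kc_KB)).
have th_l1 := t_TH tx (leq_trans lK (leqW Kc_KB)).
rewrite /= vx (c_NV cx) (c_K cx) (c_NK cx) (b_n bx) dE bdE (t_TOP tx) (t_CP tx) -/e -/i addn1 th_l th_l1 /lp_A.
rewrite !boolE [n * Kc <= i]leqNgt [n <= _]leqNgt.
have [ilt|ige] := ltnP i; rewrite /= ?mul0n ?mul1n ?addn0 ?add0n.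
  have ij : i %/ Kc < n by rewrite ltn_divLR.
  have [an|] := ltnP (e %/ Kc) n; rewrite ?mul0n //=.
  by rewrite !(b_P bx) // (b_r bx) // (t_CAP tx).
have [an|na] := ltnP (e %/ Kc) n; rewrite /= ?mul0n //.
by rewrite !(b_w bx) // ltn_subLR.
Qed.

Lemma C_exp_correct s x : ready s -> s aBD 0 = Bd -> s vA 0 = x -> x < mc * nv ->
  hev s C_exp = C (x %/ nv) (x %% nv).
Proof.
move=> [bx cx tx] bdE vx xlt.
have nv0 : 0 < nv by case: (nv) xlt; rewrite ?muln0.
have elt : x %% nv < nv by rewrite ltn_mod.
set e := x %% nv in elt *; set i := x %/ nv.
have alt : e %/ Kc < n + g by rewrite ltn_divLR.
have lK : e %% Kc < Kc by rewrite ltn_mod.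
have th_l := t_TH tx (leq_trans (ltnW lK) (leqW Kc_KB)).
have th_l1 := t_TH tx (leq_trans lK (leqW Kc_KB)).
rewrite /= vx (c_NV cx) (c_K cx) (b_n bx) bdE (t_TOP tx) -/e -/i addn1 th_l th_l1 /lp_C.
rewrite !boolE [n <= _]leqNgt.
have [an|na] := ltnP (e %/ Kc) n; rewrite /= ?mul0n ?mul1n ?addn0 ?add0n.
  by rewrite (b_P bx) // (b_r bx).
case: (_ =P _) => [<-|] //=; case: (_ =P _) => [<-|] //=.
by rewrite (b_w bx) ?ltn_subLR.
Qed.

Lemma setup_lp_correct s : ready s -> s vQ 0 = q ->
  solver_ctx mp mc nv N D It A C (den setup_lp s) /\
  forall i, i < mc -> den setup_lp s aCOV i = L0 i.
Proof.
move=> rd vq; have [bx cx tx] := rd; rewrite /setup_lp.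
have BdZ : Bd < Z by apply: (@Zsz 5) => //; apply: (sz_grid l_ge (a := 3)); apply: leq_trans KB_le.
have DZ : D < Z by apply: (Zsz lp_D_sz).
rewrite den_seq (@set_cell _ _ _ Bd) //=; last by rewrite vq addn1 (t_TH tx) // ltnW.
rewrite den_seq (@set_cell _ _ _ D) //=; last by rewrite [upd _ _ _ _ aCP _](t_CP tx).
set s0 := upd _ _ _ _; have rd0 : ready s0 by apply: ready_eq rd => a ain; rewrite /s0 !upd_other //; apply: contraTneq ain => ->.
have bd0 : s0 aBD 0 = Bd by rewrite /s0 upd_other // upd_same.
have d0 : s0 aD 0 = D by rewrite /s0 upd_same.
rewrite den_seq; set c1 := fill _ aA _ _; set s1 := den c1 s0.
rewrite den_seq; set c2 := fill _ aC _ _; set s2 := den c2 s1; set c3 := fill _ aCOV _ _.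
have fr1 a : a \notin assigned c1 -> s1 a = s0 a by apply: den_frame.
have fr2 a : a \notin assigned c2 -> s2 a = s1 a by apply: den_frame.
have fr3 a : a \notin assigned c3 -> den c3 s2 a = s2 a by apply: den_frame.
have rd1 : ready s1 by apply: ready_eq rd0; apply: in_frame.
have rd2 : ready s2 by apply: ready_eq rd1; apply: in_frame.
have [bx0 cx0 tx0] := rd0; have [bx1 cx1 tx1] := rd1; have [bx2 cx2 tx2] := rd2.
have A1 x : x < mp * nv -> s1 aA x = A (x %/ nv) (x %% nv).
  move: x; apply: fill_spec => //.
  - by rewrite /= (c_MP cx0) (c_NV cx0).
  - by apply: (@Yp 8) => //; apply: (le_expM l_ge mp_le nv_le).
  - by move=> x _; apply: leq_ltn_trans (A_le _ _) DZ.
  - move=> x s' lt vx fr; apply: A_exp_correct => //; rewrite ?fr //.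
    by apply: ready_eq rd0 => a ain; apply: fr; apply: contraTneq ain => ->.
have C2 x : x < mc * nv -> s2 aC x = C (x %/ nv) (x %% nv).
  move: x; apply: fill_spec => //.
  - by rewrite /= (c_MC cx1) (c_NV cx1).
  - by apply: (@Yp 8) => //; apply: (le_expM l_ge mc_le nv_le).
  - by move=> x _; apply: leq_ltn_trans (lp_C_le _ _ _ _ _ _ _ _ _ _ _) _; apply: (@Zp 0).
  - move=> x s' lt vx fr; apply: C_exp_correct => //; rewrite ?fr //.
      by apply: ready_eq rd1 => a ain; apply: fr; apply: contraTneq ain => ->.
    by rewrite fr1.
split.
  split; first by rewrite fr3 // (c_MP cx2).
  - by rewrite fr3 // (c_MC cx2).
  - by rewrite fr3 // (c_NV cx2).
  - by rewrite fr3 // (c_N cx2).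
  split; first by rewrite fr3 // fr2 // fr1.
  - by rewrite fr3 // (c_IT cx2).
  - move=> i e lti lte; rewrite fr3 // fr2 // A1 ?divn_block ?modn_block //.
    exact: block_lt.
  - move=> i e lti lte; rewrite fr3 // C2 ?divn_block ?modn_block //.
    exact: block_lt.
apply: fill_spec => //.
- by rewrite /= (c_MC cx2).
- exact: Yp mc_le isT.
- by move=> i _; rewrite /lp_L0; case: ifP => _; apply: (@Zp 6) => //; apply: N_le.
move=> i s' lt vi fr; rewrite /= vi !fr // (c_K cx2) (c_N cx2) (b_n bx2).
have n0 : 0 < n by case: (n) lt => //; rewrite muln0.
have jn : (i %/ Kc) %% n < n by rewrite ltn_mod.
have Sg : (i %/ Kc) %/ n < g by rewrite !ltn_divLR // mulnAC.
rewrite {1}(divn_eq (i %/ Kc) n) (b_inc bx2) // (t_NZ tx2) // !boolE /lp_L0.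
by case: (_ && _); rewrite ?muln0 ?muln1.
Qed.

End Guess.

(* Blocks stay below the cap, which only serves to make all times bounded. *)
Definition capped_grid (b : nat) : nat := grid (minn b (Kc + h)).

Definition block_of (hist : seq nat) (i o j : nat) : nat :=
  nz j * next_block h o (kappa Kc N nz (frac Kc hist) i.+1 j).

Definition outcome (blk mc st cp : nat -> nat) : Prop :=
  exists ld T bs, reach reset n m P r sp capped_grid blk prank (Kc + h).-1 (n * n) ld mc st cp T bs.

Definition total_cost (cp : nat -> nat) : nat :=
  \sum_(S < g) w S * \max_(j < n) inc S j * cp j.

Lemma next_block_le o k : next_block h o k <= k + h.-1.
Proof. by rewrite leq_add2l -ltnS prednK // ltn_mod. Qed.

Lemma block_of_le hist i o j : block_of hist i o j <= (Kc + h).-1.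
Proof.
rewrite /block_of; case: (nz j); rewrite ?mul0n // mul1n.
apply: leq_trans (next_block_le _ _) _.
by rewrite -[h in X in _ <= X](prednK h_gt0) addnS leq_add2r; apply: kappa_le.
Qed.

Lemma set_blocks_correct s hist i o : ready s -> size hist <= It -> i < 39 -> o < h ->
  s vTHR 0 = i -> s vOFF 0 = o -> (forall e, e < nv -> s aV e = count_mem e hist) ->
  forall j, j < n -> den (set_blocks h) s aBLK j = block_of hist i o j.
Proof.
move=> [bx cx tx] szh i39 oh thr off vE; apply: table_spec => //.
- by rewrite /= (b_n bx).
- move=> j _; apply: leq_ltn_trans (block_of_le _ _ _ _) _; apply: (@Zp 3) => //.
  apply: leq_trans (leq_pred _) _; apply: (le_expD l_ge (a := 2) (b := 1)) => //.
  by rewrite expn1; lia.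
move=> j s' lt vj fr; set c := (_ ;; _)%C.
have frc a : a \notin assigned c -> den c s' a = s' a by apply: den_frame.
suff kapE : den c s' aKAP 0 = \sum_(k < Kc) (40 * frac Kc hist j k < i.+1 * N).
  rewrite /= kapE !frc // vj (fr aNZ) // (fr vOFF) // off (t_NZ tx) // /block_of /next_block /kappa.
  by case: (nz j); rewrite ?mul0n.
rewrite /c den_seq den_set; set s1 := upd s' _ _ _; rewrite den_seq den_set.
set s2 := upd s1 _ _ _; set b := (_ ;; _)%C.
pose acc k := \sum_(l < k) count_mem (j * Kc + l) hist.
pose I k (s' : store) := s' aACC 0 = acc k /\ s' aKAP 0 = \sum_(l < k) (40 * acc l.+1 < i.+1 * N).
have K2 : s2 aK 0 = Kc by rewrite /s2 /s1 !upd_other // fr // (c_K cx).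
suff [//] : I (hev s2 (#aK)%H) (den (For vK (#aK)%H b) s2).
  by rewrite /= K2.
have z0 : clamp Z (K 0) 0 = 0 by rewrite clamp_safe.
apply: for_rule => //=.
- by rewrite K2; apply: Yp Kc_le isT.
- by rewrite /I /acc !big_ord0.
- rewrite K2 => k t ltk vk frt [accE kapE].
have step : s2 aV (j * Kc + k) = count_mem (j * Kc + k) hist.
  rewrite /s2 /s1 !upd_other // fr // vE //; apply: block_lt => //; exact: ltn_addr.
have accS : acc k.+1 = acc k + count_mem (j * Kc + k) hist by rewrite /acc big_ord_recr.
have accZ : acc k.+1 < Z.
  apply: (@Zp 12) => //; apply: (@leq_trans (\sum_(l < k.+1) It)).
    by apply: leq_sum => k0 _; apply: leq_trans (count_size _ _) szh.
  rewrite sum_nat_const card_ord; apply: (le_expM l_ge (a := 2) (b := 10)) => //; last exact: It_le.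
have fr2 a : a \notin [:: vA; aBLK; aACC; aKAP; vK] -> t a = s a.
  rewrite !inE !negb_or => /and5P[a1 a2 a3 a4 a5].
  by rewrite frt ?inE ?negb_or ?a3 ?a4 // /s2 /s1 !upd_other // fr // !inE !negb_or a3 a4 a5.
have vj' : t vA 0 = j by rewrite frt // /s2 /s1 !upd_other.
rewrite /b den_seq; set t1 := den (Set_ aACC _ _) t.
have t1acc : t1 aACC 0 = acc k.+1.
  by rewrite /t1 den_set upd_same /= accE vj' vk !fr2 // (c_K cx) vE ?clamp_id -?accS //;
    apply: block_lt => //; apply: ltn_addr.
split; first by rewrite den_set !upd_other.
rewrite upd_other // den_set upd_same /= t1acc /t1 !(@den_frame Y Z _ t) // kapE !fr2 // thr (c_N cx) addn1.
rewrite clamp_id ?big_ord_recr //; apply: (@Zp 2) => //; apply: leq_trans Kc_le.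
apply: leq_trans ltk; rewrite -[k.+1]addn1 leq_add //; last by case: (_ < _).
apply: (@leq_trans (\sum_(l0 < k) 1)); first by apply: leq_sum => k0 _; case: (_ < _).
by rewrite sum1_card card_ord.
Qed.

Definition horizon : nat := grid (Kc + h) + \sum_(j < n) r j.

Lemma Kch_le : Kc + h <= l ^ 3.
Proof. by apply: (le_expD l_ge (a := 2) (b := 1)) => //; rewrite expn1; lia. Qed.

Lemma sum_P_sz : sz l 3 (\sum_(j < n) P j).
Proof. by apply: (@sz_sum l l_ge 2 1) => //; rewrite expn1. Qed.

Lemma horizon_sz : sz l 6 horizon.
Proof.
apply: (@sz_add l l_ge 5 3) => //; first exact: (sz_grid l_ge Kch_le).
by apply: (@sz_sum l l_ge 2 1) => //; rewrite expn1.
Qed.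

Lemma capped_grid_le b : capped_grid b <= horizon.
Proof. by apply: leq_trans (leq_addr _ _); apply: (th_le grid_mono); apply: geq_minr. Qed.

Lemma release_le j : j < n -> r j <= horizon.
Proof. by move=> jn; apply: leq_trans (leq_addl _ _); rewrite (bigD1 (Ordinal jn)) //= leq_addr. Qed.

Lemma prank_lt j : j < n -> prank j < n.
Proof.
move=> jn; rewrite /prank (bigD1 (Ordinal jn)) //= ltnn add0n.
have nE : \sum_(a < n) 1 = n by rewrite sum1_card card_ord.
rewrite -[X in _ < X]nE [X in _ < X](bigD1 (Ordinal jn)) //= add1n ltnS.
by apply: leq_sum => a _; case: (_ < _).
Qed.

Lemma all_done hist i o a : a < n -> done n (block_of hist i o) prank (Kc + h).-1 (n * n) a.
Proof.
move=> an; rewrite /done; have := block_of_le hist i o a.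
rewrite leq_eqVlt => /orP[/eqP->|->] //; rewrite eqxx ikey_lt ?orbT //; exact: prank_lt.
Qed.

Hypothesis m_gt0 : 0 < m.

Lemma outcome_feasible hist i o mc st cp : outcome (block_of hist i o) mc st cp ->
  [/\ forall a, a < n -> [/\ r a <= st a, cp a = st a + P a %/ sp (mc a), mc a < m &
        cp a <= horizon + \sum_(j < n) P j] &
      forall a a', a < n -> a' < n -> a != a' -> mc a = mc a' -> cp a <= st a' \/ cp a' <= st a].
Proof.
case=> ld [T [bs rc]]; have dn := all_done hist i o.
have [f1 f2 f3 f4 f5] := reach_feasible prank_lt capped_grid_le release_le rc.
split=> [a an|a a' an an' aa'].
  have [h1 h2 h3 h4] := f1 a an (dn a an); split=> //.
  apply: leq_trans h4 _; apply: leq_trans (f3 _ h3) _; apply: leq_trans f4 _.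
  by rewrite leq_add2l [X in _ <= X](bigID (fun a0 : 'I_n => done n (block_of hist i o) prank (Kc + h).-1 (n * n) a0)) leq_addr.
by apply: f2 => //; apply: dn.
Qed.

Lemma place_outcome s hist i o : ready s -> (forall j, j < n -> s aBLK j = block_of hist i o j) ->
  outcome (block_of hist i o) (den (place reset) s aMACH) (den (place reset) s aSTART)
    (den (place reset) s aCOMP).
Proof.
move=> [bx cx tx] blkE.
have nbY : Kc + h <= Y by apply: Yp Kch_le isT.
have HZ : horizon + \sum_(j < n) P j < Z.
  by apply: (@Zsz 7) => //; apply: (@sz_add l l_ge 6 3) => //; [exact: horizon_sz|exact: sum_P_sz].
have nb0 : 0 < Kc + h by rewrite addn_gt0 h_gt0 orbT.
have fin := @place_correct Y Z reset n m (Kc + h) horizon P r sp capped_grid (block_of hist i o) prank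
  n_Y m_Y nbY Y_Z (fun _ _ => m_gt0) prank_lt capped_grid_le release_le HZ s nb0.
do 2!eexists; eexists; apply: fin.
split; [exact: b_n bx|exact: b_m bx|exact: c_NBLK cx| |].
  move=> b bl; rewrite /capped_grid (minn_idPl (ltnW bl)) (t_TH tx) //.
  apply: leq_trans (ltnW bl) _; apply: leqW; apply: (@leq_trans (Kc + Kc)); first by rewrite leq_add2l; apply: (@leq_trans l); [lia|rewrite leq_pmulr //; lia].
  by rewrite addnn -mul2n leq_mul2r; apply/orP; right; lia.
split; [exact: b_P bx|exact: b_r bx|exact: t_RANK tx|exact: blkE|exact: b_s bx].
Qed.

Lemma set_cost_correct s : ready s -> (forall a, a < n -> s aCOMP a <= horizon + \sum_(j < n) P j) ->
  den set_cost s aCOST 0 = total_cost (s aCOMP).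
Proof.
move=> [bx cx tx] cpZ; rewrite /set_cost den_seq den_set; set s1 := upd _ _ _ _.
set c := For _ _ _; pose mx S := \max_(j < n) inc S j * s aCOMP j.
pose I k (s' : store) := s' aCOST 0 = \sum_(S < k) w S * mx S.
have gE : hev s1 (#ag)%H = g by rewrite /= /s1 upd_other // (b_g bx).
have mx_le S : mx S <= horizon + \sum_(j < n) P j.
  apply/bigmax_leqP => j _; case: (inc S j); rewrite ?mul0n // mul1n; exact: cpZ.
have mxs S : sz l 7 (mx S).
  apply: sz_le (mx_le S) _; apply: (@sz_add l l_ge 6 3) => //; [exact: horizon_sz|exact: sum_P_sz].
have sums k : k <= g -> sz l 9 (\sum_(S < k) w S * mx S).
  move=> kg; apply: (@sz_sum l l_ge 8 1 9 k (fun S => w S * mx S)) => // [|S Sk].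
    by rewrite expn1; apply: leq_trans kg g_le.
  apply: (@sz_mul l l_ge 2 7) => //; apply: w_sz; exact: leq_trans Sk kg.
suff : I (hev s1 (#ag)%H) (den c s1) by rewrite gE.
apply: for_rule; rewrite ?gE //; first by rewrite /I big_ord0.
move=> S t ltS vS fr; rewrite /I => costE.
have fr' a : a \notin [:: vG; aCOST; aCM; vA] -> t a = s a.
  rewrite !inE !negb_or => /and4P[a1 a2 a3 a4].
  by rewrite fr ?inE ?negb_or ?a2 ?a3 ?a4 // /s1 upd_other.
rewrite upd_other // den_seq; set c1 := fold _ _ _ _ _ _.
have fr1 a : a \notin assigned c1 -> den c1 t a = t a by apply: den_frame.
have mxE : den c1 t aCM 0 = mx S.
  apply: (max_spec (f := fun j => inc S j * s aCOMP j)) => //.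
  - by move=> x /=; rewrite upd_other // fr' // (b_n bx).
  - by apply: leq_ltn_trans Y_Z.
  - move=> j jn; case: (inc S j); rewrite ?mul0n ?mul1n; first last.
      by apply: leq_ltn_trans Y_Z.
    by apply: leq_ltn_trans (cpZ j jn) _; apply: (@Zsz 7) => //; apply: (@sz_add l l_ge 6 3) => //;
      [exact: horizon_sz|exact: sum_P_sz].
  - by move=> j t' jn vj fr0; rewrite /= vj !fr0 // vS !fr' // (b_n bx) (b_inc bx).
rewrite den_set upd_same /= mxE !fr1 // costE vS fr' // (b_w bx) //.
by have := Zsz (sums _ ltS) isT; rewrite big_ord_recr /= => lt; rewrite clamp_id.
Qed.

(** * The best schedule found so far *)

Definition tried (hist : seq nat) (i o b : nat) : Prop :=
  exists mc st cp, outcome (block_of hist i o) mc st cp /\ b <= total_cost cp.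

Definition achieved (s : store) : Prop :=
  exists hist i o mc st cp, [/\ outcome (block_of hist i o) mc st cp,
    forall j, j < n -> s aBM j = mc j, forall j, j < n -> s aBST j = st j &
    s aBEST 0 = total_cost cp].

(** Before the first schedule is kept, [aBEST] is arbitrary, so the collected property [Q] is
    required of all numbers. Afterwards it holds of [aBEST]; being closed downwards, it survives
    every improvement. *)
Definition best_so_far (Q : nat -> Prop) (s : store) : Prop :=
  (s aHAS 0 = 0 /\ forall b, Q b) \/ [/\ s aHAS 0 = 1, achieved s & Q (s aBEST 0)].

Definition down (Q : nat -> Prop) : Prop := forall b b', b' <= b -> Q b -> Q b'.

Lemma tried_down hist i o : down (tried hist i o).
Proof. by move=> b b' bb' [mc [st [cp [oc le]]]]; exists mc, st, cp; split=> //; apply: leq_trans le. Qed.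

Lemma best_weak (Q Q' : nat -> Prop) s : (forall b, Q b -> Q' b) -> best_so_far Q s -> best_so_far Q' s.
Proof. by move=> QQ' [[h0 q0]|[h0 ac q0]]; [left|right]; split; auto. Qed.

Lemma keep_best_correct Q s hist i o : down Q -> ready s ->
  outcome (block_of hist i o) (s aMACH) (s aSTART) (s aCOMP) ->
  s aCOST 0 = total_cost (s aCOMP) -> best_so_far Q s ->
  best_so_far (fun b => Q b /\ tried hist i o b) (den keep_best s).
Proof.
move=> dQ [bx cx tx] oc costE bs; rewrite /keep_best den_if /= !boolE.
have [f1 _] := outcome_feasible oc.
case: ifP => [better|/norP[has worse]]; last first.
  rewrite den_nop; case: bs => [[h0]|[h1 ac qb]]; first by rewrite h0 in has.
  right; split=> //; split=> //; exists (s aMACH), (s aSTART), (s aCOMP); split=> //.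
  by rewrite -costE leqNgt.
have cpZ : horizon + \sum_(j < n) P j < Z.
  by apply: (@Zsz 7) => //; apply: (@sz_add l l_ge 6 3) => //; [exact: horizon_sz|exact: sum_P_sz].
have bE : s aCOST 0 < Z.
  rewrite costE; apply: (@Zsz 9) => //.
  apply: (@sz_sum l l_ge 8 1 9 g (fun S => w S * \max_(j < n) inc S j * s aCOMP j)) => // S Sg.
  apply: (@sz_mul l l_ge 2 7) => //; first exact: w_sz.
  apply: (@sz_le _ _ _ (horizon + \sum_(j < n) P j)); last first.
    by apply: (@sz_add l l_ge 6 3) => //; [exact: horizon_sz|exact: sum_P_sz].
  by apply/bigmax_leqP => j _; case: (inc S j); rewrite ?mul0n // mul1n; case: (f1 j).
rewrite den_seq (@set_cell aHAS _ _ 1) //; last by apply: (@Zp 0).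
set s1 := upd s _ _ _; rewrite den_seq (@set_cell aBEST _ _ (s aCOST 0)) //.
set s2 := upd s1 _ _ _; rewrite den_seq; set c3 := fill _ aBM _ _; set s3 := den c3 s2.
have s2E a : a \notin [:: aHAS; aBEST] -> s2 a = s a.
  by rewrite !inE negb_or => /andP[a1 a2]; rewrite /s2 /s1 !upd_other.
set c4 := fill _ _ _ _.
have fr3 a : a \notin assigned c3 -> s3 a = s2 a by apply: den_frame.
have fr4 a : a \notin assigned c4 -> den c4 s3 a = s3 a by apply: den_frame.
have bm j : j < n -> s3 aBM j = s aMACH j.
  move: j; apply: fill_spec => //; first by rewrite /= s2E // (b_n bx).
    by move=> j jn; have [_ _ lt _] := f1 j jn; apply: leq_trans lt _; apply: ltnW; apply: leq_ltn_trans Y_Z.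
  by move=> j s' jn vj fr; rewrite /= vj fr // s2E.
have bst j : j < n -> den c4 s3 aBST j = s aSTART j.
  move: j; apply: fill_spec => //; first by rewrite /= fr3 // s2E // (b_n bx).
    move=> j jn; have [_ cE _ le] := f1 j jn; apply: leq_ltn_trans cpZ; apply: leq_trans le.
    by rewrite cE leq_addr.
  by move=> j s' jn vj fr; rewrite /= vj fr // fr3 // s2E.
have best4 : den c4 s3 aBEST 0 = s aCOST 0 by rewrite fr4 // fr3 // /s2 upd_same.
right; split; first by rewrite fr4 // fr3.
- exists hist, i, o, (s aMACH), (s aSTART), (s aCOMP); split=> //.
  + by move=> j jn; rewrite fr4 // bm.
  + by rewrite best4.
- rewrite best4; split; last by exists (s aMACH), (s aSTART), (s aCOMP); rewrite costE.
  case: bs => [[h0 //]|[h1 ac qb]]; apply: dQ qb; move: better; rewrite h1 /=.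
  exact: ltnW.
Qed.

Definition counts (hist : seq nat) (s : store) : Prop := forall e, e < nv -> s aV e = count_mem e hist.

Lemma attempt_correct Q s hist i o : down Q -> ready s -> size hist <= It -> counts hist s ->
  i < 39 -> o < h -> s vTHR 0 = i -> s vOFF 0 = o -> best_so_far Q s ->
  best_so_far (fun b => Q b /\ tried hist i o b) (den (attempt h reset) s).
Proof.
move=> dQ rd szh ct i39 oh thr off bs; rewrite /attempt.
rewrite den_seq; set c1 := set_blocks h; set s1 := den c1 s.
rewrite den_seq; set c2 := place reset; set s2 := den c2 s1.
rewrite den_seq; set c3 := set_cost; set s3 := den c3 s2.
have rd1 : ready s1 by apply: ready_eq rd; apply: in_frame.
have rd2 : ready s2 by apply: ready_eq rd1; apply: in_frame; rewrite /c2; case: (reset).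
have rd3 : ready s3 by apply: ready_eq rd2; apply: in_frame.
have oc := place_outcome rd1 (set_blocks_correct rd szh i39 oh thr off ct).
have [f1 _] := outcome_feasible oc.
have fr3 a : a \notin assigned c3 -> s3 a = s2 a by apply: den_frame.
apply: keep_best_correct => //.
- by rewrite !fr3.
- rewrite (fr3 aCOMP) //; apply: set_cost_correct => // a an; by case: (f1 a an).
- have eqs : {in [:: aHAS; aBM; aBST; aBEST], forall a, s3 a = s a}.
    move=> a ain; have -> : s3 a = s2 a by move: a ain; apply: in_frame.
    have -> : s2 a = s1 a by move: a ain; apply: in_frame; rewrite /c2; case: (reset).
    by move: a ain; apply: in_frame.
  by rewrite /best_so_far /achieved !eqs.
Qed.

Lemma loop_frame (v : nat) c (s s' : store) (L : seq nat) : all (fun a => (a != v) && (a \notin assigned c)) L ->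
  (forall a, a != v -> a \notin assigned c -> s' a = s a) -> {in L, forall a, s' a = s a}.
Proof. by move=> /allP ac fr a /ac/andP[]; apply: fr. Qed.

(** Full coverage is asserted only if some set of columns covers all open rows. The program never
    tests a guess: too small a guess still leads to a feasible schedule, merely without a
    guarantee. *)
Definition solved (q : nat) (hist : seq nat) : Prop :=
  let D := lp_D n m Kc (grid q.+1) P sp grid in
  let A := lp_A n m Kc (grid q.+1) P r sp w grid in
  let C := lp_C n m Kc (grid q.+1) P r sp w grid in
  let L0 := lp_L0 n Kc N P r inc in
  run mp mc nv N D A C L0 hist /\
  forall E : pred nat, (forall r, r < mc -> L0 r < N -> 0 < \sum_(e < nv | E e) C r e) ->
    forall r, r < mc -> coverage N C L0 hist r = N.

Definition explored (q b : nat) : Prop :=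
  exists2 hist, solved q hist & forall i o, i < 39 -> o < h -> tried hist i o b.

Lemma explored_down q : down (explored q).
Proof.
by move=> b b' bb' [hist sv tr]; exists hist => // i o i39 oh; apply: tried_down bb' (tr i o i39 oh).
Qed.

Definition below (Q : nat -> Prop) (p : nat -> nat -> Prop) (k b : nat) : Prop :=
  Q b /\ forall i, i < k -> p i b.

Lemma down_below Q p k : down Q -> (forall i, down (p i)) -> down (below Q p k).
Proof. by move=> dQ dp b b' bb' [qb pb]; split=> [|i ik]; [apply: dQ qb|apply: dp (pb i ik)]. Qed.

Lemma best_eq Q s s' : {in [:: aHAS; aBM; aBST; aBEST], forall a, s' a = s a} ->
  best_so_far Q s -> best_so_far Q s'.
Proof. by move=> eqs; rewrite /best_so_far /achieved !eqs. Qed.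

Lemma best_upd Q s v i x : v \notin [:: aHAS; aBM; aBST; aBEST] ->
  best_so_far Q s -> best_so_far Q (upd s v i x).
Proof.
by move=> vn; apply: best_eq => a ain; rewrite upd_other //; apply: contraNneq vn => <-.
Qed.

Lemma offsets_correct Q s hist i : down Q -> ready s -> size hist <= It -> counts hist s ->
  i < 39 -> s vTHR 0 = i -> best_so_far Q s ->
  best_so_far (below Q (tried hist i) h) (den (For vOFF (K h) (attempt h reset)) s).
Proof.
move=> dQ rd szh ct i39 thr bs.
have := @for_rule Y Z (fun k => best_so_far (below Q (tried hist i) k)) vOFF (K h) (attempt h reset) s.
have vn : vOFF \notin assigned (attempt h reset) by rewrite /attempt; case: (reset).
apply=> //=; first by apply: leq_trans h_le _; apply: (@Yp 1) => //; rewrite expn1; lia.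
  by apply: best_weak bs => b qb; split.
move=> o s' oh vo fr bs'.
have fr' a : all (fun a => (a != vOFF) && (a \notin assigned (attempt h reset))) [:: a] -> s' a = s a.
  by rewrite /= andbT => /andP[]; apply: fr.
have rd' : ready s'.
  by apply: ready_eq rd; apply: (loop_frame (v := vOFF) (c := attempt h reset)) fr; rewrite /attempt; case: (reset).
have ct' : counts hist s' by move=> e lt; rewrite fr' ?ct // /attempt; case: (reset).
have thr' : s' vTHR 0 = i by rewrite fr' // /attempt; case: (reset).
have dQ' : down (below Q (tried hist i) o) by apply: down_below => // o'; apply: tried_down.
have := attempt_correct dQ' rd' szh ct' i39 oh thr' vo bs'.
set s'' := den _ s' => bs''; apply: best_upd => //.
apply: best_weak bs'' => b [[qb pb] pi]; split=> // o'; rewrite ltnS leq_eqVlt => /orP[/eqP->//|]; exact: pb.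
Qed.

Lemma thresholds_correct Q s hist : down Q -> ready s -> size hist <= It -> counts hist s ->
  best_so_far Q s ->
  best_so_far (below Q (fun i b => forall o, o < h -> tried hist i o b) 39)
    (den (For vTHR (K 39) (For vOFF (K h) (attempt h reset))) s).
Proof.
move=> dQ rd szh ct bs; set c := For vOFF _ _; set p := (fun i b => _).
have dp i : down (p i) by move=> b b' bb' pb o oh; apply: tried_down bb' (pb o oh).
have := @for_rule Y Z (fun k => best_so_far (below Q p k)) vTHR (K 39) c s.
have vn : vTHR \notin assigned c by rewrite /c /attempt; case: (reset).
apply=> //=; first by apply: (@Yp 1) => //; rewrite expn1; lia.
  by apply: best_weak bs => b qb; split.
move=> i s' i39 vi fr bs'.
have rd' : ready s'.
  by apply: ready_eq rd; apply: (loop_frame (v := vTHR) (c := c)) fr; rewrite /c /attempt; case: (reset).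
have ct' : counts hist s' by move=> e lt; rewrite fr ?ct // /c /attempt; case: (reset).
have dQ' : down (below Q p i) by apply: down_below.
have := offsets_correct dQ' rd' szh ct' i39 vi bs'.
set s'' := den _ s' => bs''; apply: best_upd => //.
apply: best_weak bs'' => b [[qb pb] pi]; split=> // i'; rewrite ltnS leq_eqVlt => /orP[/eqP->//|]; exact: pb.
Qed.

Lemma guess_correct Q s q : down Q -> ready s -> q < KB -> s vQ 0 = q -> best_so_far Q s ->
  best_so_far (fun b => Q b /\ explored q b) (den (guess h reset) s).
Proof.
move=> dQ rd qK vq bs; rewrite /guess den_seq; set s1 := den setup_lp s.
rewrite den_seq; set s2 := den solver s1.
have rd1 : ready s1 by apply: ready_eq rd; apply: in_frame.
have rd2 : ready s2 by apply: ready_eq rd1; apply: in_frame.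
have bs2 : best_so_far Q s2.
  by apply: best_eq (best_eq _ bs); apply: in_frame.
have [sx cov] := setup_lp_correct qK rd vq.
have Dsz := lp_D_sz qK.
have D0 : 0 < lp_D n m Kc (grid q.+1) P sp grid.
  by apply: lp_D_gt0; apply: leq_trans (grid1_ge q); rewrite time_unitE.
have D41 : sz l 13 (41 * lp_D n m Kc (grid q.+1) P sp grid).
  by apply: (@sz_mul l l_ge 1 11) => //; apply: sz_poly; rewrite expn1; lia.
have Dp : sz l 24 ((41 * lp_D n m Kc (grid q.+1) P sp grid) ^ It).
  by apply: (@sz_exp l l_ge 13 10) => //; apply: It_le.
have mpZ : mp * ((41 * lp_D n m Kc (grid q.+1) P sp grid) ^ It * lp_D n m Kc (grid q.+1) P sp grid) < Z.
  apply: (@Zsz 26) => //; apply: (@sz_mul l l_ge 4 25) => //; first by apply: sz_poly; apply: mp_le.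
  exact: (@sz_mul l l_ge 24 11).
have c40 : sz l 8 (40 ^ N).
  by apply: (@sz_exp l l_ge 1 6) => //; [apply: sz_poly; rewrite expn1; lia|apply: N_le].
have mcZ : mc * 40 ^ N < Z.
  by apply: (@Zsz 9) => //; apply: (@sz_mul l l_ge 4 8) => //; apply: sz_poly; apply: mc_le.
have L0N rr : lp_L0 n Kc N P r inc rr = 0 \/ lp_L0 n Kc N P r inc rr = N.
  by rewrite /lp_L0; case: ifP; auto.
have [hist [rn szh st hl]] := solver_correct D0 (lp_A_le n m Kc (grid q.+1) P r sp w grid_mono)
  (lp_C_le n m Kc (grid q.+1) P r sp w grid) (Yp mp_le isT) (Yp mc_le isT) (Yp nv_le isT)
  (Yp N_le isT) (Yp It_le isT) Y_Z mpZ (Zsz Dp isT) mcZ (Zsz c40 isT) L0N sx cov.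
case: st => _ _ _ vE.
have := thresholds_correct dQ rd2 szh vE bs2; apply: best_weak => b [qb tr]; split=> //.
exists hist; [split=> // E Ec r0 r0mc|by move=> i o i39 oh; apply: tr].
exact: (all_covered D0 (Yp mp_le isT) (Yp mc_le isT) (Yp nv_le isT)
  (Yp N_le isT) (Yp It_le isT) Y_Z mpZ (Zsz Dp isT) mcZ (Zsz c40 isT) (erefl It) Ec rn hl).
Qed.

Lemma core_correct s : base_ctx s ->
  [/\ base_ctx (den (core h reset) s), achieved (den (core h reset) s) &
   forall q, q < KB -> explored q (den (core h reset) s aBEST 0)].
Proof.
move=> bx; rewrite /core den_seq; set s1 := den (setup h) s.
have rd1 : ready s1 by have [*] := setup_correct bx.
rewrite den_seq (@set_cell aHAS _ _ 0) //; last by apply: leq_ltn_trans Y_Z.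
set s2 := upd s1 _ _ _; set c := guess h reset.
have rd2 : ready s2.
  by apply: ready_eq rd1 => a ain; rewrite /s2 upd_other //; apply: contraTneq ain => ->.
have KE : hev s2 (#aKB)%H = KB by have [_ cx _] := rd2; apply: c_KB cx.
pose I k (s' : store) := ready s' /\ best_so_far (below (fun=> True) explored k) s'.
have vn : vQ \notin assigned c by rewrite /c /guess /attempt; case: (reset).
suff : I KB (den (For vQ (#aKB) c) s2).
  case=> [[bx' _ _]] [[_ no]|[_ ac [_ ex]]]; last by split.
  have KB0 : 0 < KB by apply: leq_trans Kc_gt0 Kc_KB.
  (* Had no schedule been kept, [explored] would hold of every number, also of one that exceeds the
     cost of all outcomes. *)
  have [_ ex] := no (\sum_(S < g) w S * (horizon + \sum_(j < n) P j)).+1.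
  have [hist _ tr] := ex 0 KB0.
  have [mc' [st [cp [oc]]]] := tr 0 0 isT h_gt0; rewrite ltnNge => /negP[].
  have [f1 _] := outcome_feasible oc.
  apply: leq_sum => S _; rewrite leq_mul2l; apply/orP; right; apply/bigmax_leqP => j _.
  by case: (inc S j); rewrite ?mul0n // mul1n; case: (f1 j).
rewrite -{1}KE; apply: for_rule => //; rewrite KE.
- exact: Yp KB_le isT.
- split; last by left; split.
  by apply: ready_eq rd2 => a ain; rewrite !upd_other //; apply: contraTneq ain => ->.
move=> q s' qK vq fr [rd' bs'].
have dQ : down (below (fun=> True) explored q) by apply: down_below => // q'; apply: explored_down.
have := guess_correct dQ rd' qK vq bs'; set s'' := den _ s' => bs''; split.
  apply: ready_eq rd' => a ain; rewrite upd_other; last by apply: contraTneq ain => ->.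
  by move: a ain; apply: in_frame; rewrite /c /guess /attempt; case: (reset).
apply: best_upd => //.
apply: best_weak bs'' => b [[qb pb] pi]; split=> // q'; rewrite ltnS leq_eqVlt => /orP[/eqP->//|]; exact: pb.
Qed.

End Core.

(** * Quality of the best schedule *)

(** Both values are congruent to [o] modulo [h]. Were they out of order, they would differ by at
    least [h], whereas the value at [k] is less than [k + h]. *)
Lemma next_block_mono h o k k' : 0 < h -> k <= k' -> next_block h o k <= next_block h o k'.
Proof.
move=> h0 kk'; rewrite leqNgt; apply/negP => lt.
have eqm : next_block h o k = next_block h o k' %[mod h] by rewrite !next_block_congr.
have dv : h %| next_block h o k - next_block h o k'.
  by rewrite -eqn_mod_dvd ?eqm // ltnW.
have hle : h <= next_block h o k - next_block h o k' by rewrite dvdn_leq // subn_gt0.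
have : next_block h o k <= k + h.-1 by rewrite leq_add2l -ltnS prednK // ltn_mod.
have : k' <= next_block h o k' by rewrite leq_addr.
lia.
Qed.

(* The threshold [(i+1)/40] is chosen with a weight inverse to the loss it causes. *)
Definition reset_weight (i : nat) : nat := (1000 * i.+1) %/ (i.+1 + 42).
Definition same_weight (i : nat) : nat := (1000 * i.+1) %/ (i.+1 + (i.+1 + 42)).

Lemma sum_reset_weight : 116 * 100 <= \sum_(i < 39) reset_weight i.
Proof. by rewrite -(big_mkord xpredT) unlock; vm_compute. Qed.

Lemma sum_same_weight : 86 * 100 <= \sum_(i < 39) same_weight i.
Proof. by rewrite -(big_mkord xpredT) unlock; vm_compute. Qed.

Lemma weight_le a d c b e : 0 < d -> a * (1000 * c) <= d * (e * b) -> (1000 * a) %/ d * c <= e * b.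
Proof.
move=> d0 h; rewrite -(leq_pmul2l d0); apply: leq_trans h.
by rewrite mulnA mulnCA -mulnA mulnC -!mulnA; have := leq_divM (1000 * a) d; nia.
Qed.

Section Quality.

Variables (l n m g h : nat) (reset : bool) (P r sp w : nat -> nat) (inc : nat -> nat -> bool).
Local Notation Kc := (l * l).
Local Notation KB := (l * (l * l)).
Local Notation nv := ((n + g) * Kc).
Local Notation mp := (n * Kc).+1.
Local Notation mc := (g * n * Kc).
Local Notation N := (1200 * (mp + mc).+1).
Local Notation nz := (nontrivial P r).
Local Notation blocks_of := (block_of l n g h P r).
Local Notation outcome := (outcome l n m h reset P r sp).
Local Notation solved := (solved l n m g P r sp w inc).
Local Notation cgrid := (capped_grid l h).

Hypotheses (l_gt0 : 0 < l) (h_gt0 : 0 < h) (m_gt0 : 0 < m).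
Hypotheses (sp_gt0 : forall i, i < m -> 0 < sp i)
  (sp_dvd : forall j i, j < n -> i < m -> sp i %| P j).
Hypothesis big_horizon : forall j, j < n -> r j + \sum_(a < n) P a <= grid Kc.

Variable lev : nat -> nat.
Hypothesis lev_le : forall j, lev j <= Kc.
Hypothesis lev_eligible : forall j, j < n -> nz j -> lev j < Kc -> eligible m P r sp grid j (lev j).
Hypothesis lev_capacity : forall j k, j < n -> k < Kc ->
  \sum_(a < n | [&& nz a, lev a <= k & P j <= P a]) P a <= cap1 m P sp grid j k.
Local Notation level_sum := (lev_cost n g P r w inc grid lev).

Section Solved.

Variables (q : nat) (hist : seq nat).
Hypothesis cost_le : level_sum <= grid q.+1.
Hypothesis hist_ok : solved q hist.
Local Notation Bd := (grid q.+1).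
Local Notation x := (frac Kc hist).
Local Notation kap i := (kappa Kc N nz x i).
Local Notation Lmax := (1260 * (mp + mc).+1).

Let Bd_gt0 : 0 < Bd.
Proof. by apply: leq_trans (grid1_ge q); rewrite time_unitE. Qed.
Let Kc_gt0 : 0 < Kc. Proof. by rewrite muln_gt0 l_gt0. Qed.
Let run_h := hist_ok.1.

Let covered : forall p, p < mc ->
  coverage N (lp_C n m Kc Bd P r sp w grid) (lp_L0 n Kc N P r inc) hist p = N.
Proof. exact: hist_ok.2 _ (lev_cover grid_mono lev_eligible cost_le). Qed.

Let loads i : i < mp -> \sum_(e <- hist) lp_A n m Kc Bd P r sp w grid i e <= Lmax * lp_D n m Kc Bd P sp grid.
Proof.
move=> ilt; apply: ltnW.
exact: (load_lt (lp_D_gt0 n m Kc P sp grid Bd_gt0) (lp_A_le n m Kc Bd P r sp w grid_mono)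
  (lp_C_le n m Kc Bd P r sp w grid) (lev_pack grid_mono (erefl 0) lev_le lev_capacity cost_le)
  (lev_cover grid_mono lev_eligible cost_le) (erefl N) run_h ilt).
Qed.

Let x_mono j k : x j k <= x j k.+1.
Proof. by rewrite /frac [X in _ <= X]big_ord_recr leq_addr. Qed.

(** A nontrivial job is not eligible at time 0, so its fraction there is zero and misses any
    positive threshold. *)
Lemma kappa_gt0 i j : 0 < i -> j < n -> nz j -> 0 < kap i j.
Proof.
move=> i0 jn nj; rewrite lt_kappa //.
rewrite (_ : x j 0 = 0) ?muln0 ?muln_gt0 ?i0 //.
apply/eqP; rewrite -leqn0 leqNgt; apply/negP => x0.
have /andP[] := frac_eligible grid_mono run_h jn Kc_gt0 x0.
by rewrite /= muln0 !leqn0 => /eqP r0 /eqP p0; move: nj; rewrite /nontrivial r0 p0.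
Qed.

Lemma kappa_frac i j k : nz j -> k < Kc -> kap i j <= k -> i * N <= 40 * x j k.
Proof. by move=> nj kK; rewrite leqNgt lt_kappa // -leqNgt. Qed.

Section Attempt.

Variables (i o : nat).
Hypothesis i_lt : i < 39.
Local Notation blk := (blocks_of hist i o).
Local Notation th := cgrid.

Lemma blk_nz j : nz j -> blk j = next_block h o (kap i.+1 j).
Proof. by rewrite /block_of => ->; rewrite mul1n. Qed.

Lemma blk_gt0 j : 0 < blk j -> nz j.
Proof. by rewrite /block_of; case: (nz j). Qed.

Lemma kappa_le_blk j : nz j -> kap i.+1 j <= blk j.
Proof. by move=> nj; rewrite blk_nz // leq_addr. Qed.

Lemma th_blk j : th (blk j) = grid (blk j).
Proof.
rewrite /capped_grid (minn_idPl _) //.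
by apply: leq_trans (block_of_le l n g P r h_gt0 hist i o j) _; apply: leq_pred.
Qed.

Lemma zero_block j : j < n -> blk j = 0 -> P j = 0 /\ r j = 0.
Proof.
move=> jn b0; case nj: (nz j).
  have := kappa_gt0 (ltn0Sn i) jn nj; have := kappa_le_blk nj; lia.
by move: nj; rewrite /nontrivial; lia.
Qed.

Lemma top_attained : exists2 p, p < m & top_speed m sp = sp p.
Proof.
have [|p pE] := @bigop.eq_bigmax _ (fun i : 'I_m => sp i); first by rewrite card_ord.
by exists p.
Qed.

(** Below level [Kc] this is the eligibility of a job with positive fraction. From [Kc] on, the grid
    time exceeds any release date plus the total work, and any machine will do. *)
Lemma block_fits j : j < n -> 0 < blk j ->
  r j <= th (blk j) /\ exists2 p, p < m & P j <= sp p * th (blk j).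
Proof.
move=> jn b0; have nj := blk_gt0 b0; rewrite th_blk.
have [bK|Kb] := ltnP (blk j) Kc.
  have xj : 0 < x j (blk j).
    have := kappa_frac nj bK (kappa_le_blk nj); rewrite lt0n; apply: contraTneq => ->.
    by rewrite muln0 -ltnNge.
  have /andP[rj Pj] := frac_eligible grid_mono run_h jn bK xj.
  by split=> //; have [p pm topE] := top_attained; exists p => //; rewrite -topE.
have big := big_horizon jn; have gK := th_le grid_mono Kb.
split; first by apply: leq_trans gK; apply: leq_trans big; apply: leq_addr.
exists 0 => //; apply: (@leq_trans (grid (blk j))); last by rewrite leq_pmull // sp_gt0.
apply: leq_trans gK; apply: leq_trans big; apply: leq_trans (leq_addl _ _).
by rewrite (bigD1 (Ordinal jn)) //= leq_addr.
Qed.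

Lemma late_block j p0 (D : pred nat) : j < n -> Kc <= blk j -> p0 < m -> P j <= sp p0 * th (blk j) ->
  i.+1 * (\sum_(a < n | D a) P a) <= 42 * th (blk j) * \sum_(p < m) (P j <= sp p * th (blk j)) * sp p.
Proof.
move=> jn Kb pm Pj; rewrite th_blk in Pj *.
have big := big_horizon jn; have gK := th_le grid_mono Kb.
apply: (@leq_trans (42 * grid (blk j) * 1)); last first.
  rewrite leq_mul2l; apply/orP; right.
  by rewrite (bigD1 (Ordinal pm)) //= Pj mul1n; apply: leq_trans (leq_addr _ _); apply: sp_gt0.
rewrite muln1 leq_mul //; first lia.
apply: leq_trans gK; apply: leq_trans big; apply: leq_trans (leq_addl _ _).
by rewrite [X in _ <= X](bigID (fun a : 'I_n => D a)) leq_addr.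
Qed.

(** Jobs past the threshold have fraction at least [i.+1 / 40], while the fractional load is at most
    1260/1200 times the capacity; and 40 * 1260 = 42 * 1200. *)
Lemma packed j b (D : pred nat) : j < n -> b < Kc ->
  0 < capacity m P sp grid j b ->
  (forall a, a < n -> D a -> P a = 0 \/ [/\ nz a, kap i.+1 a <= b & P j <= P a]) ->
  i.+1 * (\sum_(a < n | D a) P a) <= 42 * capacity m P sp grid j b.
Proof.
move=> jn bK cap0 Dok.
have N0 : 0 < 30 * (mp + mc).+1 by [].
rewrite -(leq_pmul2l N0).
have capE : cap1 m P sp grid j b = capacity m P sp grid j b.
  by rewrite /cap1; case: eqP cap0 => [->|_ _] //; rewrite addn0.
have := frac_pack Bd_gt0 run_h loads jn bK; rewrite capE => pack.
have low : i.+1 * N * (\sum_(a < n | D a) P a) <= 40 * \sum_(a < n | P j <= P a) P a * x a b.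
  rewrite !big_distrr /= big_mkcond [X in _ <= X]big_mkcond /=; apply: leq_sum => a _.
  case: ifP => // Da; case: (Dok a (ltn_ord a) Da) => [->|[na ka ja]]; first by rewrite muln0.
  by rewrite ja mulnC [X in _ <= X]mulnCA leq_mul2l (kappa_frac na bK ka) orbT.
move: low pack; set c := capacity _ _ _ _ _ _; set s1 := \sum_(a < n | D a) _.
set s2 := \sum_(a < n | _) _ * _; move: (mp + mc).+1 => X; nia.
Qed.

Lemma capacity_pos j b p : p < m -> 0 < grid b -> P j <= sp p * grid b ->
  0 < capacity m P sp grid j b.
Proof.
move=> pm g0 Pj; rewrite /capacity muln_gt0 g0 /= (bigD1 (Ordinal pm)) //= Pj mul1n.
by apply: leq_trans (leq_addr _ _); apply: sp_gt0.
Qed.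

Lemma grid_gt0 b : 0 < b -> 0 < grid b.
Proof. by case: b => // b _; apply: leq_trans (grid1_ge b); rewrite time_unitE. Qed.

Lemma reset_block_ok j : j < n -> 0 < blk j ->
  [/\ r j <= th (blk j), exists2 p, p < m & P j <= sp p * th (blk j)
   & i.+1 * (\sum_(a < n | (blk a == blk j) && (P j <= P a)) P a) <=
     42 * th (blk j) * \sum_(p < m) (P j <= sp p * th (blk j)) * sp p].
Proof.
move=> jn b0; have [rj [p pm Pj]] := block_fits jn b0; split=> //; first by exists p.
have [bK|Kb] := ltnP (blk j) Kc; last first.
  exact: (late_block (fun a => (blk a == blk j) && (P j <= P a)) jn Kb pm Pj).
rewrite th_blk in Pj *; rewrite -mulnA.
apply: (packed (D := fun a => (blk a == blk j) && (P j <= P a))) => //.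
  exact: capacity_pos pm (grid_gt0 b0) Pj.
move=> a an /andP[/eqP ab ja]; right.
have na : nz a by apply: blk_gt0; rewrite ab.
by split=> //; rewrite -ab; apply: kappa_le_blk.
Qed.

(** The row of the shortest job [j0] counts every job. Its capacity is at most that of all machines,
    and is positive since [j] itself fits. *)
Lemma same_block_ok j : (forall p p', p < m -> p' < m -> sp p = sp p') -> j < n -> 0 < blk j ->
  [/\ r j <= th (blk j), exists2 p, p < m & P j <= sp p * th (blk j)
   & i.+1 * (\sum_(a < n | blk a <= blk j) P a) <= 42 * th (blk j) * \sum_(p < m) sp p].
Proof.
move=> same jn b0; have [rj [p pm Pj]] := block_fits jn b0; split=> //; first by exists p.
have [bK|Kb] := ltnP (blk j) Kc; last first.
  apply: leq_trans (late_block (fun a => blk a <= blk j) jn Kb pm Pj) _.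
  by rewrite leq_mul2l; apply/orP; right; apply: leq_sum => p' _; case: (P _ <= _); rewrite ?mul1n ?mul0n.
rewrite th_blk in Pj *; rewrite -mulnA.
pose j0 := [arg min_(a < Ordinal jn) P a].
have j0P a : P j0 <= P (a : 'I_n) by rewrite /j0; case: arg_minnP => // a0 _; apply.
apply: (@leq_trans (42 * capacity m P sp grid j0 (blk j))); last first.
  rewrite !leq_mul2l; apply/orP; right; apply/orP; right.
  by apply: leq_sum => p' _; case: (P _ <= _); rewrite ?mul1n ?mul0n.
apply: (packed (D := fun a => blk a <= blk j)) => //.
  by apply: capacity_pos pm (grid_gt0 b0) _; apply: leq_trans Pj; apply: (j0P (Ordinal jn)).
move=> a an ab; have [b0'|ba] := posnP (blk a); [left|right].
  by case: (zero_block an b0').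
have na := blk_gt0 ba; split=> //; last exact: (j0P (Ordinal an)).
exact: leq_trans (kappa_le_blk na) ab.
Qed.

Lemma capped_grid_mono b : th b <= th b.+1.
Proof. by apply: (th_le grid_mono); rewrite leq_min geq_minr andbT geq_min leqnSn. Qed.

Lemma reset_outcome mc st cp a : reset -> 40 <= h -> outcome blk mc st cp -> a < n ->
  i.+1 * (1000 * cp a) <= (i.+1 + 42) * (1607 * grid (blk a)).
Proof.
move=> rs h40 [ld [T [bs]]]; rewrite rs => rc an; rewrite -(th_blk a).
have i40 : i.+1 <= 40 by apply: ltnW.
have th0 : th 0 = 0 by rewrite /capped_grid min0n.
have rank_order j b : j < n -> b < n -> P b < P j -> prank n P j < prank n P b.
  move=> jn bn Pb; rewrite /prank (bigD1 (Ordinal jn)) //= ltnn add0n.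
  rewrite [X in _ < X](bigD1 (Ordinal jn)) //= Pb add1n ltnS; apply: leq_sum => c _.
  by case: (ltnP (P j) (P c)) => // jc; rewrite (ltn_trans Pb jc).
(* Positive blocks are congruent to the offset modulo [h], so two different ones are at least [h]
   grid steps apart. *)
have gaps j b : j < n -> b < n -> 0 < blk b -> blk b < blk j -> 265 * th (blk b) <= 100 * th (blk j).
  move=> jn bn b0 bj; rewrite !th_blk; apply: (grid_gap b0 h40).
  have nb := blk_gt0 b0; have nj : nz j by apply: blk_gt0; apply: leq_trans bj.
  have eqm : blk j = blk b %[mod h] by rewrite !blk_nz // !next_block_congr.
  have dv : h %| blk j - blk b by rewrite -eqn_mod_dvd ?eqm // ltnW.
  have : h <= blk j - blk b by rewrite dvdn_leq // subn_gt0.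
  by move: bj; lia.
exact: (@reset_quality n m P r sp th blk (prank n P) i.+1 (ltn0Sn i) i40 sp_gt0 sp_dvd (@prank_lt n P)
  th0 capped_grid_mono (@zero_block) rank_order (@reset_block_ok) gaps
  _ _ _ _ _ _ _ _ rc a an (all_done l g P r h_gt0 hist i o an)).
Qed.

Lemma same_outcome mc st cp a : reset = false -> (forall p p', p < m -> p' < m -> sp p = sp p') ->
  outcome blk mc st cp -> a < n -> i.+1 * cp a <= (i.+1 + (i.+1 + 42)) * grid (blk a).
Proof.
move=> rs same [ld [T [bs]]]; rewrite rs => rc an; rewrite -(th_blk a).
have i40 : i.+1 <= 40 by apply: ltnW.
have th0 : th 0 = 0 by rewrite /capped_grid min0n.
exact: (@no_reset_quality n m P r sp th blk (prank n P) i.+1 (ltn0Sn i) i40 sp_gt0 sp_dvd (@prank_lt n P)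
  th0 capped_grid_mono (@zero_block) same (fun j => @same_block_ok j same)
  _ _ _ _ _ _ _ _ rc a an (all_done l g P r h_gt0 hist i o an)).
Qed.

End Attempt.

Variables (best E Gc : nat) (om : nat -> nat).
Hypothesis best_ok : forall i o, i < 39 -> o < h ->
  tried l n m g h reset P r sp w inc hist i o best.
Hypothesis om_ok : forall i o mc st cp a, i < 39 -> o < h -> outcome (blocks_of hist i o) mc st cp ->
  a < n -> om i * cp a <= E * grid (blocks_of hist i o a).
Hypothesis sum_next : forall k, 0 < k -> 10 * \sum_(o < h) grid (next_block h o k) <= Gc * grid k.

Lemma group_cost_le i o mc st cp S : i < 39 -> o < h ->
  outcome (blocks_of hist i o) mc st cp ->
  om i * (\max_(j < n) inc S j * cp j) <=
  E * (if group_kappa n Kc N inc nz x i.+1 S == 0 then 0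
       else grid (next_block h o (group_kappa n Kc N inc nz x i.+1 S))).
Proof.
move=> i39 oh oc; set gk := group_kappa _ _ _ _ _ _ _ _.
have [[j0 ->]|->] : (exists j0 : 'I_n, \max_(j < n) inc S j * cp j = inc S j0 * cp j0) \/
    \max_(j < n) inc S j * cp j = 0; last by rewrite muln0.
  case: (posnP n) => [n0|n0]; [right|left].
    by apply/eqP; rewrite -leqn0; apply/bigmax_leqP => j; have := ltn_ord j; rewrite {2}n0.
  by have [|j0 E0] := @bigop.eq_bigmax _ (fun j : 'I_n => inc S j * cp j); [rewrite card_ord|exists j0].
case iS: (inc S j0); last by rewrite mul0n muln0.
rewrite mul1n; apply: leq_trans (om_ok i39 oh oc (ltn_ord j0)) _; rewrite leq_mul2l; apply/orP; right.
case nj: (nz j0); last by rewrite /block_of nj mul0n.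
have kle : kap i.+1 j0 <= gk.
  apply: (@bigop.leq_bigmax_cond _ (fun j : 'I_n => inc S j && nz j) (fun j : 'I_n => kap i.+1 j) j0).
  by rewrite iS nj.
rewrite ifF; last by have := kappa_gt0 (ltn0Sn i) (ltn_ord j0) nj; lia.
by rewrite blk_nz //; apply: (th_le grid_mono); apply: next_block_mono.
Qed.

Lemma best_average : h * best * (\sum_(i < 39) om i) * 100 <= E * Gc * (420 * Bd).
Proof.
have uc : \sum_(S < g) \sum_(k < Kc) w S * gap grid k * unfinished n Kc hist S k <= Lmax * Bd.
  exact: (frac_cost (inc := inc) run_h loads).
have := @averaging n g Kc N Lmax Bd h w grid inc nz x (unfinished n Kc hist) isT (erefl 0) grid_mono
  x_mono (fun S j k Sg jn kK iS nj => frac_cover run_h covered Sg jn kK iS nj) uc best E Gc om _ sum_next.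
(* The common factor of both sides: with X the bracket, 10 N = 120 X * 100 and 40 Lmax = 120 X *
   420. *)
have X0 : 0 < 120 * (mp + mc).+1 by [].
move=> avg; rewrite -(leq_pmul2l X0); apply: leq_trans (leq_trans (avg _) _).
- by rewrite mulnC; apply/eq_leq; move: (mp + mc).+1 => X; ring.
- move=> i o i39 oh; have [mc' [st [cp [oc le]]]] := best_ok i39 oh.
  apply: leq_trans (leq_mul (leqnn (om i)) le) _.
  rewrite /total_cost !big_distrr /=; apply: leq_sum => S _.
  by rewrite mulnCA [X in _ <= X]mulnCA leq_mul2l (group_cost_le S i39 oh oc) orbT.
- by apply/eq_leq; move: (mp + mc).+1 => X; ring.
Qed.

End Solved.
Variable best : nat.
Hypothesis explored_ok : forall q, q < KB -> explored l n m g h reset P r sp w inc q best.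
Hypothesis w_gt0 : forall S, S < g -> 0 < w S.
Hypothesis lev_cost_le : level_sum <= grid KB.

Section Bound.

Variables (E Gc : nat) (om : nat -> nat).
Hypothesis om_ok : forall q hist i o mc st cp a, level_sum <= grid q.+1 -> solved q hist ->
  i < 39 -> o < h -> outcome (blocks_of hist i o) mc st cp ->
  a < n -> om i * cp a <= E * grid (blocks_of hist i o a).
Hypothesis om_gt0 : 0 < om 0.
Hypothesis sum_next : forall k, 0 < k -> 10 * \sum_(o < h) grid (next_block h o k) <= Gc * grid k.

Lemma lev_cost_ge : 0 < level_sum -> time_unit <= level_sum.
Proof.
rewrite lt0n sum_nat_eq0 => /forallPn[S]; rewrite implyTb muln_eq0 negb_or => /andP[w0 t0].
rewrite /lev_cost (bigD1 S) //=; apply: leq_trans (leq_addr _ _).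
apply: (@leq_trans (1 * grid (group_lev n P r inc lev S))); last by rewrite leq_mul2r lt0n w0 orbT.
by rewrite mul1n; case: group_lev t0 => // k _; apply: grid1_ge.
Qed.

(** The first grid time not below the cost exceeds it by at most 41/40. At the lower end this needs
    a positive cost to be at least one time unit, which is [grid 1]. *)
Lemma good_guess : 0 < level_sum ->
  exists2 q, q < KB & level_sum <= grid q.+1 /\ 40 * grid q.+1 <= 41 * level_sum.
Proof.
move=> pos; have ex : exists k, level_sum <= grid k by exists KB.
have min_k := ex_minnP ex; case: min_k => -[|q] le qmin.
  by move: pos; rewrite ltnNge le.
exists q; first exact: (qmin KB lev_cost_le); split=> //.
case: q le qmin => [|q] le qmin.
  have /= u := lev_cost_ge pos; apply: leq_trans (leq_mul (leqnn 40) u) _.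
  by rewrite leq_mul2r orbT.
apply: leq_trans (grid_up (ltn0Sn q)) _; rewrite leq_mul2l /=; apply: ltnW; rewrite ltnNge.
by apply/negP => le1; have := qmin q.+1 le1; rewrite ltnn.
Qed.

(** No guess is within a constant factor of cost 0. In this case positive weights force all members
    of groups to be trivial, and these complete at time 0. *)
Lemma zero_best : level_sum = 0 -> best = 0.
Proof.
move=> z; have Kc0 : 0 < Kc by rewrite muln_gt0 l_gt0.
have KB0 : 0 < KB by rewrite muln_gt0 l_gt0.
have [hist sv /(_ 0 0 isT h_gt0)[mc' [st [cp [oc le]]]]] := explored_ok KB0.
apply/eqP; rewrite -leqn0; apply: leq_trans le _; rewrite leqn0 sum_nat_eq0; apply/forallP => S.
rewrite implyTb muln_eq0; apply/orP; right; rewrite -leqn0; apply/bigmax_leqP => j _.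
case iS: (inc S j); last by rewrite mul0n.
have triv : ~~ nz j.
  apply/negP => nj; move/eqP: z; rewrite sum_nat_eq0 => /forallP/(_ S).
  rewrite implyTb muln_eq0 -leqn0 leqNgt w_gt0 //=.
  have : lev j <= group_lev n P r inc lev S.
    apply: (@bigop.leq_bigmax_cond _ (fun j : 'I_n => inc S j && nz j) (fun j : 'I_n => lev j) j).
    by rewrite iS nj.
  case: group_lev => [|k] lj; last by rewrite -leqn0 leqNgt (leq_trans _ (grid1_ge k)) // time_unitE.
  have l0 : lev j = 0 by apply/eqP; rewrite -leqn0.
  have := lev_eligible (ltn_ord j) nj; rewrite l0 => /(_ Kc0)/andP[] /=.
  by rewrite muln0 !leqn0 => /eqP r0 /eqP p0; move: nj; rewrite /nontrivial r0 p0.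
have c0 : level_sum <= grid 1 by rewrite z.
have := om_ok (i := 0) c0 sv isT h_gt0 oc (ltn_ord j).
by rewrite /block_of (negPf triv) mul0n muln0 leqn0 muln_eq0 eqn0Ngt om_gt0 mul1n => /eqP->.
Qed.

Lemma best_bound : h * best * (\sum_(i < 39) om i) * 4000 <= E * Gc * (420 * 41 * level_sum).
Proof.
have [z|pos] := posnP level_sum; first by rewrite zero_best // muln0.
have [q qK [le ge]] := good_guess pos; have [hist sv tr] := explored_ok qK.
have := best_average le sv tr (fun i o mc st cp a => om_ok le sv) sum_next.
move: ge; move: (grid q.+1) (level_sum) (\sum_(i < 39) om i) => b c s.
move: (E * Gc) (h * best) => x y; clear; move=> h1 h2.
have := leq_mul (leqnn 40) h2; have := leq_mul (leqnn (x * 420)) h1.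
by lia.
Qed.

End Bound.

(** The losses 1.607 (geometric series of blocks), 1.6875 (offsets), 1.05 (solver) and 41/40 (guess)
    combine to 1607 * 675 * 420 * 41 / (40 * 11600 * 4000), about 10.06, which stays below
    410/40. *)
Lemma reset_best : reset -> h = 40 -> 40 * best <= 410 * level_sum.
Proof.
move=> rs h40.
have ok q hist i o mc st cp a : level_sum <= grid q.+1 -> solved q hist ->
    i < 39 -> o < h -> outcome (blocks_of hist i o) mc st cp -> a < n ->
    reset_weight i * cp a <= 1607 * grid (blocks_of hist i o a).
  move=> le sv i39 oh oc an; apply: weight_le; first by rewrite addn_gt0.
  by apply: (reset_outcome le sv i39 rs _ oc an); rewrite h40.
have sn k : 0 < k -> 10 * \sum_(o < h) grid (next_block h o k) <= 675 * grid k.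
  by rewrite h40; apply: sum_next_block; apply: grid_up.
have := best_bound ok isT sn; rewrite h40; have := sum_reset_weight.
move: (\sum_(i < 39) _) best (level_sum) => s b c; clear=> h1 h2.
have h3 := leq_mul (leqnn (40 * b)) h1; lia.
Qed.

(** With period 1 there is no loss from offsets: 1000 * 10 * 420 * 41 / (8600 * 4000) is about
    5.006, below 205/40. *)
Lemma same_best : reset = false -> h = 1 -> (forall p p', p < m -> p' < m -> sp p = sp p') ->
  40 * best <= 205 * level_sum.
Proof.
move=> rs h1 same.
have ok q hist i o mc st cp a : level_sum <= grid q.+1 -> solved q hist ->
    i < 39 -> o < h -> outcome (blocks_of hist i o) mc st cp -> a < n ->
    same_weight i * cp a <= 1000 * grid (blocks_of hist i o a).
  move=> le sv i39 oh oc an; apply: weight_le; first by rewrite addn_gt0.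
  have := same_outcome le sv i39 rs same oc an; rewrite mulnCA => H.
  by apply: leq_trans (leq_mul (leqnn 1000) H) _; rewrite mulnCA.
have sn k : 0 < k -> 10 * \sum_(o < h) grid (next_block h o k) <= 10 * grid k.
  by rewrite h1 big_ord1 /next_block modn1 addn0.
have := best_bound ok isT sn; rewrite h1; have := sum_same_weight.
move: (\sum_(i < 39) _) best (level_sum) => s b c; clear=> h2 h3.
have h4 := leq_mul (leqnn b) h2; lia.
Qed.

End Quality.

(** * Reading the instance *)

Notation aJB := 82. Notation aGB := 83. Notation aGU := 84. Notation aPS := 85.
Notation aDD := 86. Notation aLEN := 87.

(** The rational with numerator in cell [i] and denominator in cell [i + 1], multiplied by the
    common denominator. The product of all positive input entries serves as such, whichever of them
    are denominators. *)
Definition ratio_exp (i : hexp) : hexp := (rIN $ i * (#aDD %/ rIN $ (i + K 1)))%H.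

(** Identical machines are given by their number in binary, possibly exponential in the input size;
    no more than one per job can be used, and one is kept if there is no job. Related machines are
    listed by their speeds, so their number is bounded by the input. *)
Definition parse_counts (same : bool) : hcmd :=
  (an ::= rIN $ (K 1) ;; ag ::= rIN $ (K 2) ;;
   am ::= (if same then B OMin (rIN $ (K 0)) (#an) + (#an == K 0) else rIN $ (K 0)) ;;
   aJB ::= (if same then K 3 else K 3 + K 2 * #am) ;;
   aGB ::= #aJB + K 4 * #an ;; aLEN ::= #aGB + #ag * (#an + K 2))%C.

(** Time is scaled by the common denominator, the product of all integer speeds and the time unit.
    Thus each speed divides each length, and a positive duration or release date is at least one
    time unit. *)
Definition parse_scales (same : bool) : hcmd :=
  (fold OMul vA aDD (#aLEN) (K 1) (rIN $ (#vA) || K 1) ;;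
   fill vA aS (#am) (if same then K 1 else ratio_exp (K 3 + K 2 * #vA)) ;;
   fold OMul vA aACC (#am) (K 1) (aS $ (#vA)) ;;
   aGU ::= #aACC * (K 100 * K 400) ;; aLAM ::= #aDD * #aGU ;;
   aPS ::= (if same then #aGU else #aLAM))%C.

Definition parse_data : hcmd :=
  (fill vA aP (#an) (ratio_exp (#aJB + K 4 * #vA) * #aPS) ;;
   fill vA aR (#an) (ratio_exp (#aJB + K 4 * #vA + K 2) * #aGU) ;;
   fill vA aW (#ag) (ratio_exp (#aGB + #vA * (#an + K 2))) ;;
   fill vA aINC (#ag * #an) (rIN $ (#aGB + (#vA %/ #an) * (#an + K 2) + K 2 + #vA %% #an)))%C.

(* Identical machines ([same]) use the period 1 and never wait for the previous
   block ([reset = false]); related machines use the period 40 and do wait. *)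
Definition program (same : bool) (h : nat) (reset : bool) : hcmd :=
  (parse_counts same ;; parse_scales same ;; parse_data ;; core h reset ;; output)%C.

Section Parse.

Variables (same : bool) (h : nat) (reset : bool) (s : seq nat).
Hypotheses (h_gt0 : 0 < h) (h_le : h <= 40).
Let input := nth 0 s.
Let n := input 1.
Let g := input 2.
Let m := if same then minn (input 0) n + (n == 0) else input 0.
Let jb := if same then 3 else 3 + 2 * m.
Let gb := jb + 4 * n.
Definition common_den : nat := \prod_(i < size s) maxn (input i) 1.
Definition scaled (i : nat) : nat := input i * (common_den %/ input i.+1).
Definition in_speed (i : nat) : nat := if same then 1 else scaled (3 + 2 * i).
Definition in_unit : nat := (\prod_(i < m) in_speed i) * time_unit.
Definition in_scale : nat := common_den * in_unit.
Definition in_work (j : nat) : nat := scaled (jb + 4 * j) * (if same then in_unit else in_scale).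
Definition in_release (j : nat) : nat := scaled (jb + 4 * j + 2) * in_unit.
Definition in_weight (S : nat) : nat := scaled (gb + S * (n + 2)).
Definition in_member (S j : nat) : bool := input (gb + S * (n + 2) + 2 + j) != 0.

Hypothesis size_s : size s = gb + g * (n + 2).
Hypothesis member_le : forall S j, S < g -> j < n -> input (gb + S * (n + 2) + 2 + j) <= 1.
Hypothesis m_gt0 : 0 < m.
Hypothesis speed_pos : forall i, same = false -> i < m ->
  0 < input (3 + 2 * i) /\ 0 < input (3 + 2 * i).+1.

Let lg := bits (\prod_(x <- s) x.+2).
Let l := 2000 * lg.

Lemma prod_lt : \prod_(x <- s) x.+2 < 2 ^ lg.
Proof. exact: ltn_bits. Qed.

Lemma size_le : size s <= lg.
Proof.
rewrite -(leq_exp2l (m := 2)) //; apply: ltnW; apply: leq_ltn_trans prod_lt.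
have -> : 2 ^ size s = \prod_(x <- s) 2.
  by elim: (s) => [|x t IH]; rewrite ?big_nil // big_cons -IH expnS.
by apply: leq_prod => x _.
Qed.

Lemma prod_input : \prod_(x <- s) x.+2 = \prod_(i < size s) (input i).+2.
Proof. by rewrite (big_nth 0) big_mkord. Qed.

Lemma common_den_lt : common_den < 2 ^ lg.
Proof.
apply: leq_ltn_trans prod_lt; rewrite prod_input; apply: leq_prod => i _.
by rewrite geq_max; lia.
Qed.

Lemma input_lt i : input i < 2 ^ lg.
Proof.
have [lt|ge] := ltnP i (size s); last by rewrite /input nth_default // expn_gt0.
apply: leq_ltn_trans prod_lt; rewrite prod_input (bigD1 (Ordinal lt)) //=.
apply: (@leq_trans ((input i).+2 * 1)); first by rewrite muln1; lia.
by rewrite leq_mul2l /= prodn_gt0.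
Qed.

Lemma scaled_le i : scaled i <= 2 ^ (2 * lg).
Proof.
rewrite mul2n -addnn expnD leq_mul //; first exact: ltnW (input_lt i).
by apply: leq_trans (leq_div _ _) _; apply: ltnW; apply: common_den_lt.
Qed.

Lemma scaledE i : i.+1 < size s -> 0 < input i.+1 ->
  scaled i * input i.+1 = input i * common_den.
Proof.
move=> lt d0; rewrite /scaled -mulnA; congr (_ * _); apply: divnK.
by rewrite /common_den (bigD1 (Ordinal lt)) //= (maxn_idPl _) // dvdn_mulr.
Qed.

Lemma common_den_gt0 : 0 < common_den.
Proof. by apply: prodn_gt0 => i; rewrite leq_max orbT. Qed.

Lemma in_speed_gt0 i : i < m -> 0 < in_speed i.
Proof.
move=> im; rewrite /in_speed; case sE: same => //; have [n0 d0] := speed_pos sE im.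
have lt : (3 + 2 * i).+1 < size s by rewrite size_s /gb /jb sE; move: im; lia.
rewrite lt0n; apply/eqP => z; have := scaledE lt d0; rewrite z mul0n => /esym/eqP.
by rewrite muln_eq0 !eqn0Ngt n0 common_den_gt0.
Qed.

Lemma lg_gt0 : 0 < lg. Proof. by []. Qed.
Let l_ge : 2000 <= l. Proof. by rewrite /l leq_pmulr. Qed.

Lemma size_l : size s <= l.
Proof. by apply: leq_trans size_le _; rewrite /l leq_pmull. Qed.

Lemma n_size : n <= size s. Proof. by rewrite size_s /gb; lia. Qed.
Lemma g_size : g <= size s. Proof. by rewrite size_s; apply: leq_trans (leq_addl _ _); rewrite leq_pmulr ?addn2. Qed.
Lemma m_size : m <= size s.
Proof.
rewrite size_s; have := leq_addr (g * (n + 2)) gb; apply: leq_trans.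
rewrite /gb /jb /m; case: same => //; last by lia.
by have := geq_minr (input 0) n; case: (n == 0); lia.
Qed.

Lemma in_unit_le : in_unit <= 2 ^ (2 * lg * lg + 16).
Proof.
rewrite expnD leq_mul //.
apply: (@leq_trans (\prod_(i < m) 2 ^ (2 * lg))).
  apply: leq_prod => i _; rewrite /in_speed; case: (same); first by rewrite expn_gt0.
  exact: scaled_le.
rewrite prod_nat_const card_ord -expnM leq_exp2l // leq_mul2l.
by rewrite (leq_trans m_size size_le) orbT.
Qed.

Lemma in_scale_le : in_scale <= 2 ^ (lg + (2 * lg * lg + 16)).
Proof. by rewrite expnD leq_mul ?in_unit_le // ltnW ?common_den_lt. Qed.

Lemma in_work_le j : in_work j <= 2 ^ (21 * (lg * lg)).
Proof.
apply: (@leq_trans (2 ^ (2 * lg + (lg + (2 * lg * lg + 16))))); last first.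
  by rewrite leq_exp2l //; have := lg_gt0; move: lg => k; nia.
rewrite expnD leq_mul ?scaled_le //; case: (same); last exact: in_scale_le.
by apply: leq_trans in_unit_le _; rewrite leq_exp2l // leq_addl.
Qed.

Lemma in_release_le j : in_release j <= 2 ^ (21 * (lg * lg)).
Proof.
apply: (@leq_trans (2 ^ (2 * lg + (2 * lg * lg + 16)))); last first.
  by rewrite leq_exp2l //; have := lg_gt0; move: lg => k; nia.
by rewrite expnD leq_mul ?scaled_le ?in_unit_le.
Qed.

Lemma sz2_of x : x <= 2 ^ (21 * (lg * lg)) -> sz l 2 x.
Proof.
move=> le; apply: leq_ltn_trans le _; rewrite ltn_exp2l // /l.
have := lg_gt0; move: lg => k; rewrite expnS expn1; nia.
Qed.

Lemma sz1_of x : x <= 2 ^ (2 * lg) -> sz l 1 x.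
Proof. by move=> le; apply: leq_ltn_trans le _; rewrite ltn_exp2l // expn1 /l; have := lg_gt0; lia. Qed.

Lemma in_speed_sz i : sz l 1 (in_speed i).
Proof. by apply: sz1_of; rewrite /in_speed; case: (same); rewrite ?expn_gt0 ?scaled_le. Qed.

Lemma in_weight_sz S : sz l 2 (in_weight S).
Proof. by apply: (@sz_weak l l_ge 1) => //; apply: sz1_of; apply: scaled_le. Qed.

(** All times are at most [2 ^ (22 * (lg * lg))]. Forty grid steps double the time, so 880 lg^2 + 1
    levels suffice, and [l * l] with its factor 2000^2 is larger. *)
Lemma in_horizon j : in_release j + \sum_(a < n) in_work a <= grid (l * l).
Proof.
have n_lt : n.+1 <= 2 ^ lg.
  by apply: leq_trans (ltn_expl lg (isT : 1 < 2)); rewrite ltnS; apply: leq_trans n_size size_le.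
apply: (@leq_trans (time_unit * 2 ^ (22 * (lg * lg)))).
  apply: (@leq_trans (2 ^ (21 * (lg * lg)) * n.+1)).
    rewrite mulnS leq_add ?in_release_le // mulnC -[n in n * _]card_ord -sum_nat_const.
    by apply: leq_sum => a _; apply: in_work_le.
  apply: (@leq_trans (1 * 2 ^ (22 * (lg * lg)))); last by rewrite leq_mul2r time_unitE orbT.
  rewrite mul1n; apply: leq_trans (leq_mul (leqnn _) n_lt) _; rewrite -expnD leq_exp2l //.
  by have := lg_gt0; move: lg => k; nia.
apply: leq_trans (grid_doubling _) _; apply: (th_le grid_mono); rewrite /l.
by have := lg_gt0; move: lg => k; nia.
Qed.

Lemma in_lev_cost_le lev : (forall j, lev j <= l * l) ->
  lev_cost n g in_work in_release in_weight in_member grid lev <= grid (l * (l * l)).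
Proof.
move=> lev_le; have g_lt : g <= 2 ^ lg.
  by apply: ltnW; apply: leq_ltn_trans (leq_trans g_size size_le) (ltn_expl _ _).
apply: (@leq_trans (time_unit * 2 ^ (3 * lg + l * l))).
  apply: (@leq_trans (g * (2 ^ (2 * lg) * (time_unit * 2 ^ (l * l))))).
    rewrite -[g in g * _]card_ord -sum_nat_const; apply: leq_sum => S _.
    apply: leq_mul; first exact: scaled_le.
    by apply: leq_trans (grid_le _); apply: (th_le grid_mono); apply: group_lev_le.
  rewrite [g * _]mulnA mulnCA leq_mul2l; apply/orP; right; rewrite -mulnA.
  apply: (@leq_trans (2 ^ lg * (2 ^ (2 * lg) * 2 ^ (l * l)))); first by rewrite leq_mul2r g_lt orbT.
  by rewrite -!expnD leq_exp2l //; lia.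
apply: leq_trans (grid_doubling _) _; apply: (th_le grid_mono).
have lgl : lg <= l by rewrite /l leq_pmull.
have h0 := l_ge; move: lgl h0; clear; move: l lg => a b; nia.
Qed.

Variables Y Z : nat.
Hypotheses (YE : Y = l ^ 30) (ZE : Z = 2 ^ Y).
Local Notation den := (den Y Z).

Let Y_Z : Y < Z. Proof. exact: Y_lt_Z ZE. Qed.
Let small_Y x : x <= size s -> x <= Y.
Proof.
by move=> le; apply: (poly_Y l_ge YE (k := 1)) => //; rewrite expn1; apply: leq_trans le size_l.
Qed.
Let small_Z x : x <= size s -> x < Z.
Proof. by move=> le; apply: leq_ltn_trans (small_Y le) Y_Z. Qed.
Let sz_lt k x : sz l k x -> k <= 30 -> x < Z.
Proof. exact: (sz_Z l_ge YE ZE). Qed.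
Let one_Z : 1 < Z.
Proof. by apply: small_Z; rewrite size_s /gb /jb; case: (same); lia. Qed.

Record input_ctx (t : store) : Prop := InputCtx {
  i_IN : forall i, i < size s -> t rIN i = input i; i_l : t rL 0 = l }.

Record parse_ctx (t : store) : Prop := ParseCtx {
  p_n : t an 0 = n; p_g : t ag 0 = g; p_m : t am 0 = m; p_jb : t aJB 0 = jb;
  p_gb : t aGB 0 = gb; p_len : t aLEN 0 = size s }.

Lemma input_ctx_eq t t' : {in [:: rIN; rL], forall a, t' a = t a} -> input_ctx t -> input_ctx t'.
Proof. by move=> fr [] *; split; move=> *; rewrite fr; auto. Qed.

Lemma parse_ctx_eq t t' : {in [:: an; ag; am; aJB; aGB; aLEN], forall a, t' a = t a} ->
  parse_ctx t -> parse_ctx t'.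
Proof. by move=> fr [] *; split; rewrite fr. Qed.

Lemma head_lt : 2 < size s.
Proof. by rewrite size_s /gb /jb; case: (same); lia. Qed.

Lemma parse_counts_correct t : input_ctx t -> parse_ctx (den (parse_counts same) t).
Proof.
move=> [INE _]; rewrite /parse_counts.
have h2 := head_lt; have h1 := ltnW h2; have h0 := ltnW h1.
have jb_s : jb <= size s by rewrite size_s /gb -!addnA leq_addr.
have gb_s : gb <= size s by rewrite size_s leq_addr.
rewrite den_seq (@set_cell Y Z _ _ _ n) //=; [|by rewrite INE|exact: small_Z n_size].
rewrite den_seq (@set_cell Y Z _ _ _ g) //=; [|by rewrite [LHS]INE|exact: small_Z g_size].
rewrite den_seq (@set_cell Y Z _ _ _ m) //=; last exact: small_Z m_size; last first.
  by rewrite /m; case: (same) => /=; rewrite [upd _ _ _ _ rIN _]INE.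
rewrite den_seq (@set_cell Y Z _ _ _ jb) //=; last exact: small_Z jb_s; last first.
  by rewrite /jb; case: (same).
rewrite den_seq (@set_cell Y Z aGB _ _ gb) //=; last exact: small_Z gb_s.
rewrite (@set_cell Y Z _ _ _ (size s)) //=; last exact: small_Z.
Qed.

Lemma ratio_correct t i k : input_ctx t -> t aDD 0 = common_den -> hev t i = k -> k.+1 < size s ->
  hev t (ratio_exp i) = scaled k.
Proof. by move=> [INE _] dE iE lt /=; rewrite iE addn1 !INE ?dE // ltnW. Qed.

Record scale_ctx (t : store) : Prop := ScaleCtx {
  s_D : t aDD 0 = common_den; s_S : forall i, i < m -> t aS i = in_speed i;
  s_GU : t aGU 0 = in_unit; s_LAM : t aLAM 0 = in_scale;
  s_PS : t aPS 0 = if same then in_unit else in_scale }.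

Lemma parse_scales_correct t : input_ctx t -> parse_ctx t -> scale_ctx (den (parse_scales same) t).
Proof.
move=> ix px; rewrite /parse_scales.
rewrite den_seq; set c1 := fold _ _ aDD _ _ _; set t1 := den c1 t.
rewrite den_seq; set c2 := fill _ aS _ _; set t2 := den c2 t1.
rewrite den_seq; set c3 := fold _ _ aACC _ _ _; set t3 := den c3 t2.
have fr1 a : a \notin assigned c1 -> t1 a = t a by apply: den_frame.
have fr2 a : a \notin assigned c2 -> t2 a = t1 a by apply: den_frame.
have fr3 a : a \notin assigned c3 -> t3 a = t2 a by apply: den_frame.
have D1 : t1 aDD 0 = common_den.
  apply: (prod_spec (f := fun i => maxn (input i) 1)) => //.
  - by move=> x /=; rewrite upd_other // (p_len px).
  - exact: small_Y.
  - by move=> i _; rewrite leq_max orbT.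
  - by apply: (sz_lt (k := 1)) => //; apply: sz1_of; apply: ltnW; apply: leq_trans common_den_lt _;
      rewrite leq_exp2l // leq_pmull.
  - by move=> i t' lt vi fr; rewrite /= vi fr // (i_IN ix).
have ix1 : input_ctx t1 by apply: input_ctx_eq ix; apply: in_frame.
have S2 i : i < m -> t2 aS i = in_speed i.
  move: i; apply: fill_spec => //.
  - by rewrite /= fr1 // (p_m px).
  - exact: small_Y m_size.
  - by move=> i _; apply: (sz_lt (k := 1)) => //; apply: in_speed_sz.
  move=> i t' im vi fr; rewrite /in_speed; case sE: (same) => //.
  apply: ratio_correct; rewrite ?fr //=.
  - by apply: input_ctx_eq ix1 => a ain; apply: fr; apply: contraTneq ain => ->.
  - by rewrite vi.
  - rewrite size_s /gb /jb sE; move: im; lia.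
have G3 : t3 aACC 0 = \prod_(i < m) in_speed i.
  apply: prod_spec => //.
  - by move=> x /=; rewrite upd_other // fr2 // fr1 // (p_m px).
  - exact: small_Y m_size.
  - exact: in_speed_gt0.
  - apply: (@leq_ltn_trans in_unit); first by rewrite leq_pmulr // time_unitE.
    apply: (sz_lt (k := 2)) => //; apply: sz2_of; apply: leq_trans in_unit_le _.
    by rewrite leq_exp2l //; have := lg_gt0; move: lg => k; nia.
  - by move=> i t' im vi fr; rewrite /= vi fr // S2.
have D3 : t3 aDD 0 = common_den by rewrite fr3 // fr2.
have uZ : in_unit < Z.
  apply: (sz_lt (k := 2)) => //; apply: sz2_of; apply: leq_trans in_unit_le _.
  by rewrite leq_exp2l //; have := lg_gt0; move: lg => k; nia.
have sZ : in_scale < Z.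
  apply: (sz_lt (k := 2)) => //; apply: sz2_of; apply: leq_trans in_scale_le _.
  by rewrite leq_exp2l //; have := lg_gt0; move: lg => k; nia.
rewrite den_seq (@set_cell Y Z _ _ _ in_unit) //=; last by rewrite G3 /in_unit time_unit_factors.
rewrite den_seq (@set_cell Y Z aLAM _ _ in_scale) //=; last by rewrite [upd _ _ _ _ aDD _]D3.
rewrite (@set_cell Y Z _ _ _ (if same then in_unit else in_scale)) //=; last by case: (same).
  split=> //.
  by move=> i im; rewrite /= /upd /= fr3 // S2.
by case: (same).
Qed.

Lemma parse_data_correct t : input_ctx t -> parse_ctx t -> scale_ctx t ->
  base_ctx l n m g in_work in_release in_speed in_weight in_member (den parse_data t).
Proof.
move=> ix px sx; rewrite /parse_data.
rewrite den_seq; set c1 := fill _ aP _ _; set t1 := den c1 t.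
rewrite den_seq; set c2 := fill _ aR _ _; set t2 := den c2 t1.
rewrite den_seq; set c3 := fill _ aW _ _; set t3 := den c3 t2; set c4 := fill _ aINC _ _.
have fr1 a : a \notin assigned c1 -> t1 a = t a by apply: den_frame.
have fr2 a : a \notin assigned c2 -> t2 a = t1 a by apply: den_frame.
have fr3 a : a \notin assigned c3 -> t3 a = t2 a by apply: den_frame.
have fr4 a : a \notin assigned c4 -> den c4 t3 a = t3 a by apply: den_frame.
have ix1 : input_ctx t1 by apply: input_ctx_eq ix; apply: in_frame.
have ix2 : input_ctx t2 by apply: input_ctx_eq ix1; apply: in_frame.
have jobs_s j : j < n -> (jb + 4 * j + 2).+1 < size s.
  by move=> jn; rewrite size_s /gb; apply: leq_trans (leq_addr _ _); move: jn; lia.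
have P1 j : j < n -> t1 aP j = in_work j.
  move: j; apply: fill_spec => //.
  - by rewrite /= (p_n px).
  - exact: small_Y n_size.
  - by move=> j _; apply: (sz_lt (k := 2)) => //; apply: sz2_of; apply: in_work_le.
  move=> j t' jn vj fr; rewrite /in_work -(s_PS sx) -(fr aPS) //.
  have lt := jobs_s _ jn.
  have ix' : input_ctx t' by apply: input_ctx_eq ix => a ain; apply: fr; apply: contraTneq ain => ->.
  have e : hev t' (ratio_exp (#aJB + K 4 * #vA)%H) = scaled (jb + 4 * j).
    apply: ratio_correct => //; last by move: lt; lia.
      by rewrite fr // (s_D sx).
    by rewrite /= vj !fr // (p_jb px).
  by rewrite -e.
have R2 j : j < n -> t2 aR j = in_release j.
  move: j; apply: fill_spec => //.
  - by rewrite /= fr1 // (p_n px).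
  - exact: small_Y n_size.
  - by move=> j _; apply: (sz_lt (k := 2)) => //; apply: sz2_of; apply: in_release_le.
  move=> j t' jn vj fr; rewrite /in_release -(s_GU sx) -(fr1 aGU) // -(fr aGU) //.
  have lt := jobs_s _ jn.
  have ix' : input_ctx t' by apply: input_ctx_eq ix1 => a ain; apply: fr; apply: contraTneq ain => ->.
  have e : hev t' (ratio_exp (#aJB + K 4 * #vA + K 2)%H) = scaled (jb + 4 * j + 2).
    apply: ratio_correct => //; first by rewrite fr // fr1 // (s_D sx).
    by rewrite /= vj !fr // !fr1 // (p_jb px).
  by rewrite -e.
have groups_s S : S < g -> gb + S * (n + 2) + 2 + n <= size s.
  by move=> Sg; have := leq_mul Sg (leqnn (n + 2)); rewrite mulSn size_s -!addnA leq_add2l; clear; lia.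
have W3 S : S < g -> t3 aW S = in_weight S.
  move: S; apply: fill_spec => //.
  - by rewrite /= fr2 // fr1 // (p_g px).
  - exact: small_Y g_size.
  - by move=> S _; apply: (sz_lt (k := 2)) => //; apply: in_weight_sz.
  move=> S t' Sg vS fr; have lt := groups_s _ Sg.
  have ix' : input_ctx t' by apply: input_ctx_eq ix2 => a ain; apply: fr; apply: contraTneq ain => ->.
  apply: ratio_correct => //.
  - by rewrite fr // fr2 // fr1 // (s_D sx).
  - by rewrite /= vS !fr // !fr2 // !fr1 // (p_gb px) (p_n px).
  - by move: lt; lia.
have gn_s : g * n <= size s by rewrite size_s; apply: leq_trans (leq_addl _ _); rewrite leq_mul2l leq_addr orbT.
split.
- by rewrite fr4 // fr3 // fr2 // fr1 // (p_n px).
- by rewrite fr4 // fr3 // fr2 // fr1 // (p_m px).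
- by rewrite fr4 // fr3 // fr2 // fr1 // (p_g px).
- by rewrite fr4 // fr3 // fr2 // fr1 // (i_l ix).
- by move=> j jn; rewrite fr4 // fr3 // fr2 // P1.
- by move=> j jn; rewrite fr4 // fr3 // R2.
- by move=> i im; rewrite fr4 // fr3 // fr2 // fr1 // (s_S sx).
- by move=> S Sg; rewrite fr4 // W3.
suff H x : x < g * n -> den c4 t3 aINC x = in_member (x %/ n) (x %% n).
  by move=> S j Sg jn; rewrite H ?block_lt // divn_block // modn_block.
move: x; apply: fill_spec => //.
- by rewrite /= !fr3 // !fr2 // !fr1 // (p_n px) (p_g px).
- exact: small_Y.
- by move=> x _; case: in_member => //; apply: ltnW.
move=> x t' lt vx fr; have n0 : 0 < n by case: (n) lt => //; rewrite muln0.
have jn : x %% n < n by rewrite ltn_mod.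
have Sg : x %/ n < g by rewrite ltn_divLR.
rewrite /= vx !fr // !fr3 // !fr2 // !fr1 // (p_n px) (p_gb px) (i_IN ix).
  by rewrite /in_member; have := member_le Sg jn; case: (input _) => [|[]].
by apply: leq_trans (groups_s _ Sg); rewrite ltn_add2l.
Qed.

Definition written_out (out : nat -> nat) (k : nat) (mc st : nat -> nat) : Prop :=
  forall j, j < k -> [/\ out (3 * j) = mc j, out (3 * j + 1) = st j & out (3 * j + 2) = in_scale].

Lemma output_correct t mc st : t an 0 = n -> t aLAM 0 = in_scale ->
  (forall j, j < n -> t aBM j = mc j) -> (forall j, j < n -> t aBST j = st j) ->
  written_out (fun i => den output t rOUT (n + i)) n mc st.
Proof.
move=> nE lE mE sE; rewrite /output; set c := (_ ;; _)%C.
have vn : vA \notin assigned c by [].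
have := @for_rule Y Z (fun k t' => written_out (fun i => t' rOUT (n + i)) k mc st) vA (#an)%H c t vn.
rewrite /= nE; apply => //; first exact: small_Y n_size.
move=> i t' lt vi fr IH.
have nE' : t' an 0 = n by rewrite fr.
move=> j; rewrite ltnS leq_eqVlt => jle.
have cells x : upd (den c t') vA 0 i.+1 rOUT (n + x) =
   if x == 3 * i then mc i else if x == 3 * i + 1 then st i else if x == 3 * i + 2 then in_scale
   else t' rOUT (n + x).
  rewrite upd_other // /c den_seq; set c1 := Set_ rOUT (#an + K 3 * #vA)%H _; set t1 := den c1 t'.
  rewrite den_seq; set c2 := Set_ rOUT (#an + K 3 * #vA + K 1)%H _.
  set t2 := den c2 t1; set c3 := Set_ _ _ _.
  have fr1 a : a \notin assigned c1 -> t1 a = t' a by apply: den_frame.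
  have fr2 a : a \notin assigned c2 -> t2 a = t1 a by apply: den_frame.
  rewrite /c3 den_set upd_cell /= (fr2 an) // (fr2 vA) // (fr2 aLAM) // !fr1 // nE' vi (fr aLAM) // lE clamp_safe //.
  rewrite /t2 /c2 den_set upd_cell /= (fr1 an) // (fr1 vA) // (fr1 aBST) // nE' vi (fr aBST) // sE // clamp_safe //.
  rewrite /t1 /c1 den_set upd_cell /= nE' vi (fr aBM) // mE // clamp_safe //.
  by rewrite -!addnA !eqn_add2l; clear; repeat case: eqP => ? //; lia.
rewrite !cells; case: (j =P i) jle => [-> _|ji /= ji'].
  by split; clear; repeat case: eqP => ? //; lia.
have [h1 h2 h3] := IH j ji'; split.
- by rewrite !ifF //; apply/eqP; lia.
- by rewrite !ifF //; apply/eqP; lia.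
- by rewrite !ifF //; apply/eqP; lia.
Qed.

Lemma program_wf : wf (program same h reset).
Proof. by rewrite /program; case: (same); case: (reset). Qed.

Lemma program_correct t : input_ctx t ->
  let t' := den (program same h reset) t in
  [/\ n <= Y, t' 0 0 = n &
   exists hist i o mc st cp,
    [/\ outcome l n m h reset in_work in_release in_speed
          (block_of l n g h in_work in_release hist i o) mc st cp,
        written_out (fun i => t' rOUT (n + i)) n mc st &
        forall q, q < l * (l * l) -> explored l n m g h reset in_work in_release in_speed in_weight
          in_member q (total_cost n g in_weight in_member cp)]].
Proof.
move=> ix; rewrite /program.
rewrite den_seq; set c1 := parse_counts same; set t1 := den c1 t.
rewrite den_seq; set c2 := parse_scales same; set t2 := den c2 t1.
rewrite den_seq; set c3 := parse_data; set t3 := den c3 t2.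
rewrite den_seq; set c4 := core h reset; set t4 := den c4 t3; set t' := den output t4.
have ix1 : input_ctx t1 by apply: input_ctx_eq ix; apply: in_frame; rewrite /c1; case: (same).
have ix2 : input_ctx t2 by apply: input_ctx_eq ix1; apply: in_frame; rewrite /c2; case: (same).
have px1 : parse_ctx t1 by apply: parse_counts_correct.
have px2 : parse_ctx t2 by apply: parse_ctx_eq px1; apply: in_frame; rewrite /c2; case: (same).
have sx2 : scale_ctx t2 by apply: parse_scales_correct.
have bx3 := parse_data_correct ix2 px2 sx2.
have [bx4 ac4 ex4] := core_correct reset l_ge YE ZE (leq_trans n_size size_l) (leq_trans m_size size_l)
  (leq_trans g_size size_l) h_gt0 h_le (fun j _ => sz2_of (in_work_le j)) (fun j _ => sz2_of (in_release_le j))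
  (fun i _ => in_speed_sz i) (fun S _ => in_weight_sz S) m_gt0 bx3.
have nE : t4 an 0 = n by case: bx4.
have lam : t4 aLAM 0 = in_scale.
  rewrite /t4 den_frame; last by rewrite /c4 /core /guess /attempt; case: (reset).
  by rewrite /t3 den_frame // (s_LAM sx2).
case: ac4 => hist [i [o [mc [st [cp [oc bmE bsE bestE]]]]]]; split.
- exact: small_Y n_size.
- by rewrite /t' den_frame.
exists hist, i, o, mc, st, cp; split=> //; first exact: output_correct.
by move=> q qK; rewrite -bestE; apply: ex4.
Qed.

End Parse.

(** * Schedules of the instance and of the scaled data *)

Local Open Scope ring_scope.

(** Induction removing the job that starts last: if its duration is positive, all others have ended
    by its start, which becomes the new bound; if it is zero, the job adds nothing and is
    dropped. *)
Lemma sum_dur_le (I : finType) (st du : I -> rat) (D : {set I}) (T : rat) :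
  0 <= T -> (forall a, a \in D -> [/\ 0 <= st a, 0 <= du a & st a + du a <= T]) ->
  (forall a b, a \in D -> b \in D -> a != b -> st a + du a <= st b \/ st b + du b <= st a) ->
  \sum_(a in D) du a <= T.
Proof.
move: {-1}(#|D|) (leqnn #|D|) => k; elim: k D T => [|k IHk] D T Dk T0 ok apart.
  by move: Dk; rewrite leqn0 cards_eq0 => /eqP->; rewrite big_set0.
have [->|[a0 a0D]] := set_0Vmem D; first by rewrite big_set0.
case: (Order.TotalTheory.arg_maxP st a0D) => a aD' amax; have {aD'}aD : a \in D := aD'.
rewrite (big_setD1 a) //=; have [sa da ea] := ok a aD.
have Dk' : (#|D :\ a| <= k)%N by move: Dk; rewrite (cardsD1 a D) aD.
have sub b : b \in D :\ a -> b \in D by rewrite !inE => /andP[].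
have apart' b c : b \in D :\ a -> c \in D :\ a -> b != c ->
    st b + du b <= st c \/ st c + du c <= st b by move=> /sub bD /sub cD; apply: apart.
have [da0|da0] := eqVneq (du a) 0.
  by rewrite da0 add0r; apply: (IHk) => // b /sub; apply: ok.
suff : \sum_(i in D :\ a) du i <= st a by lra.
apply: IHk => // b bD'; have bD := sub b bD'; have [sb db eb] := ok b bD; split=> //.
have ba : b != a by move: bD'; rewrite !inE => /andP[].
have sba : st b <= st a := amax b bD; case: (apart b a bD aD ba) => // sab.
have da1 : 0 < du a by rewrite lt0r da0 da.
by lra.
Qed.

Section Link.

Variables (M : nat) (J : job_data) (speed : 'I_M -> rat) (dur : 'I_M -> 'I_(njobs J) -> rat).
Local Notation n := (njobs J).
Local Notation g := (size (groups J)).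
Local Notation group S := (nth (set0, 0) (groups J) S).
Hypothesis durE : forall i j, dur i j = proc j / speed i.
Hypothesis speed_gt0 : forall i, 0 < speed i.
Hypothesis J_ok : valid_jobs J.

Variables (m Lam D : nat) (cs : rat) (P r sp w : nat -> nat) (inc : nat -> nat -> bool).
Hypotheses (Lam_gt0 : (0 < Lam)%N) (D_gt0 : (0 < D)%N) (m_le : (m <= M)%N) (m_gt0 : (0 < m)%N).
Hypothesis PE : forall j : 'I_n, (P j)%:R = Lam%:R * cs * proc j.
Hypothesis rE : forall j : 'I_n, (r j)%:R = Lam%:R * release j.
Hypothesis spE : forall i : 'I_M, (sp i)%:R = cs * speed i.
Hypothesis wE : forall S, (S < g)%N -> (w S)%:R = D%:R * (group S).2.
Hypothesis incE : forall S (j : 'I_n), (S < g)%N -> inc S j = (j \in (group S).1).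
Hypothesis m_cases : m = M \/ ((forall i, sp i = 1%N) /\ (0 < n -> m = minn M n)%N).

Local Notation Lr := (Lam%:R : rat).

Lemma Lr_gt0 : 0 < Lr. Proof. by rewrite ltr0n. Qed.

Lemma dur_ge0 i (j : 'I_n) : 0 <= dur i j.
Proof. by case: J_ok => p0 _ _ _; rewrite durE divr_ge0 ?p0 // ltW. Qed.

Lemma dur_scaled i (j : 'I_n) : Lr * dur i j * (sp i)%:R = (P j)%:R.
Proof. by rewrite durE spE PE; have := speed_gt0 i => s0; field; lra. Qed.

(** * The levels of an arbitrary feasible schedule *)

Section Adversary.

Variable s : schedule M n.
Hypothesis feas : feasible_schedule dur s.
Local Notation tau j := (Lr * completion dur s j).

Variable K : nat.

(** The first grid level not below the scaled completion time, and [K] if there is none among the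
    first [K]; indices that are no jobs get 0. *)
Definition level (j : nat) : nat :=
  if insub j is Some o then find (fun k => tau (o : 'I_n) <= (grid k)%:R) (iota 0 K) else 0%N.

Lemma level_le j : (level j <= K)%N.
Proof. by rewrite /level; case: insubP => // o _ _; rewrite -[X in (_ <= X)%N](size_iota 0) find_size. Qed.

Lemma level_ord (j : 'I_n) : level j = find (fun k => tau j <= (grid k)%:R) (iota 0 K).
Proof. by rewrite /level valK. Qed.

Lemma level_spec (j : 'I_n) : (level j < K)%N -> tau j <= (grid (level j))%:R.
Proof.
rewrite level_ord => lt; have := @nth_find _ 0%N (fun k => tau j <= (grid k)%:R) (iota 0 K).
by rewrite nth_iota // add0n; apply; rewrite has_find size_iota.
Qed.

Lemma level_low (j : 'I_n) k : (k < level j)%N -> (grid k)%:R < tau j.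
Proof.
move=> lt; have kK := leq_trans lt (level_le j); move: lt; rewrite level_ord => lt.
by have := before_find 0%N lt; rewrite nth_iota // add0n => /negbT; rewrite -ltNge.
Qed.

Lemma start_ge0 (j : 'I_n) : 0 <= start s j.
Proof. by case: J_ok => _ r0 _ _; apply: le_trans (r0 j) _; apply: feas.1. Qed.

Lemma release_tau (j : 'I_n) : (r j)%:R <= tau j.
Proof.
rewrite rE ler_pM2l ?Lr_gt0 //; apply: le_trans (feas.1 j) _.
by rewrite /completion lerDl dur_ge0.
Qed.

Lemma dur_tau (j : 'I_n) : Lr * dur (machine_of s j) j <= tau j.
Proof. by rewrite ler_pM2l ?Lr_gt0 // lerDr start_ge0. Qed.

Lemma work_le (j : 'I_n) k : tau j <= (grid k)%:R -> (P j <= sp (machine_of s j) * grid k)%N.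
Proof.
move=> le; rewrite -(ler_nat rat) natrM -(dur_scaled (machine_of s j)) mulrC.
by rewrite ler_wpM2l ?ler0n //; apply: le_trans (dur_tau j) le.
Qed.

Lemma sp_top (i : 'I_M) : (sp i <= top_speed m sp)%N.
Proof.
case: m_cases => [mM|[sp1 _]].
  have im : (i < m)%N by rewrite mM.
  exact: (@bigop.leq_bigmax_cond _ xpredT (fun i : 'I_m => sp i) (Ordinal im)).
rewrite sp1 -(sp1 0%N).
exact: (@bigop.leq_bigmax_cond _ xpredT (fun i : 'I_m => sp i) (Ordinal m_gt0)).
Qed.

Lemma level_eligible j : (j < n)%N -> nontrivial P r j -> (level j < K)%N ->
  eligible m P r sp grid j (level j).
Proof.
move=> jn _; rewrite -[j]/(val (Ordinal jn)); move: (Ordinal jn) => {jn} o lt.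
have le := level_spec lt; apply/andP; split.
  by rewrite -(ler_nat rat); apply: le_trans (release_tau o) le.
by apply: leq_trans (work_le le) _; rewrite leq_mul2r sp_top orbT.
Qed.

Lemma machine_load (A : {set 'I_n}) (i : 'I_M) k : (forall a, a \in A -> tau a <= (grid k)%:R) ->
  (\sum_(a in A | machine_of s a == i) P a <= sp i * grid k)%N.
Proof.
move=> le; rewrite -(ler_nat rat) natr_sum natrM.
have -> : \sum_(a in A | machine_of s a == i) (P a)%:R =
    (sp i)%:R * \sum_(a in [set a in A | machine_of s a == i]) Lr * dur i a.
  rewrite big_distrr /=; apply: eq_big => [a|a /andP[_ _]]; first by rewrite inE.
  by rewrite -(dur_scaled i) mulrC.
rewrite ler_wpM2l ?ler0n //; apply: (@sum_dur_le _ (fun a => Lr * start s a)); rewrite ?ler0n //.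
  move=> a; rewrite inE => /andP[aA /eqP ai].
  have L0 := ltW Lr_gt0; rewrite !mulr_ge0 ?start_ge0 ?dur_ge0 //; split=> //.
  by rewrite -ai -mulrDr; apply: le.
move=> a b; rewrite !inE => /andP[_ /eqP ai] /andP[_ /eqP bi] ab.
rewrite -!mulrDr !ler_pM2l ?Lr_gt0 // -{1}ai -bi; apply: feas.2 => //.
by rewrite ai bi.
Qed.

(** The jobs counted are grouped by the machines they use, each of which could do [j] in time. Only
    identical machines have been reduced in number; there, the machines used number at most both [M]
    and the number of jobs, hence at most [m]. *)
Lemma level_capacity j k : (j < n)%N -> (k < K)%N ->
  (\sum_(a < n | [&& nontrivial P r a, level a <= k & P j <= P a]) P a <= cap1 m P sp grid j k)%N.
Proof.
move=> jn kK; apply: leq_trans (leq_addr _ _).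
pose A := [set a : 'I_n | [&& nontrivial P r a, level a <= k & P j <= P a]%N].
have tauA a : a \in A -> tau a <= (grid k)%:R.
  rewrite inE => /and3P[_ lk _]; apply: le_trans (level_spec (leq_ltn_trans lk kK)) _.
  by rewrite ler_nat (th_le grid_mono).
have PA a : a \in A -> (P j <= sp (machine_of s a) * grid k)%N.
  move=> aA; have := work_le (tauA a aA); apply: leq_trans.
  by move: aA; rewrite inE => /and3P[].
pose used := machine_of s @: A.
have -> : (\sum_(a < n | [&& nontrivial P r a, level a <= k & P j <= P a]) P a = \sum_(a in A) P a)%N.
  by apply: eq_bigl => a; rewrite inE.
rewrite (partition_big_imset (machine_of s)) /=.
apply: (@leq_trans (\sum_(i in used) sp i * grid k)%N).
  by apply: leq_sum => i _; apply: machine_load.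
rewrite /capacity mulnC big_distrl /=.
case: m_cases => [mM|[sp1 mn]].
  rewrite mM [X in (_ <= X)%N](bigID (mem used)) /=; apply: leq_trans (leq_addr _ _).
  by apply: leq_sum => i /imsetP[a aA ->]; rewrite PA // mul1n.
have [A0|[a aA]] := set_0Vmem A; first by rewrite /used A0 imset0 big_set0.
have Pj := PA a aA; rewrite !sp1 in Pj.
rewrite (eq_bigr (fun=> grid k)) => [|i _]; last by rewrite sp1 mul1n.
rewrite [X in (_ <= X)%N](eq_bigr (fun=> grid k)) => [|i _]; last by rewrite !sp1 Pj !mul1n.
rewrite !sum_nat_const card_ord leq_mul2r; apply/orP; right.
rewrite (mn (leq_ltn_trans (leq0n j) jn)) leq_min; apply/andP; split.
  by rewrite -[X in (_ <= X)%N]card_ord max_card.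
apply: leq_trans (leq_imset_card _ _) _.
by rewrite -[X in (_ <= X)%N]card_ord max_card.
Qed.

(* [time_unit] is hidden behind a variable: tactics would otherwise compute with it in unary. *)
Variable U : nat.
Hypothesis UE : time_unit = U.
Hypothesis work_unit : forall (i : 'I_M) (j : 'I_n), (0 < P j -> U * sp i <= P j)%N.
Hypothesis release_unit : forall j : 'I_n, (0 < r j -> U <= r j)%N.

Lemma tau_unit (j : 'I_n) : nontrivial P r j -> U%:R <= tau j.
Proof.
have [r0|r0] := posnP (r j); last first.
  by move=> _; apply: le_trans (release_tau j); rewrite ler_nat release_unit.
rewrite /nontrivial r0 addn0 => P0; apply: le_trans (dur_tau j).
have sp0 : 0 < (sp (machine_of s j))%:R :> rat.
  have : 0 < (P j)%:R :> rat by rewrite ltr0n.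
  rewrite -(dur_scaled (machine_of s j)) => h.
  have : 0 <= (sp (machine_of s j))%:R :> rat by rewrite ler0n.
  by rewrite le0r => /orP[/eqP z|//]; rewrite z mulr0 ltxx in h.
have := work_unit (machine_of s j) P0; rewrite -(ler_nat rat) natrM -(dur_scaled (machine_of s j)).
by rewrite (ler_pM2r sp0).
Qed.

(** Above the first positive grid time, rounding up loses at most one grid ratio. Level 1 costs
    nothing, since a nontrivial job does not complete before one time unit. *)
Lemma level_tau (j : 'I_n) : nontrivial P r j -> 40 * (grid (level j))%:R <= 41 * tau j.
Proof.
move=> nj; have u := tau_unit nj; have u0 : 0 <= U%:R :> rat by rewrite ler0n.
case lE: (level j) => [|[|k]]; first by rewrite mulr0; lra.
  by rewrite [grid 1]/= UE; lra.
have := level_low (j := j) (k := k.+1); rewrite lE => /(_ (ltnSn _)) low.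
have := grid_up (ltn0Sn k); rewrite -(ler_nat rat) !natrM; lra.
Qed.

Lemma level_cost : 40 * (lev_cost n g P r w inc grid level)%:R <=
  41 * (D%:R * Lr) * weighted_completion dur s.
Proof.
rewrite /weighted_completion (big_nth (set0, 0)) big_mkord natr_sum !big_distrr /=.
apply: ler_sum => S _; rewrite natrM (wE (ltn_ord S)) mulrCA.
have w0 : 0 < (group S).2 by case: J_ok => _ _ _; apply; rewrite mem_nth.
suff H : 40 * (grid (group_lev n P r inc level S))%:R <= 41 * (Lr * group_completion dur s (group S).1).
  have D0 : 0 <= (D%:R : rat) * (group S).2 by rewrite mulr_ge0 ?ler0n ?ltW.
  apply: le_trans (ler_wpM2l D0 H) _; move: (group_completion _ _ _) => b.
  by rewrite le_eqVlt; apply/orP; left; apply/eqP; ring.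
have c0 : 0 <= group_completion dur s (group S).1.
  by rewrite /group_completion; apply: bigmax_ge_id.
have [[j /andP[iS nj] ->]|->] : (exists2 j : 'I_n, inc S j && nontrivial P r j &
    group_lev n P r inc level S = level j) \/ group_lev n P r inc level S = 0%N.
- case: (pickP (fun j : 'I_n => inc S j && nontrivial P r j)) => [j0 ok0|none]; last first.
    by right; rewrite /group_lev big_pred0.
  left; have c0' : (0 < #|[pred j : 'I_n | inc S j && nontrivial P r j]|)%N by apply/card_gt0P; exists j0.
  have [j jin E] := @bigop.eq_bigmax_cond _ [pred j : 'I_n | inc S j && nontrivial P r j]
    (fun j : 'I_n => level j) c0'.
  by exists j.
- rewrite /=; apply: le_trans (level_tau nj) _; rewrite ler_pM2l // ler_pM2l ?Lr_gt0 //.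
  by rewrite /group_completion; apply: le_bigmax_cond; rewrite -incE.
- by rewrite mulr0 !mulr_ge0 ?ler0n.
Qed.

End Adversary.

(** * From integer times back to a schedule of the instance *)

Section Result.

Variables (mc st cp : nat -> nat).
Hypothesis sp_gt0 : forall i, (i < m)%N -> (0 < sp i)%N.
Hypothesis sp_dvd : forall j i, (j < n)%N -> (i < m)%N -> (sp i %| P j)%N.
Hypothesis placed : forall a, (a < n)%N ->
  [/\ (r a <= st a)%N, (cp a = st a + P a %/ sp (mc a))%N & (mc a < m)%N].
Hypothesis apart : forall a b, (a < n)%N -> (b < n)%N -> a != b -> mc a = mc b ->
  (cp a <= st b)%N \/ (cp b <= st a)%N.

Let M_gt0 : (0 < M)%N. Proof. exact: leq_trans m_gt0 m_le. Qed.

Definition result : schedule M n :=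
  [ffun j : 'I_n => (insubd (Ordinal M_gt0) (mc j), (st j)%:R / Lr)].

Lemma result_machine (j : 'I_n) : machine_of result j = mc j :> nat.
Proof.
have [_ _ lt] := placed (ltn_ord j).
by rewrite /machine_of ffunE val_insubd (leq_trans lt m_le).
Qed.

Lemma result_start (j : 'I_n) : start result j = (st j)%:R / Lr.
Proof. by rewrite /start ffunE. Qed.

Lemma result_completion (j : 'I_n) : completion dur result j = (cp j)%:R / Lr.
Proof.
have [_ -> lt] := placed (ltn_ord j); rewrite /completion result_start natrD mulrDl; congr (_ + _).
have s0 : (sp (mc j))%:R != 0 :> rat by rewrite pnatr_eq0 -lt0n sp_gt0.
have L0 : Lr != 0 by rewrite gt_eqF ?Lr_gt0.
have := dur_scaled (machine_of result j) j; rewrite result_machine.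
rewrite -{1}(divnK (sp_dvd (ltn_ord j) lt)) natrM => /(mulIf s0) <-.
by rewrite mulrC mulKf.
Qed.

Lemma result_feasible : feasible_schedule dur result.
Proof.
have Li : 0 < Lr^-1 by rewrite invr_gt0 Lr_gt0.
split=> [j|j k jk jkm].
  have [le _ _] := placed (ltn_ord j).
  by rewrite result_start ler_pdivlMr ?Lr_gt0 // mulrC -rE ler_nat.
rewrite !result_completion !result_start !(ler_pM2r Li) !ler_nat.
by apply: apart => //; rewrite -!result_machine jkm.
Qed.

Lemma result_cost : D%:R * Lr * weighted_completion dur result <= (total_cost n g w inc cp)%:R.
Proof.
rewrite /weighted_completion (big_nth (set0, 0)) big_mkord natr_sum big_distrr /=.
apply: ler_sum => S _; rewrite natrM (wE (ltn_ord S)).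
have w0 : 0 < (group S).2 by case: J_ok => _ _ _; apply; rewrite mem_nth.
set mx := (\max_(j < n) _)%N.
suff H : group_completion dur result (group S).1 <= mx%:R / Lr.
  rewrite ler_pdivlMr ?Lr_gt0 // in H.
  have D0 : 0 <= (D%:R : rat) * (group S).2 by rewrite mulr_ge0 ?ler0n ?ltW.
  apply: le_trans (ler_wpM2l D0 H); move: (group_completion _ _ _) => b.
  by rewrite le_eqVlt; apply/orP; left; apply/eqP; ring.
rewrite /group_completion; apply: bigmax_le; first by rewrite divr_ge0 ?ler0n.
move=> j jS; rewrite result_completion ler_pM2r ?invr_gt0 ?Lr_gt0 // ler_nat.
have -> : cp j = (inc S j * cp j)%N by rewrite incE // jS mul1n.
exact: (@bigop.leq_bigmax_cond _ xpredT (fun j : 'I_n => inc S j * cp j)%N j).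
Qed.

End Result.

End Link.

Local Close Scope ring_scope.

(** * The two algorithms *)

Lemma size_flatten_const (T : Type) (f : T -> seq nat) c (t : seq T) :
  (forall x, size (f x) = c) -> size (flatten (map f t)) = size t * c.
Proof. by move=> fc; elim: t => //= x t IH; rewrite size_cat fc IH. Qed.

Lemma nth_flatten_const (T : Type) (x0 : T) (f : T -> seq nat) c (t : seq T) k i :
  (forall x, size (f x) = c) -> k < size t -> i < c ->
  nth 0 (flatten (map f t)) (k * c + i) = nth 0 (f (nth x0 t k)) i.
Proof.
move=> fc; elim: t k => // x t IH [|k] lt ic /=; rewrite nth_cat fc; first by rewrite mul0n ic.
by rewrite ifF; [rewrite mulSn -addnA addKn IH|apply/negbTE; rewrite -leqNgt mulSn -addnA leq_addr].
Qed.

(** The input word has no end mark, and its length is recovered from the three header cells. *)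
Definition len_exp (same : bool) : expr :=
  let n := Fetch (Const 1) in
  Defs.Add (if same then Const 3 else Defs.Add (Const 3) (Defs.Mul (Const 2) (Fetch (Const 0))))
    (Defs.Add (Defs.Mul (Const 4) n) (Defs.Mul (Fetch (Const 2)) (Defs.Add n (Const 2)))).

(** Chains the output schedule to its integer cost ([tot]), this to the level cost of the competing
    schedule ([lev]), and that to its true cost; [x] is the joint scale of time and weights. *)
Lemma combine_bounds (tot lev rt x a b : rat) : (0 < x -> 0 <= rt -> x * a <= tot ->
  40%:R * lev <= 41%:R * x * b -> 40%:R * tot <= rt * lev -> 1600%:R * a <= 41%:R * rt * b)%R.
Proof.
move=> x0 rt0 le_a le_lev le_tot; rewrite -(ler_pM2l x0).
have := ler_wpM2l rt0 le_lev; lra.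
Qed.

Section Instance.

Variables (same : bool) (M : nat) (J : job_data) (speed : 'I_M -> rat)
  (dur : 'I_M -> 'I_(njobs J) -> rat).
Local Notation n := (njobs J).
Local Notation g := (size (groups J)).
Local Notation group S := (nth (set0, 0%R) (groups J) S).
Hypothesis durE : forall i j, dur i j = (proc j / speed i)%R.
Hypothesis speed_gt0 : forall i, (0 < speed i)%R.
Hypothesis same1 : same -> forall i, speed i = 1%R.
Hypothesis J_ok : valid_jobs J.
Hypothesis M_gt0 : 0 < M.

Let s := [:: M; n; g] ++ (if same then [::] else flatten [seq encode_rat (speed i) | i <- enum 'I_M]) ++
  encode_jobs J.
Let input := nth 0 s.
Let h := if same then 1 else 40.
Let reset := ~~ same.
Let m := if same then minn M n + (n == 0) else M.
Let jb := if same then 3 else 3 + 2 * m.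
Let gb := jb + 4 * n.
Local Notation D := (common_den s).
Local Notation work := (in_work same s).
Local Notation release := (in_release same s).
Local Notation sp := (in_speed same s).
Local Notation wt := (in_weight same s).
Local Notation inc := (in_member same s).
Local Notation unit := (in_unit same s).

Definition job_code (j : 'I_n) : seq nat := encode_rat (proc j) ++ encode_rat (Defs.release j).
Definition group_code (G : {set 'I_n} * rat) : seq nat :=
  encode_rat G.2 ++ [seq nat_of_bool (j \in G.1) | j <- enum 'I_n].
Lemma size_group G : size (group_code G) = n + 2.
Proof. by rewrite size_cat size_map size_enum_ord addnC. Qed.

Lemma size_speeds : size (if same then [::] else flatten [seq encode_rat (speed i) | i <- enum 'I_M])
  = jb - 3.
Proof.
rewrite /jb /m; case: same => //.
by rewrite (@size_flatten_const _ _ 2) // size_enum_ord; lia.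
Qed.

Lemma jb_ge : 3 <= jb. Proof. by rewrite /jb; case: same. Qed.

Lemma input_jobs k : input (jb + k) = nth 0 (encode_jobs J) k.
Proof.
rewrite /input /s nth_cat /= ifF; last by have := jb_ge; lia.
rewrite nth_cat size_speeds ifF; last by have := jb_ge; lia.
by congr nth; have := jb_ge; lia.
Qed.

Lemma jobs_size : size (flatten [seq job_code j | j <- enum 'I_n]) = 4 * n.
Proof. by rewrite (@size_flatten_const _ _ 4) // size_enum_ord mulnC. Qed.

Lemma input_job (j : 'I_n) i : i < 4 -> input (jb + 4 * j + i) = nth 0 (job_code j) i.
Proof.
move=> i4; rewrite -addnA input_jobs /encode_jobs nth_cat -/(job_code) jobs_size ifT; last first.
  by have := ltn_ord j; lia.
by rewrite mulnC (@nth_flatten_const _ j _ 4) ?size_enum_ord // nth_ord_enum.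
Qed.

Lemma input_group S i : S < g -> i < n + 2 ->
  input (gb + S * (n + 2) + i) = nth 0 (group_code (group S)) i.
Proof.
move=> Sg i2.
have -> : gb + S * (n + 2) + i = jb + (4 * n + (S * (n + 2) + i)) by rewrite /gb; lia.
rewrite input_jobs /encode_jobs nth_cat -/(job_code) jobs_size ifF; last by lia.
by rewrite addKn (@nth_flatten_const _ (set0, 0%R) group_code (n + 2)) //; apply: size_group.
Qed.

Lemma size_input : size s = gb + g * (n + 2).
Proof.
rewrite /s !size_cat /= size_speeds jobs_size (@size_flatten_const _ group_code (n + 2)).
  by rewrite /gb; have := jb_ge; lia.
exact: size_group.
Qed.

Lemma input_member S (j : 'I_n) : S < g -> input (gb + S * (n + 2) + 2 + j) = (j \in (group S).1).
Proof.
move=> Sg; rewrite -[_ + 2 + _]addnA input_group //; last by rewrite addnC ltn_add2r.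
by rewrite /= add0n (nth_map j) ?size_enum_ord // nth_ord_enum.
Qed.

Lemma input_speed (i : 'I_M) : same = false ->
  input (3 + 2 * i) = `|numq (speed i)|%N /\ input (3 + 2 * i).+1 = `|denq (speed i)|%N.
Proof.
move=> sE; have nthE k : k < 2 -> input (3 + (i * 2 + k)) = nth 0 (encode_rat (speed i)) k.
  move=> k2; rewrite /input /s sE nth_cat /= addnC addnK nth_cat.
  have lt : i * 2 + k < size (flatten [seq encode_rat (speed i) | i <- enum 'I_M]).
    by rewrite (@size_flatten_const _ _ 2) // size_enum_ord; have := ltn_ord i; lia.
  by rewrite lt (@nth_flatten_const _ i _ 2) ?size_enum_ord // nth_ord_enum.
by have := nthE 0 isT; have := nthE 1 isT; rewrite addn0 addn1 addnS mulnC.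
Qed.

Lemma scaled_rat (q : rat) i : (0 <= q)%R -> i.+1 < size s ->
  input i = `|numq q|%N -> input i.+1 = `|denq q|%N ->
  ((scaled s i)%:R = D%:R * q :> rat)%R.
Proof.
move=> q0 lt ni di.
have d0 : 0 < input i.+1 by rewrite di absz_gt0 denq_eq0.
have dr : ((denq q)%:~R != 0 :> rat)%R by rewrite intr_eq0 denq_eq0.
have dE : ((input i.+1)%:R = (denq q)%:~R :> rat)%R by rewrite di natr_absz ger0_norm ?denq_ge0.
have nE : ((input i)%:R = (numq q)%:~R :> rat)%R by rewrite ni natr_absz ger0_norm ?numq_ge0.
have := congr1 (fun x : nat => x%:R : rat)%R (scaledE lt d0); rewrite !natrM -/input dE nE => e.
by apply: (mulIf dr); rewrite e mulrC -mulrA; congr (_ * _)%R; rewrite -{2}(divq_num_den q) divfK.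
Qed.

Let h_gt0 : 0 < h. Proof. by rewrite /h; case: same. Qed.
Let h_le : h <= 40. Proof. by rewrite /h; case: same. Qed.
Let m_gt0 : 0 < m.
Proof. by rewrite /m; case: same => //; have [->|n0] := posnP n; rewrite ?addn1 // addn0 leq_min M_gt0. Qed.
Let m_le : m <= M.
Proof.
rewrite /m; case: same => //; have [->|n0] := posnP n; first by rewrite minn0.
by rewrite addn0 geq_minl.
Qed.

Let speed_pos i : same = false -> i < m -> 0 < input (3 + 2 * i) /\ 0 < input (3 + 2 * i).+1.
Proof.
move=> sE im; have iM : i < M by apply: leq_trans im m_le.
have [-> ->] := input_speed (Ordinal iM) sE; rewrite !absz_gt0 denq_eq0; split=> //.
by rewrite numq_eq0 gt_eqF // speed_gt0.
Qed.

Let member_le S j : S < g -> j < n -> input (gb + S * (n + 2) + 2 + j) <= 1.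
Proof. by move=> Sg jn; rewrite (input_member (Ordinal jn) Sg); case: (_ \in _). Qed.

Let D_gt0 : 0 < D. Proof. exact: common_den_gt0. Qed.
Let sp_gt0 i : i < m -> 0 < sp i.
Proof. exact: (in_speed_gt0 h_gt0 h_le size_input m_gt0 speed_pos). Qed.

Let unitE : unit = (\prod_(i < m) sp i) * time_unit. Proof. by []. Qed.
Let G_gt0 : 0 < \prod_(i < m) sp i.
Proof. by rewrite prodn_cond_gt0 // => i _; apply: sp_gt0. Qed.
Let time_unit_gt0 : 0 < time_unit. Proof. by rewrite time_unitE. Qed.
Let unit_gt0 : 0 < unit. Proof. by rewrite unitE muln_gt0 G_gt0. Qed.
Let Lam := in_scale same s.
Let Lam_gt0 : 0 < Lam. Proof. by rewrite /Lam muln_gt0 D_gt0. Qed.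
Let cs : rat := (if same then 1 else D%:R)%R.

Let job_bound (j : 'I_n) i : i < 4 -> jb + 4 * j + i < size s.
Proof. by move=> i4; rewrite size_input /gb; have := ltn_ord j; lia. Qed.

Lemma scaled_proc (j : 'I_n) : ((scaled s (jb + 4 * j))%:R = D%:R * proc j :> rat)%R.
Proof.
apply: scaled_rat; first by case: J_ok.
- by rewrite -[(_ + _).+1]addn1 job_bound.
- by have := input_job j (isT : 0 < 4); rewrite addn0.
- by have := input_job j (isT : 1 < 4); rewrite addn1.
Qed.

Lemma scaled_release (j : 'I_n) : ((scaled s (jb + 4 * j + 2))%:R = D%:R * Defs.release j :> rat)%R.
Proof.
apply: scaled_rat; first by case: J_ok.
- by rewrite -addnS job_bound.
- exact: input_job.
- by rewrite -addnS; apply: input_job.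
Qed.

Lemma work_rat (j : 'I_n) : ((work j)%:R = Lam%:R * cs * proc j :> rat)%R.
Proof.
rewrite /in_work /Lam /in_scale /cs -/m -/jb natrM scaled_proc; case: (same); rewrite !natrM; ring.
Qed.

Lemma release_rat (j : 'I_n) : ((release j)%:R = Lam%:R * Defs.release j :> rat)%R.
Proof. by rewrite /in_release /Lam /in_scale natrM scaled_release natrM; ring. Qed.

Lemma speed_rat (i : 'I_M) : ((sp i)%:R = cs * speed i :> rat)%R.
Proof.
rewrite /in_speed /cs; case sE: {1 2}same; first by rewrite same1 ?mulr1.
have [h0 h1] := input_speed i sE.
apply: scaled_rat => //; first exact/ltW/speed_gt0.
by rewrite size_input /gb /jb /m sE; have := ltn_ord i; lia.
Qed.

Lemma weight_rat S : S < g -> ((wt S)%:R = D%:R * (group S).2 :> rat)%R.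
Proof.
move=> Sg; have w0 : (0 < (group S).2)%R by case: J_ok => _ _ _; apply; rewrite mem_nth.
apply: scaled_rat; first exact: ltW.
- have := leq_mul Sg (leqnn (n + 2)); rewrite mulSn size_input -[nth 0 s 1]/n -/m -/jb -/gb.
  by move: (S * _) (g * _) gb; clear; lia.
- by have := @input_group S 0 Sg; rewrite addn0; apply; rewrite addn2.
- by have := @input_group S 1 Sg; rewrite addn1; apply; rewrite addn2.
Qed.

Lemma member_rat S (j : 'I_n) : S < g -> inc S j = (j \in (group S).1).
Proof. by move=> Sg; rewrite /in_member [nth 0 s _](input_member j Sg); case: (_ \in _). Qed.

Lemma speed_unit i : i < m -> sp i <= \prod_(k < m) sp k.
Proof.
move=> im; rewrite (bigD1 (Ordinal im)) //= leq_pmulr // prodn_cond_gt0 // => k _.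
exact: sp_gt0.
Qed.

Lemma work_dvd j i : j < n -> i < m -> sp i %| work j.
Proof.
move=> jn im; have [sE|sE] : same = true \/ same = false by case: same; [left|right].
  by rewrite /in_speed sE dvd1n.
rewrite /in_work [if same then in_unit _ _ else _]ifF //.
rewrite dvdn_mull // /in_scale dvdn_mull // [in_unit _ _]unitE dvdn_mulr //.
by rewrite (bigD1 (Ordinal im)) //= dvdn_mulr.
Qed.

Let m_cases : m = M \/ ((forall i, sp i = 1) /\ (0 < n -> m = minn M n)).
Proof.
rewrite /m /in_speed; case: same; [right|by left].
by split=> // n0; rewrite (gtn_eqF n0) addn0.
Qed.

Lemma work_unit_le (i : 'I_M) (j : 'I_n) : 0 < work j -> time_unit * sp i <= work j.
Proof.
rewrite /in_work muln_gt0 => /andP[q0 _]; apply: leq_trans (leq_pmull _ q0).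
have [sE|sE] : same = true \/ same = false by case: same; [left|right].
  rewrite [if same then in_unit _ _ else _]ifT // /in_speed ifT // muln1 [in_unit _ _]unitE.
  exact: leq_pmull.
rewrite [if same then in_unit _ _ else _]ifF //.
have im : i < m by rewrite /m sE.
rewrite /in_scale; apply: leq_trans (leq_pmull _ D_gt0).
by rewrite [in_unit _ _]unitE mulnC leq_mul2r speed_unit ?orbT.
Qed.

Lemma release_unit_le (j : 'I_n) : 0 < release j -> time_unit <= release j.
Proof.
rewrite /in_release muln_gt0 => /andP[q0 _]; apply: leq_trans (leq_pmull _ q0).
by rewrite [in_unit _ _]unitE leq_pmull.
Qed.

Lemma weight_gt0 S : S < g -> 0 < wt S.
Proof.
move=> Sg; rewrite -(ltr0n rat) weight_rat // mulr_gt0 ?ltr0n //.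
by case: J_ok => _ _ _; apply; rewrite mem_nth.
Qed.

(** The guaranteed factor over the level cost, in 40ths; the rounding to levels later multiplies it
    by 41/40. *)
Definition ratio : nat := if same then 205 else 410.

Lemma program_ratio l lev best : l = 2000 * bits (\prod_(x <- s) x.+2) ->
  (forall j, lev j <= l * l) ->
  (forall j, j < n -> nontrivial work release j -> lev j < l * l ->
     eligible m work release sp grid j (lev j)) ->
  (forall j k, j < n -> k < l * l ->
     \sum_(a < n | [&& nontrivial work release a, lev a <= k & work j <= work a]) work a
       <= cap1 m work sp grid j k) ->
  (forall q, q < l * (l * l) -> explored l n m g h reset work release sp wt inc q best) ->
  40 * best <= ratio * lev_cost n g work release wt inc grid lev.
Proof.
move=> lE lev_le el cap ex.
have l0 : 0 < l by rewrite lE.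
have bh j : j < n -> release j + \sum_(a < n) work a <= grid (l * l).
  by move=> _; rewrite lE; apply: (in_horizon h_gt0 h_le size_input m_gt0).
have lc : lev_cost n g work release wt inc grid lev <= grid (l * (l * l)).
  by rewrite lE; apply: (in_lev_cost_le h_gt0 h_le size_input m_gt0); rewrite -lE.
have [sE|sE] : same = true \/ same = false by case: same; [left|right].
  have -> : ratio = 205 by rewrite /ratio sE.
  apply: (same_best l0 h_gt0 m_gt0 sp_gt0 work_dvd bh lev_le el cap ex weight_gt0 lc).
  - by rewrite /reset sE.
  - by rewrite /h sE.
  - by move=> p p' _ _; rewrite /in_speed sE.
have -> : ratio = 410 by rewrite /ratio sE.
apply: (reset_best l0 h_gt0 m_gt0 sp_gt0 work_dvd bh lev_le el cap ex weight_gt0 lc).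
- by rewrite /reset sE.
- by rewrite /h sE.
Qed.

Lemma len_exp_correct (mem : memory) : (forall i, i < 3 -> mem i = nth 0 s i) ->
  eval mem (len_exp same) = size s.
Proof.
move=> memE; rewrite size_input /gb /jb /m.
have e0 := memE 0 isT; have e1 := memE 1 isT; have e2 := memE 2 isT.
rewrite /= in e0 e1 e2; rewrite /len_exp /=; case: same => /=; rewrite ?e0 e1 e2 addnA //.
Qed.

Let whole_cost := (fun x => let Y := (2000 * (3 * x + 1)) ^ 30 in
   (prelude_cost (len_exp same) Y + (ccost Y Y.+3 (program same h reset) +
     (ecost (Fetch (Const 0)) * Y.+3 + epilogue_cost Y.+3 Y).+1).+1).+1).

Lemma instance_run : runs (whole (len_exp same) (program same h reset)) (init_memory s)
  (whole_cost (input_size s))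
  (fun mem => exists res : schedule M n, [/\ written_schedule res mem, feasible_schedule dur res &
     forall s', feasible_schedule dur s' ->
       (1600%:R * weighted_completion dur res <=
        41%:R * ratio%:R * weighted_completion dur s')%R]).
Proof.
pose l := 2000 * bits (\prod_(x <- s) x.+2).
pose Out (out : nat -> nat) := exists hist i o mc st cp,
  [/\ outcome l n m h reset work release sp (block_of l n g h work release hist i o) mc st cp,
      written_out same s out n mc st &
      forall q, q < l * (l * l) -> explored l n m g h reset work release sp wt inc q
        (total_cost n g wt inc cp)].
apply: runs_weaken (whole_correct (n := n) (Out := Out) _ (program_wf same h reset) len_exp_correct _)
  (leqnn _) _.
- by rewrite size_input /gb; have := jb_ge; lia.
- move=> st _ stL stI.
  exact: (program_correct reset h_gt0 h_le size_input member_le m_gt0 speed_pos (erefl _) (erefl _)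
    (InputCtx stI stL)).
move=> mem [out [hist [i [o [mc [st [cp [oc wo ex]]]]]]] memE].
have [f1 f2] := outcome_feasible h_gt0 oc.
have placed a : a < n -> [/\ release a <= st a, cp a = st a + work a %/ sp (mc a) & mc a < m].
  by move=> an; case: (f1 a an).
have [U UE] : exists U, time_unit = U by eexists.
have wu (k : 'I_M) (j : 'I_n) : 0 < work j -> U * sp k <= work j by rewrite -UE; apply: work_unit_le.
have ru (j : 'I_n) : 0 < release j -> U <= release j by rewrite -UE; apply: release_unit_le.
exists (result J Lam m_le m_gt0 mc st); split.
- move=> j; have jn := ltn_ord j; have [w1 w2 w3] := wo j jn.
  rewrite !memE ?w1 ?w2 ?w3; try (move: jn; lia).
  split; first by rewrite (result_machine (P := work) (r := release) (sp := sp) Lam m_le m_gt0 placed).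
    by rewrite -/Lam; move: Lam_gt0; rewrite lt0n.
  exact: result_start.
- exact: (result_feasible durE speed_gt0 Lam_gt0 m_le m_gt0 work_rat release_rat speed_rat sp_gt0 work_dvd placed f2).
move=> s' feas.
have rc := result_cost durE speed_gt0 J_ok Lam_gt0 m_le m_gt0 work_rat speed_rat weight_rat member_rat
  sp_gt0 work_dvd placed.
have lc := level_cost durE speed_gt0 J_ok Lam_gt0 work_rat release_rat speed_rat weight_rat member_rat
  feas (l * l) UE wu ru.
have br := program_ratio (erefl l) (level_le dur Lam s' (l * l))
  (fun j => level_eligible durE speed_gt0 J_ok Lam_gt0 m_gt0 work_rat release_rat speed_rat m_cases feas
     (K := l * l) (j := j))
  (fun j k => level_capacity durE speed_gt0 J_ok release Lam_gt0 work_rat speed_rat m_cases feas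
     (K := l * l) (j := j) (k := k)) ex.
rewrite -(ler_nat rat) !natrM in br.
have x0 : (0 < D%:R * Lam%:R :> rat)%R by rewrite mulr_gt0 ?ltr0n.
have rt0 : (0 <= ratio%:R :> rat)%R by rewrite ler0n.
exact: combine_bounds x0 rt0 rc lc br.
Qed.

End Instance.

Lemma weighted_completion_ge0 m (J : job_data) (dur : 'I_m -> 'I_(njobs J) -> rat) sched :
  valid_jobs J -> (0 <= weighted_completion dur sched)%R.
Proof.
case=> _ _ _ w0; rewrite /weighted_completion big_seq sumr_ge0 // => G /w0 wG.
by apply: mulr_ge0; [exact: ltW|exact: bigmax_ge_id].
Qed.

(** The simple rational [c] separates the arithmetic from the decimal literal [q], with which only
    the closed comparison [c <= q] has to compute. *)
Lemma approx_ratio (a b : rat) (k : nat) (c q : rat) : (0 <= b)%R ->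
  (1600%:R * a <= 41%:R * k%:R * b)%R -> (41%:R * k%:R <= 1600%:R * c)%R -> (c <= q)%R ->
  (a <= q * b)%R.
Proof.
move=> b0 le kc cq; have := ler_wpM2r b0 kc; have := ler_wpM2r b0 cq.
by move: le; move: (k%:R)%R => k'; lra.
Qed.

Lemma P_ratio : (41%:R * 205%:R <= 1600%:R * 6%:R :> rat)%R. Proof. lra. Qed.
Lemma P_ratio_le : (6%:R <= 7.249%Q :> rat)%R. Proof. by vm_compute. Qed.
Lemma Q_ratio : (41%:R * 410%:R <= 1600%:R * (53%:R / 5%:R) :> rat)%R. Proof. lra. Qed.
Lemma Q_ratio_le : (53%:R / 5%:R <= 10.874%Q :> rat)%R. Proof. by vm_compute. Qed.

Theorem theorem18 :
  (exists c : cmd, approximation_algorithm P_rj_sum_wSCS 7.249%Q c) /\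
  (exists c : cmd, approximation_algorithm Q_rj_sum_wSCS 10.874%Q c).
Proof.
split.
- exists (whole (len_exp true) (program true 1 false)).
  have [T TE] := whole_poly (len_exp true) (program true 1 false).
  exists T => x [M0 J_ok].
  have durE (i : 'I_(P_machines x)) j : P_dur i j = (proc j / 1)%R by rewrite divr1.
  have [mem [t [ex le [res [wr fs opt]]]]] :=
    @instance_run true _ _ (fun=> 1%R) _ durE (fun=> ltr01) (fun _ _ => erefl) J_ok M0.
  exists mem, t, res; split=> //; first exact: leq_trans le (TE _).
  move=> s' fs'; have ge0 := weighted_completion_ge0 (@P_dur x) s' J_ok.
  exact: (approx_ratio ge0 (opt s' fs') P_ratio P_ratio_le).
- exists (whole (len_exp false) (program false 40 true)).
  have [T TE] := whole_poly (len_exp false) (program false 40 true).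
  exists T => x [M0 s0 J_ok].
  have durE (i : 'I_(Q_machines x)) j : Q_dur i j = (proc j / speed i)%R by [].
  have no : false -> forall i : 'I_(Q_machines x), speed i = 1%R by [].
  have [mem [t [ex le [res [wr fs opt]]]]] := @instance_run false _ _ _ _ durE s0 no J_ok M0.
  exists mem, t, res; split=> //; first exact: leq_trans le (TE _).
  move=> s' fs'; have ge0 := weighted_completion_ge0 (@Q_dur x) s' J_ok.
  exact: (approx_ratio ge0 (opt s' fs') Q_ratio Q_ratio_le).
Qed.
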